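(* Let $m,\ell\in\mathbb{R}$. Let $\phi:\mathbb{R}^n\times\mathbb{Z}^n\to\mathbb{R}$ be such that the function $x\mapsto e^{i\phi(x,\xi)}$ is $2\pi$-periodic for all $\xi\in\mathbb{Z}^n$. Let $T:C^\infty(\mathbb{T}^n)\to\mathcal{D}'(\mathbb{T}^n)$ be defined by $$Tu(x)=\sum_{\xi\in\mathbb{Z}^n}\int_{\mathbb{T}^n}e^{i(\phi(x,\xi)-y\cdot\xi)}\,a(x,y,\xi)\,u(y)\,(2\pi)^{-n}\mathrm{d}y,$$ where the toroidal amplitude $a\in C^\infty(\mathbb{T}^n\times\mathbb{T}^n\times\mathbb{Z}^n)$ satisfies $$|\partial_x^\alpha\partial_y^\beta a(x,y,\xi)|\le C_{\alpha\beta}\langle\xi\rangle^m$$ for every $x,y\in\mathbb{T}^n$, $\xi\in\mathbb{Z}^n$ and $\alpha,\beta\in\mathbb{N}_0^n$. Let $p\in S^\ell(\mathbb{T}^n\times\mathbb{Z}^n)=S^\ell_{1,0}(\mathbb{T}^n\times\mathbb{Z}^n)$ be a toroidal symbol and $P=p(X,D)$ the corresponding pseudo-differential operator. Then the composition $TP$ has the form $$TPu(x)=\sum_{\xi\in\mathbb{Z}^n}\int_{\mathbb{T}^n}e^{i(\phi(x,\xi)-z\cdot\xi)}\,c(x,z,\xi)\,u(z)\,(2\pi)^{-n}\mathrm{d}z,$$ where $$c(x,z,\xi)=\sum_{\eta\in\mathbb{Z}^n}\int_{\mathbb{T}^n}e^{i(y-z)\cdot(\eta-\xi)}\,a(x,y,\xi)\,p(y,\eta)\,(2\pi)^{-n}\mathrm{d}y$$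 satisfies $$|\partial_x^\alpha\partial_z^\beta c(x,z,\xi)|\le C'_{\alpha\beta}\langle\xi\rangle^{m+\ell}$$ for every $x,z\in\mathbb{T}^n$, $\xi\in\mathbb{Z}^n$ and $\alpha,\beta\in\mathbb{N}_0^n$. Moreover, there is the asymptotic expansion $$c(x,z,\xi)\sim\sum_{\alpha\ge 0}\frac{1}{\alpha!}(-D_z)^{(\alpha)}\bigl[a(x,z,\xi)\,\triangle_\xi^\alpha p(z,\xi)\bigr],$$ i.e. for every $M\in\mathbb{N}$ and all $\beta,\gamma\in\mathbb{N}_0^n$ there is a constant $C_{M\beta\gamma}$ such that $R_M:=c-\sum_{|\alpha|<M}\frac{1}{\alpha!}(-D_z)^{(\alpha)}[a\,\triangle_\xi^\alpha p]$ satisfies $|\partial_x^\beta\partial_z^\gamma R_M(x,z,\xi)|\le C_{M\beta\gamma}\langle\xi\rangle^{m+\ell-M}$ for all $x,z\in\mathbb{T}^n$, $\xi\in\mathbb{Z}^n$. Furthermore, if $0\le\delta<\rho\le 1$, $p\in S^\ell_{\rho,\delta}(\mathbb{T}^n\times\mathbb{Z}^n)$ and $a\in S^m_{\rho,\delta}(\mathbb{T}^n\times\mathbb{T}^n\times\mathbb{Z}^n)$, then $c\in S^{m+\ell}_{\rho,\delta}(\mathbb{T}^n\times\mathbb{T}^n\times\mathbb{Z}^n)$.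
   Context: $\mathbb{T}^n=(\mathbb{R}/2\pi\mathbb{Z})^n$, identified with the cube $[0,2\pi)^n$ with Lebesgue measure; functions on $\mathbb{T}^n$ are identified with $2\pi$-periodic functions on $\mathbb{R}^n$. $\langle\xi\rangle=(1+|\xi|^2)^{1/2}$. $a\in C^\infty(\mathbb{T}^n\times\mathbb{T}^n\times\mathbb{Z}^n)$ means $a(\cdot,\cdot,\xi)$ is smooth for every $\xi\in\mathbb{Z}^n$. $\mathcal{D}'(\mathbb{T}^n)$ is the space of distributions on $\mathbb{T}^n$. In the formula for $T$ (and similar ones) the integral is computed before the sum. Differences: $\triangle_{\xi_j}\sigma(\xi)=\sigma(\xi+e_j)-\sigma(\xi)$, $\triangle_\xi^\alpha=\triangle_{\xi_1}^{\alpha_1}\cdots\triangle_{\xi_n}^{\alpha_n}$. $S^\ell_{\rho,\delta}(\mathbb{T}^n\times\mathbb{Z}^n)$: functions $p(x,\xi)$ smooth in $x$ for each $\xi\in\mathbb{Z}^n$ with $|\triangle_\xi^\alpha\partial_x^\beta p(x,\xi)|\le C_{\alpha\beta}\langle\xi\rangle^{\ell-\rho|\alpha|+\delta|\beta|}$ for all $x\in\mathbb{T}^n$, $\xi\in\mathbb{Z}^n$, $\alpha,\beta\in\mathbb{N}_0^n$. $S^m_{\rho,\delta}(\mathbb{T}^n\times\mathbb{T}^n\times\mathbb{Z}^n)$: functions $a(x,y,\xi)$ smooth in $x,y$ for each $\xi\in\mathbb{Z}^n$ with $|\triangle_\xi^\alpha\partial_x^\beta\partial_y^\gamma a(x,y,\xi)|\le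 C_{\alpha\beta\gamma}\langle\xi\rangle^{m-\rho|\alpha|+\delta|\beta+\gamma|}$ for all $x,y,\xi,\alpha,\beta,\gamma$. Toroidal pseudo-differential operator: $p(X,D)f(x)=\sum_{\xi\in\mathbb{Z}^n}\int_{\mathbb{T}^n}e^{i(x-y)\cdot\xi}p(x,\xi)f(y)\,(2\pi)^{-n}\mathrm{d}y$ for $f\in C^\infty(\mathbb{T}^n)$. With $D_{z_j}=\frac{1}{i}\frac{\partial}{\partial z_j}$: $(-D_z)^{(\alpha)}=(-D_{z_1})^{(\alpha_1)}\cdots(-D_{z_n})^{(\alpha_n)}$, where $(-D_{z_j})^{(0)}=I$ and $(-D_{z_j})^{(k+1)}=(-D_{z_j})(-D_{z_j}-I)\cdots(-D_{z_j}-kI)$. *)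

(* Defs.v *)
(* MathComp-Analysis, over an arbitrary realType R; complex numbers are R[i]. *)
From HB Require Import structures.
From mathcomp Require Import all_boot all_order all_algebra.
From mathcomp Require Import complex.
From mathcomp Require Import all_classical all_reals all_analysis.

Set Implicit Arguments.
Unset Strict Implicit.
Unset Printing Implicit Defensive.

Import Order.TTheory GRing.Theory Num.Theory.
Import numFieldNormedType.Exports.

Local Open Scope classical_set_scope.
Local Open Scope complex_scope.
Local Open Scope ring_scope.

Section Toroidal.
Context {R : realType}.

Definition cabs (z : R[i]) : R := ComplexField.Normc.normc z.

Definition expi (t : R) : R[i] := cos t +i* sin t.

Section Dimension.
Context {n : nat}.

Definition basis_vec (j : 'I_n) : 'rV[R]_n := delta_mx 0 j.

Definition dot (x : 'rV[R]_n) (xi : 'rV[int]_n) : R :=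
  \sum_j x 0 j * (xi 0 j)%:~R.

Definition japanese (xi : 'rV[int]_n) : R :=
  Num.sqrt (1 + \sum_j ((xi 0 j)%:~R) ^+ 2).

(* Functions on the torus (R / 2 pi Z)^n are periodic functions on R^n. *)
Definition torus_periodic (f : 'rV[R]_n -> R[i]) : Prop :=
  forall j, periodic f ((2 * pi) *: basis_vec j).

Definition partial (j : 'I_n) (f : 'rV[R]_n -> R[i]) : 'rV[R]_n -> R[i] :=
  fun x => 'D_(basis_vec j) (fun y => complex.Re (f y)) x
        +i* 'D_(basis_vec j) (fun y => complex.Im (f y)) x.

(* The derivative 'D is a total function, so each iterated partial derivative
   (in any order of the coordinates) is required to exist, not only to be
   continuous. *)
Definition smooth (f : 'rV[R]_n -> R[i]) : Prop :=
  forall s : seq 'I_n, let g := foldr partial f s in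
  [/\ continuous (fun x => complex.Re (g x)),
      continuous (fun x => complex.Im (g x)) &
      forall x j, derivable (fun y => complex.Re (g y)) x (basis_vec j)
               /\ derivable (fun y => complex.Im (g y)) x (basis_vec j)].

Definition smooth_torus (f : 'rV[R]_n -> R[i]) : Prop :=
  smooth f /\ torus_periodic f.

Definition mi_size (alpha : 'I_n -> nat) : nat := (\sum_j alpha j)%N.

Definition mi_fact (alpha : 'I_n -> nat) : nat := (\prod_j (alpha j)`!)%N.

(* op 0 (alpha 0) \o op 1 (alpha 1) \o ... *)
Definition mi_comp (F : Type) (op : 'I_n -> nat -> F -> F)
  (alpha : 'I_n -> nat) (f : F) : F :=
  foldr (fun j g => op j (alpha j) g) f (enum 'I_n).

Definition deriv_mi : ('I_n -> nat) -> ('rV[R]_n -> R[i]) -> 'rV[R]_n -> R[i] :=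
  mi_comp (fun j k => iter k (partial j)).

Definition diff_step (j : 'I_n) (s : 'rV[int]_n -> R[i]) : 'rV[int]_n -> R[i] :=
  fun xi => s (xi + delta_mx 0 j) - s xi.

Definition diff_mi : ('I_n -> nat) ->
    ('rV[int]_n -> R[i]) -> 'rV[int]_n -> R[i] :=
  mi_comp (fun j k => iter k (diff_step j)).

Definition D_ (j : 'I_n) (f : 'rV[R]_n -> R[i]) : 'rV[R]_n -> R[i] :=
  fun z => (0 +i* 1)^-1 * partial j f z.

(* (- D_j) (- D_j - I) ... (- D_j - (k - 1) I) *)
Fixpoint negD_falling (j : 'I_n) (k : nat) (f : 'rV[R]_n -> R[i]) :
    'rV[R]_n -> R[i] :=
  if k is k'.+1 then
    negD_falling j k' (fun z => - D_ j f z - k'%:R * f z)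
  else f.

Definition negD_mi : ('I_n -> nat) -> ('rV[R]_n -> R[i]) -> 'rV[R]_n -> R[i] :=
  mi_comp negD_falling.

Definition deriv2_mi (alpha beta : 'I_n -> nat)
    (a : 'rV[R]_n -> 'rV[R]_n -> R[i]) (x y : 'rV[R]_n) : R[i] :=
  deriv_mi alpha (fun x' => deriv_mi beta (a x') y) x.

End Dimension.

Section Amplitudes.
Context {n : nat}.
Implicit Types (p : 'rV[R]_n -> 'rV[int]_n -> R[i])
  (a : 'rV[R]_n -> 'rV[R]_n -> 'rV[int]_n -> R[i]).

(* Joint smoothness on R^n x R^n, identified with R^(n + n). *)
Definition smooth_amplitude a : Prop :=
  forall xi,
  [/\ smooth (fun w : 'rV[R]_(n + n) => a (lsubmx w) (rsubmx w) xi),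
      forall y, torus_periodic (fun x => a x y xi) &
      forall x, torus_periodic (fun y => a x y xi)].

Definition bounded_amplitude (m : R) a : Prop :=
  smooth_amplitude a /\
  forall alpha beta : 'I_n -> nat, exists C : R, forall x y xi,
    cabs (deriv2_mi alpha beta (fun x' y' => a x' y' xi) x y)
      <= C * japanese xi `^ m.

Definition symbol_class (l rho delta : R) p : Prop :=
  (forall xi, smooth_torus (fun x => p x xi)) /\
  forall alpha beta : 'I_n -> nat, exists C : R, forall x xi,
    cabs (diff_mi alpha (fun zeta => deriv_mi beta (fun x' => p x' zeta) x) xi)
      <= C * japanese xi `^
             (l - rho * (mi_size alpha)%:R + delta * (mi_size beta)%:R).

Definition amplitude_class (m rho delta : R) a : Prop :=
  smooth_amplitude a /\
  forall alpha beta gamma : 'I_n -> nat, exists C : R, forall x y xi,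
    cabs (diff_mi alpha
            (fun zeta => deriv2_mi beta gamma (fun x' y' => a x' y' zeta) x y)
            xi)
      <= C * japanese xi `^
             (m - rho * (mi_size alpha)%:R
                + delta * (mi_size beta + mi_size gamma)%N%:R).

End Amplitudes.

(* Integral over the cube [0, 2 pi)^n, as an iterated Lebesgue integral. *)
Fixpoint cube_integral (n : nat) : ('rV[R]_n -> \bar R) -> \bar R :=
  match n with
  | 0 => fun f => f 0
  | k.+1 => fun f =>
      (\int[@lebesgue_measure R]_(t in [set t : R | (0 <= t < 2 * pi)%R])
        cube_integral (fun v : 'rV[R]_k => f (row_mx (t%:M : 'rV[R]_1) v)))%E
  end.

Section Operators.
Context {n : nat}.

Definition torus_integral (f : 'rV[R]_n -> R[i]) : R[i] :=
  fine (cube_integral (fun x => (complex.Re (f x))%:E))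
  +i* fine (cube_integral (fun x => (complex.Im (f x))%:E)).

(* Absolutely convergent (unordered) sums over Z^n. *)
Definition abs_summable (f : 'rV[int]_n -> R[i]) : Prop :=
  summable setT (fun k => (cabs (f k))%:E).

Definition lattice_rsum (g : 'rV[int]_n -> R) : R :=
  fine (\esum_(k in setT) (Num.max (g k) 0)%:E)
  - fine (\esum_(k in setT) (Num.max (- g k) 0)%:E).

Definition lattice_sum (f : 'rV[int]_n -> R[i]) : R[i] :=
  lattice_rsum (fun k => complex.Re (f k))
  +i* lattice_rsum (fun k => complex.Im (f k)).

Definition two_pi_mn : R[i] := ((2 * pi) ^- n)%:C.

Definition fso_term (phi : 'rV[R]_n -> 'rV[int]_n -> R)
    (a : 'rV[R]_n -> 'rV[R]_n -> 'rV[int]_n -> R[i])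
    (u : 'rV[R]_n -> R[i]) (x : 'rV[R]_n) (xi : 'rV[int]_n) : R[i] :=
  torus_integral (fun y =>
    expi (phi x xi - dot y xi) * a x y xi * u y * two_pi_mn).

Definition fso phi a u (x : 'rV[R]_n) : R[i] :=
  lattice_sum (fso_term phi a u x).

Definition psdo_term (p : 'rV[R]_n -> 'rV[int]_n -> R[i])
    (u : 'rV[R]_n -> R[i]) (x : 'rV[R]_n) (xi : 'rV[int]_n) : R[i] :=
  torus_integral (fun y => expi (dot (x - y) xi) * p x xi * u y * two_pi_mn).

Definition psdo p u (x : 'rV[R]_n) : R[i] := lattice_sum (psdo_term p u x).

Definition comp_term (a : 'rV[R]_n -> 'rV[R]_n -> 'rV[int]_n -> R[i])
    (p : 'rV[R]_n -> 'rV[int]_n -> R[i])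
    (x z : 'rV[R]_n) (xi eta : 'rV[int]_n) : R[i] :=
  torus_integral (fun y =>
    expi (dot (y - z) (eta - xi)) * a x y xi * p y eta * two_pi_mn).

Definition comp_amplitude a p (x z : 'rV[R]_n) (xi : 'rV[int]_n) : R[i] :=
  lattice_sum (comp_term a p x z xi).

Definition expansion_term (a : 'rV[R]_n -> 'rV[R]_n -> 'rV[int]_n -> R[i])
    (p : 'rV[R]_n -> 'rV[int]_n -> R[i]) (alpha : 'I_n -> nat)
    (x z : 'rV[R]_n) (xi : 'rV[int]_n) : R[i] :=
  ((mi_fact alpha)%:R)^-1 *
  negD_mi alpha (fun z' => a x z' xi * diff_mi alpha (p z') xi) z.

(* The multi-indices with |alpha| < M have all entries in 'I_M. *)
Definition remainder (a : 'rV[R]_n -> 'rV[R]_n -> 'rV[int]_n -> R[i])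
    (p : 'rV[R]_n -> 'rV[int]_n -> R[i]) (M : nat)
    (x z : 'rV[R]_n) (xi : 'rV[int]_n) : R[i] :=
  comp_amplitude a p x z xi
  - \sum_(alpha : {ffun 'I_n -> 'I_M} | (mi_size (fun j => alpha j) < M)%N)
      expansion_term a p (fun j => alpha j) x z xi.

(* Continuity on the Frechet space of smooth functions on the torus is
   expressed sequentially.  A distribution is a function on all of
   'rV[R]_n -> R[i], whose values outside of smooth_torus are irrelevant. *)
Definition torus_distribution (D : ('rV[R]_n -> R[i]) -> R[i]) : Prop :=
  (forall (k : R[i]) f g, smooth_torus f -> smooth_torus g ->
     D (fun x => k * f x + g x) = k * D f + D g) /\
  (forall (f : nat -> 'rV[R]_n -> R[i]) g,
     (forall N, smooth_torus (f N)) -> smooth_torus g ->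
     (forall (alpha : 'I_n -> nat) (e : R), 0 < e ->
        \forall N \near \oo, forall x,
          cabs (deriv_mi alpha (f N) x - deriv_mi alpha g x) < e) ->
     forall e : R, 0 < e -> \forall N \near \oo, cabs (D (f N) - D g) < e).

Definition torus_integrable (f : 'rV[R]_n -> R[i]) : Prop :=
  [/\ measurable_fun [set: n.-tuple R]
        (fun t => complex.Re (f (\row_j tnth t j)) : R),
      measurable_fun [set: n.-tuple R]
        (fun t => complex.Im (f (\row_j tnth t j)) : R) &
      (cube_integral (fun x => (cabs (f x))%:E) < +oo)%E].

(* D is the distribution given by the integrable function f. *)
Definition is_function_distribution (D : ('rV[R]_n -> R[i]) -> R[i])
    (f : 'rV[R]_n -> R[i]) : Prop :=
  torus_integrable f /\
  forall psi, smooth_torus psi -> D psi = torus_integral (fun x => f x * psi x).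

End Operators.
End Toroidal.

(* Main.v *)
(* In terms of k = eta - xi, the amplitude c is the Fourier series
     c(x, z, xi) = Sum_k e^(- i z k) (2 pi)^(-n) Int e^(i y k) a(x, y, xi) p(y, xi + k) dy.
   Replace p(y, xi + k) by its discrete Taylor polynomial
     Sum_(|alpha| < M) k^((alpha)) / alpha! (Delta^alpha p)(y, xi),
   where k^((alpha)) is the falling power.  On the Fourier side (-D_z)^((alpha)) is
   multiplication by k^((alpha)), so by Fourier inversion the polynomial contributes
   exactly the first terms of the expansion, and R_M is the same series with the
   Taylor remainder instead of p(y, xi + k).  This remainder is bounded by |k|^M
   times M-th differences of p at the lattice points xi + k', |k'| <= |k|.
   Integrating by parts in y, its Fourier coefficients decay fast enough in k to be
   summed and differentiated: for 2|k| <= <xi> the differences have the size of those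
   at xi, and for larger k the decay in k beats every power of <xi>.
   For classes with delta > 0 the coefficients lose <xi>^(2 n delta), so c is estimated
   as its expansion plus R_M with M large, and differences in xi are handled
   inductively by the discrete Leibniz rule
     Delta_j c[a, p] = c[Delta_j a, p] + c[a(. + e_j), Delta_j p].
   In TPu, exchanging sum and integral for each xi gives the composition formula. *)
From HB Require Import structures.
Require Import Defs.
From mathcomp Require Import all_boot all_order all_algebra.
From mathcomp Require Import complex.
From mathcomp Require Import all_classical all_reals all_analysis.
From mathcomp Require Import ring lra.
Import Order.TTheory GRing.Theory Num.Theory.
Import numFieldNormedType.Exports.
Local Open Scope ring_scope.
Set Implicit Arguments.
Unset Strict Implicit.
Unset Printing Implicit Defensive.

(** * Integration over the torus *)

Section Continuity.
Local Open Scope classical_set_scope.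

(** The amplitude c is the case M = 0 of R_M, the Taylor polynomial being empty there. One kernel
    with parameter M, a joint function of (x, z), therefore serves for convergence, smoothness and
    every estimate, and the expansion is an identity between two such kernels. The bounds have to be
    uniform in xi and k, with constants that depend only on the derivative taken. They are kept in
    one form, C W(q) lam(q)^|s| for every word s of partial derivatives, which is stable under
    products, pullbacks and change of parameters. Words are used because [smooth] speaks of them;
    that they may be reordered rests on the uniqueness of Fourier coefficients. The integrations by
    parts number 2n for summability in k, one for each z-derivative, and M for the factor |k|^M.
    Each costs <xi>^delta, whence the exponent m + l - (rho - delta) M + 2n delta for R_M; nothing
    is lost when delta = 0. For large k the scale <xi>^delta is at most of order |k|^delta, so each
    integration by parts gains a power 1 - delta > 0 of |k|. *)

Lemma continuous_fcomp (T U V : topologicalType) (f : U -> V) (g : T -> U) :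
  continuous f -> continuous g -> continuous (fun x => f (g x)).
Proof. by move=> cf cg x; exact: (continuous_comp (cg x) (cf (g x))). Qed.

Lemma continuous_pair (T U V : topologicalType) (f : T -> U) (g : T -> V) :
  continuous f -> continuous g -> continuous (fun x => (f x, g x)).
Proof. by move=> cf cg x; apply: cvg_pair; [exact: cf|exact: cg]. Qed.

Lemma continuous_fst (T U : topologicalType) : continuous (@fst T U).
Proof. by move=> x; exact: cvg_fst. Qed.

Lemma continuous_snd (T U : topologicalType) : continuous (@snd T U).
Proof. by move=> x; exact: cvg_snd. Qed.

Lemma continuous_id (T : topologicalType) : continuous (fun x : T => x).
Proof. by move=> x; exact: cvg_id. Qed.

Lemma continuous_cst (T U : topologicalType) (c : U) :
  continuous (fun _ : T => c).
Proof. by move=> x; exact: cvg_cst. Qed.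

Context {R : realType}.

Lemma continuous_add (T : topologicalType) (f g : T -> R) :
  continuous f -> continuous g -> continuous (fun x => f x + g x).
Proof. by move=> cf cg x; exact: cvgD (cf x) (cg x). Qed.

Lemma continuous_opp (T : topologicalType) (f : T -> R) :
  continuous f -> continuous (fun x => - f x).
Proof. by move=> cf x; exact: cvgN (cf x). Qed.

Lemma continuous_mul (T : topologicalType) (f g : T -> R) :
  continuous f -> continuous g -> continuous (fun x => f x * g x).
Proof. by move=> cf cg x; exact: cvgM (cf x) (cg x). Qed.

End Continuity.

(** * Integrals over one period *)

Section CircleIntegral.
Local Open Scope classical_set_scope.
Context {R : realType}.
Local Notation mu := (@lebesgue_measure R).

Definition circ : set R := [set t : R | 0 <= t < 2 * pi].

Definition circle_int (h : R -> R) : R := \int[mu]_(t in circ) h t.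

Lemma two_pi_gt0 : 0 < 2 * pi :> R.
Proof. by rewrite mulr_gt0// pi_gt0. Qed.

Lemma circE : circ = `[0, 2 * pi[.
Proof. by apply/seteqP; split=> t; rewrite /circ/= in_itv/=. Qed.

Lemma measurable_circ : measurable circ.
Proof. by rewrite circE; exact: measurable_itv. Qed.

Lemma circ_integrable (h : R -> R) : continuous h ->
  mu.-integrable circ (EFin \o h).
Proof.
move=> ch; apply: (@integrableS _ _ _ mu `[0, 2 * pi]) => //.
- exact: measurable_circ.
- by rewrite circE; apply: subset_itvl; rewrite bnd_simp.
- apply: continuous_compact_integrable; first exact: segment_compact.
  exact: continuous_subspaceT.
Qed.

Lemma circle_int_EFin (h : R -> R) : continuous h ->
  (\int[mu]_(t in circ) (h t)%:E = (circle_int h)%:E)%E.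
Proof.
move=> ch; rewrite /circle_int /Rintegral fineK//.
by apply: integrable_fin_num; [exact: measurable_circ|exact: circ_integrable].
Qed.

Lemma circle_intD (f g : R -> R) : continuous f -> continuous g ->
  circle_int (fun t => f t + g t) = circle_int f + circle_int g.
Proof.
by move=> cf cg; apply: RintegralD; [exact: measurable_circ|exact: circ_integrable..].
Qed.

Lemma circle_intZ (c : R) (f : R -> R) : continuous f ->
  circle_int (fun t => c * f t) = c * circle_int f.
Proof.
by move=> cf; apply: RintegralZl; [exact: measurable_circ|exact: circ_integrable..].
Qed.

Lemma mu_circ : mu circ = (2 * pi)%:E.
Proof.
rewrite circE lebesgue_measure_itv/= lte_fin two_pi_gt0.
by rewrite -EFinB subr0.
Qed.

Lemma circle_int_cst (c : R) : circle_int (fun=> c) = 2 * pi * c.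
Proof.
rewrite /circle_int Rintegral_cst; last exact: measurable_circ.
by move: mu_circ => /= ->/=; rewrite mulrC.
Qed.

(** Stated for integrable functions because the uniqueness proof compares a continuous integrand
    with a multiple of an indicator function. *)
Lemma circle_int_le (f g : R -> R) :
  mu.-integrable circ (EFin \o f) -> mu.-integrable circ (EFin \o g) ->
  (forall t, 0 <= t <= 2 * pi -> f t <= g t) -> circle_int f <= circle_int g.
Proof.
move=> cf cg fg; apply: le_Rintegral => //; first exact: measurable_circ.
by move=> t /andP[t0 t1]; apply: fg; rewrite t0 ltW.
Qed.

Lemma circle_int_norm_le (f : R -> R) (B : R) : continuous f ->
  (forall t, 0 <= t <= 2 * pi -> `|f t| <= B) -> `|circle_int f| <= 2 * pi * B.
Proof.
move=> cf fB; rewrite ler_norml; apply/andP; split.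
  rewrite -mulrN -circle_int_cst; apply: circle_int_le.
  - by apply: circ_integrable => ?; exact: cvg_cst.
  - exact: circ_integrable.
  - by move=> t /fB; rewrite ler_norml => /andP[].
rewrite -circle_int_cst; apply: circle_int_le.
- exact: circ_integrable.
- by apply: circ_integrable => ?; exact: cvg_cst.
- by move=> t /fB; rewrite ler_norml => /andP[].
Qed.

Lemma circle_int_FTC (F f : R -> R) : continuous f ->
  (forall t : R, is_derive t 1 F (f t)) -> circle_int f = F (2 * pi) - F 0.
Proof.
move=> cf dF; rewrite /circle_int circE Rintegral_itv_bndo_bndc; last first.
  by rewrite -circE; exact: circ_integrable.
have cF : continuous F.
  move=> t; apply: differentiable_continuous; apply/derivable1_diffP.
  by have [] := dF t.
rewrite /Rintegral (@continuous_FTC2 _ f F)//; first exact: two_pi_gt0.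
- exact: continuous_subspaceT.
- split.
  + by move=> t _; have [] := dF t.
  + exact/cvg_at_right_filter/cF.
  + exact/cvg_at_left_filter/cF.
- by move=> t _; rewrite derive1E; have [] := dF t.
Qed.

(** By compactness of [0, 2 pi], every w has a neighbourhood on which [F w'] stays close to [F w]
    uniformly in t. The argument works for any topological space of parameters, which the induction
    on the dimension exploits. *)
Lemma circle_int_continuous (W : topologicalType) (F : W -> R -> R) :
  continuous (fun wt : W * R => F wt.1 wt.2) ->
  continuous (fun w => circle_int (F w)).
Proof.
move=> cF w.
have cFw w' : continuous (F w').
  apply: (continuous_fcomp (f := fun wt => F wt.1 wt.2) (g := pair w')) => //.
  by apply: continuous_pair; [exact: continuous_cst|exact: continuous_id].
apply/cvgrPdist_le => /= e e0.
have /compact_near_coveringP := @segment_compact R 0 (2 * pi).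
pose d := e / (2 * pi).
have d0 : 0 < d by rewrite divr_gt0// two_pi_gt0.
move=> /(_ W (nbhs w) (fun w' t => `|F w t - F w' t| <= d) _).
have H : forall t, `[0, 2 * pi]%classic t ->
   \forall t' \near t & w' \near w, `|F w t' - F w' t'| <= d.
  move=> t _.
  have /cvgrPdist_le /(_ (d / 2)) := cF (w, t).
  rewrite divr_gt0// => /(_ isT) [[/= A B] [nA nB] AB].
  exists (B, A) => //= -[t' w'] /= [Bt' Aw'].
  have h1 := AB (w', t') (conj Aw' Bt').
  have h2 := AB (w, t') (conj (nbhs_singleton nA) Bt').
  rewrite /= in h1 h2.
  have -> : F w t' - F w' t' = (F w t - F w' t') - (F w t - F w t') by ring.
  by rewrite (le_trans (ler_normB _ _))// (splitr d) lerD.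
move=> /(_ H); apply: filterS => w' H'.
have -> : circle_int (F w) - circle_int (F w') =
  circle_int (fun t => F w t + (-1) * F w' t).
  rewrite circle_intD//; first by rewrite circle_intZ// mulN1r.
  by move=> t; apply: cvgM; [exact: cvg_cst|exact: cFw].
rewrite (le_trans (circle_int_norm_le (B := d) _ _))//.
- move=> t; apply: cvgD; first exact: cFw.
  by apply: cvgM; [exact: cvg_cst|exact: cFw].
- by move=> t t2; rewrite mulN1r; apply: H'; rewrite /= in_itv.
by rewrite /d mulrCA divff ?mulr1// gt_eqF// two_pi_gt0.
Qed.

End CircleIntegral.

(** * Differentiation under the integral sign *)

Section Derivatives.
Local Open Scope classical_set_scope.
Context {R : realType}.

(** A form of differentiability without division, where h ranges over a full neighbourhood of 0.
    Such estimates can be integrated or summed over a further parameter. *)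
Lemma is_derive_eps (V : normedModType R) (f : V -> R) (x v : V) (l : R) :
  (forall e : R, 0 < e ->
     \forall h \near (0 : R), `|f (h *: v + x) - f x - h * l| <= e * `|h|) ->
  is_derive x v f l.
Proof.
move=> H.
have C : h^-1 *: ((f \o shift x) (h *: v) - f x) @[h --> 0^'] --> l.
  apply/cvgrPdist_le => /= e e0; near=> h.
  have h0 : h != 0 by near: h; exact: nbhs_dnbhs_neq.
  have nh0 : 0 < `|h| by rewrite normr_gt0.
  have -> : l - h^-1 *: (f (h *: v + x) - f x)
          = - (h^-1 * (f (h *: v + x) - f x - h * l)).
    by rewrite [_ *: _]/GRing.scale/=; field.
  rewrite normrN normrM normfV mulrC ler_pdivrMr//.
  by near: h; apply: nbhs_dnbhs; exact: H.
apply: DeriveDef; first by apply/cvg_ex; exists l.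
exact: cvg_lim C.
Unshelve. all: by end_near. Qed.

Lemma is_derive_line (V : normedModType R) (f : V -> R) (x v : V) (h l : R) :
  is_derive (h *: v + x) v f l -> is_derive h 1 (fun s => f (s *: v + x)) l.
Proof.
move=> [df dE].
have E : (fun s => s^-1 *: (((fun s => f (s *: v + x)) \o shift h) (s *: 1) -
            f (h *: v + x))) =
         (fun s => s^-1 *: ((f \o shift (h *: v + x)) (s *: v) - f (h *: v + x))).
  apply/funext => s /=; congr (_ *: (f _ - _)).
  by rewrite [s *: 1]mulr1 scalerDl addrA.
apply: DeriveDef.
  by rewrite /derivable/= in df *; rewrite E.
by rewrite /derive E -dE.
Qed.

(** The mean value theorem turns closeness of the derivatives into an error with the same constant
    e. When e is common to a family of functions, so is the error, which is what exchanging
    derivatives with integrals and series requires. *)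
Lemma mvt_bound (f df : R -> R) (h l e : R) :
  (forall s : R, is_derive s 1 f (df s)) ->
  (forall s, `|s| <= `|h| -> `|df s - l| <= e) ->
  `|f h - f 0 - h * l| <= e * `|h|.
Proof.
move=> dF B.
have cf : continuous f.
  move=> s; apply: differentiable_continuous; apply/derivable1_diffP.
  by have [] := dF s.
have [h0|h0] := leP 0 h.
  have [c /itvP ch E] := @MVT_segment R f df 0 h h0 (fun s _ => dF s)
     (continuous_subspaceT cf).
  rewrite E subr0 (mulrC h) -mulrBl normrM ler_wpM2r// B//.
  by rewrite !ger0_norm ?ch.
have [c /itvP ch E] := @MVT_segment R f df h 0 (ltW h0) (fun s _ => dF s)
     (continuous_subspaceT cf).
have -> : f h - f 0 - h * l = (df c - l) * h by rewrite -(opprB (f 0)) E; ring.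
rewrite normrM ler_wpM2r// B//.
by rewrite !ler0_norm ?ch ?(ltW h0)// lerN2 ch.
Qed.

(** Compactness makes [G (s + h) t] close to [G h t] uniformly in t for small s, and [mvt_bound]
    converts this into an error of size d |s| for F, again uniformly in t. *)
Lemma circle_int_derive (F G : R -> R -> R) :
  continuous (fun ht : R * R => F ht.1 ht.2) ->
  continuous (fun ht : R * R => G ht.1 ht.2) ->
  (forall h t : R, is_derive h 1 (F^~ t) (G h t)) ->
  forall h : R, is_derive h 1 (fun h => circle_int (F h)) (circle_int (G h)).
Proof.
move=> cF cG dF h.
have sec (H : R -> R -> R) : continuous (fun ht : R * R => H ht.1 ht.2) ->
    forall w', continuous (H w').
  move=> cH w'.
  apply: (continuous_fcomp (f := fun wt => H wt.1 wt.2) (g := pair w')) => //.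
  by apply: continuous_pair; [exact: continuous_cst|exact: continuous_id].
apply: is_derive_eps => e e0.
pose d := e / (2 * pi).
have d0 : 0 < d by rewrite divr_gt0// two_pi_gt0.
have /compact_near_coveringP := @segment_compact R 0 (2 * pi).
move=> /(_ R (nbhs (0 : R)) (fun s t => `|G (s + h) t - G h t| <= d) _).
have H : forall t, `[0, 2 * pi]%classic t ->
   \forall t' \near t & s \near (0 : R), `|G (s + h) t' - G h t'| <= d.
  move=> t _.
  pose K (st : R * R) := G (st.1 + h) st.2.
  have cK : continuous K.
    apply: (continuous_fcomp (f := fun wt : R * R => G wt.1 wt.2)
      (g := fun st : R * R => (st.1 + h, st.2))) => //.
    apply: continuous_pair; last exact: continuous_snd.
    by move=> st; apply: cvgD; [exact: continuous_fst|exact: cvg_cst].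
  have /cvgrPdist_le /(_ (d / 2)) := cK (0, t).
  rewrite divr_gt0// => /(_ isT) [[/= A B] [nA nB] AB].
  exists (B, A) => //= -[t' w'] /= [Bt' Aw'].
  have h1 := AB (w', t') (conj Aw' Bt').
  have h2 := AB (0, t') (conj (nbhs_singleton nA) Bt').
  rewrite /K/= add0r in h1 h2.
  have -> : G (w' + h) t' - G h t' =
    (G h t - G h t') - (G h t - G (w' + h) t') by ring.
  by rewrite (le_trans (ler_normB _ _))// (splitr d) lerD.
move=> /(_ H) /nbhs_ballP[r r0 Hr].
apply/nbhs_ballP; exists r => // s /= sr.
have Hs s' t : `|s'| <= `|s| -> 0 <= t <= 2 * pi -> `|G (s' + h) t - G h t| <= d.
  move=> s's tI; apply: (Hr s'); last by rewrite /= in_itv.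
  rewrite /ball/= sub0r normrN; apply: le_lt_trans s's _.
  by move: sr; rewrite /ball/= sub0r normrN.
have -> : s *: (1 : R) = s by exact: mulr1.
have -> : circle_int (F (s + h)) - circle_int (F h) - s * circle_int (G h)
  = circle_int (fun t => F (s + h) t + (-1) * (F h t + s * G h t)).
  rewrite circle_intD; first last.
  - move=> t; apply: cvgM; first exact: cvg_cst.
    apply: cvgD; first exact: (sec _ cF).
    by apply: cvgM; [exact: cvg_cst|exact: (sec _ cG)].
  - exact: (sec _ cF).
  rewrite circle_intZ; last first.
    move=> t; apply: cvgD; first exact: (sec _ cF).
    by apply: cvgM; [exact: cvg_cst|exact: (sec _ cG)].
  rewrite circle_intD ?circle_intZ; first by ring.
  - exact: (sec _ cG).
  - exact: (sec _ cF).
  - by move=> t; apply: cvgM; [exact: cvg_cst|exact: (sec _ cG)].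
apply: le_trans (circle_int_norm_le (B := d * `|s|) _ _) _.
- move=> t; apply: cvgD; first exact: (sec _ cF).
  apply: cvgM; first exact: cvg_cst.
  apply: cvgD; first exact: (sec _ cF).
  by apply: cvgM; [exact: cvg_cst|exact: (sec _ cG)].
- move=> t tI.
  have := @mvt_bound (fun s => F (s + h) t) (fun s => G (s + h) t) s (G h t) d.
  rewrite add0r mulN1r opprD addrA; apply; last by move=> s' s's; exact: Hs.
  move=> s'.
  have := @is_derive_line R^o (F^~ t) h 1 s' (G (s' + h) t).
  have -> : (fun s0 : R => F (s0 *: (1 : R^o) + h) t) = (fun s0 => F (s0 + h) t).
    by apply/funext => s0; rewrite [_ *: _]mulr1.
  apply.
  by rewrite [_ *: _]mulr1; exact: dF.
by rewrite /d; have := two_pi_gt0 (R := R) => p0; rewrite mulrA mulrCA divff ?mulr1 ?gt_eqF.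
Qed.

End Derivatives.

Section MatrixContinuity.
Local Open Scope classical_set_scope.
Context {R : realType}.

Lemma continuous_mx (W : topologicalType) m n (f : W -> 'M[R]_(m, n)) :
  (forall i j, continuous (fun w => f w i j)) -> continuous f.
Proof.
move=> cf w A [P nP PA].
have : \forall w' \near w, forall i j, P i j (f w' i j).
  have : \forall w' \near w, forall ij : 'I_m * 'I_n, P ij.1 ij.2 (f w' ij.1 ij.2).
    by apply: filter_forall => -[i j]; exact: (cf i j w _ (nP i j)).
  by apply: filterS => w' H i j; exact: (H (i, j)).
by apply: filterS => w'; exact: PA.
Qed.

Lemma continuous_mx_entry m n (i : 'I_m) (j : 'I_n) :
  continuous (fun x : 'M[R]_(m, n) => x i j).
Proof. exact: coord_continuous. Qed.

Lemma continuous_row_mx (W : topologicalType) m n (f : W -> 'rV[R]_m)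
  (g : W -> 'rV[R]_n) : continuous f -> continuous g ->
  continuous (fun w => row_mx (f w) (g w)).
Proof.
move=> cf cg; apply: continuous_mx => i j.
rewrite -(splitK j); case: (fintype.split j) => k /=.
  under eq_fun do rewrite row_mxEl.
  exact: (continuous_fcomp (@continuous_mx_entry _ _ i k) cf).
under eq_fun do rewrite row_mxEr.
exact: (continuous_fcomp (@continuous_mx_entry _ _ i k) cg).
Qed.

Lemma continuous_scalar1 : continuous (fun t : R => t%:M : 'rV[R]_1).
Proof.
apply: continuous_mx => i j; rewrite !ord1.
under eq_fun do rewrite mxE eqxx mulr1n.
exact: continuous_id.
Qed.

End MatrixContinuity.

(** * The iterated integral over the cube *)

Section CubeIntegral.
Local Open Scope classical_set_scope.
Context {R : realType}.

Definition cube_int n (f : 'rV[R]_n -> R) : R :=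
  fine (cube_integral (fun x => (f x)%:E)).

Definition row_cons n (t : R) (v : 'rV[R]_n) : 'rV[R]_n.+1 :=
  row_mx (t%:M : 'rV[R]_1) v.

(** The two claims need a joint induction: in dimension n + 1 the outer integral is finite because
    the inner one depends continuously on the first coordinate. The second claim quantifies over all
    parameter spaces, since the step applies it to R and to the product of W and R. *)
Lemma cube_int_props n :
  (forall f : 'rV[R]_n -> R, continuous f ->
     cube_integral (fun x => (f x)%:E) = (cube_int f)%:E) /\
  (forall (W : topologicalType) (F : W -> 'rV[R]_n -> R),
     continuous (fun w : W * 'rV[R]_n => F w.1 w.2) ->
     continuous (fun w => cube_int (F w))).
Proof.
elim: n => [|n [IH1 IH2]].
  split=> // W F cF; rewrite /cube_int/=.
  apply: (continuous_fcomp (f := fun wt => F wt.1 wt.2)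
           (g := fun w => (w, 0 : 'rV[R]_0))) => //.
  by apply: continuous_pair; [exact: continuous_id|exact: continuous_cst].
have csec (W : topologicalType) (F : W -> 'rV[R]_n.+1 -> R) :
    continuous (fun w : W * 'rV[R]_n.+1 => F w.1 w.2) ->
    continuous (fun wtv : (W * R) * 'rV[R]_n => F wtv.1.1 (row_cons wtv.1.2 wtv.2)).
  move=> cF.
  apply: (continuous_fcomp (f := fun wt => F wt.1 wt.2)
    (g := fun wtv : (W * R) * 'rV[R]_n => (wtv.1.1, row_cons wtv.1.2 wtv.2))) => //.
  apply: continuous_pair.
    exact: (continuous_fcomp (@continuous_fst _ _) (@continuous_fst _ _)).
  apply: (@continuous_row_mx R _ 1); last exact: continuous_snd.
  apply: (continuous_fcomp (@continuous_scalar1 R)).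
  exact: (continuous_fcomp (@continuous_snd _ _) (@continuous_fst _ _)).
have csec1 (f : 'rV[R]_n.+1 -> R) : continuous f ->
    continuous (fun tv : R * 'rV[R]_n => f (row_cons tv.1 tv.2)).
  move=> cf; apply: (continuous_fcomp cf).
  apply: (@continuous_row_mx R _ 1); last exact: continuous_snd.
  exact: (continuous_fcomp (@continuous_scalar1 R) (@continuous_fst _ _)).
have E (f : 'rV[R]_n.+1 -> R) : continuous f ->
  cube_integral (fun x => (f x)%:E) =
  (circle_int (fun t => cube_int (fun v => f (row_cons t v))))%:E.
  move=> cf /=.
  rewrite -circle_int_EFin; last first.
    exact: (IH2 R (fun t v => f (row_cons t v)) (csec1 _ cf)).
  apply: eq_integral => t _; rewrite IH1//.
  apply: (continuous_fcomp (csec1 _ cf) (g := pair t)).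
  by apply: continuous_pair; [exact: continuous_cst|exact: continuous_id].
split=> [f cf|W F cF]; first by rewrite /cube_int E.
have -> : (fun w => cube_int (F w)) =
  (fun w => circle_int (fun t => cube_int (fun v => F w (row_cons t v)))).
  apply/funext => w; rewrite {1}/cube_int E//.
  apply: (continuous_fcomp (f := fun wt => F wt.1 wt.2) (g := pair w)) => //.
  by apply: continuous_pair; [exact: continuous_cst|exact: continuous_id].
apply: circle_int_continuous.
exact: (IH2 _ (fun wt v => F wt.1 (row_cons wt.2 v)) (csec _ _ cF)).
Qed.

Lemma cube_int_EFin n (f : 'rV[R]_n -> R) : continuous f ->
  cube_integral (fun x => (f x)%:E) = (cube_int f)%:E.
Proof. exact: (cube_int_props n).1. Qed.

Lemma cube_int_continuous n (W : topologicalType) (F : W -> 'rV[R]_n -> R) :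
  continuous (fun w : W * 'rV[R]_n => F w.1 w.2) ->
  continuous (fun w => cube_int (F w)).
Proof. exact: (cube_int_props n).2. Qed.

Lemma continuous_row_cons n (f : 'rV[R]_n.+1 -> R) : continuous f ->
  continuous (fun tv : R * 'rV[R]_n => f (row_cons tv.1 tv.2)).
Proof.
move=> cf; apply: (continuous_fcomp cf).
apply: (@continuous_row_mx R _ 1); last exact: continuous_snd.
exact: (continuous_fcomp (@continuous_scalar1 R) (@continuous_fst _ _)).
Qed.

Lemma continuous_section (W T U : topologicalType) (F : W -> T -> U) w :
  continuous (fun wt : W * T => F wt.1 wt.2) -> continuous (F w).
Proof.
move=> cF; apply: (continuous_fcomp cF (g := pair w)).
by apply: continuous_pair; [exact: continuous_cst|exact: continuous_id].
Qed.

Lemma continuous_row_cons_sec n (f : 'rV[R]_n.+1 -> R) (t : R) : continuous f ->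
  continuous (fun v : 'rV[R]_n => f (row_cons t v)).
Proof.
move=> /continuous_row_cons cf.
exact: (continuous_section (F := fun t v => f (row_cons t v)) (w := t) cf).
Qed.

Lemma cube_intS n (f : 'rV[R]_n.+1 -> R) : continuous f ->
  cube_int f = circle_int (fun t => cube_int (fun v => f (row_cons t v))).
Proof.
move=> cf; have crc := continuous_row_cons cf; rewrite {1}/cube_int /=.
have cin : continuous (fun t => cube_int (fun v => f (row_cons t v))).
  exact: (cube_int_continuous (F := fun t v => f (row_cons t v)) crc).
rewrite -[RHS]/(fine (circle_int _)%:E) -circle_int_EFin//; congr fine.
apply: eq_integral => t _; rewrite -cube_int_EFin//.
exact: continuous_row_cons_sec.
Qed.

Lemma cube_int0 (f : 'rV[R]_0 -> R) : cube_int f = f 0.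
Proof. by []. Qed.

Lemma cube_intD n (f g : 'rV[R]_n -> R) : continuous f -> continuous g ->
  cube_int (fun x => f x + g x) = cube_int f + cube_int g.
Proof.
elim: n f g => [|n IH] f g cf cg //.
rewrite !cube_intS//; last exact: continuous_add.
have cf' := continuous_row_cons cf; have cg' := continuous_row_cons cg.
rewrite -circle_intD.
- congr circle_int; apply/funext => t; rewrite IH//.
  + exact: continuous_row_cons_sec.
  + exact: continuous_row_cons_sec.
- exact: (cube_int_continuous (F := fun t v => f (row_cons t v)) cf').
- exact: (cube_int_continuous (F := fun t v => g (row_cons t v)) cg').
Qed.

Lemma cube_intZ n (c : R) (f : 'rV[R]_n -> R) : continuous f ->
  cube_int (fun x => c * f x) = c * cube_int f.
Proof.
elim: n f => [|n IH] f cf //.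
rewrite !cube_intS//; last by apply: continuous_mul => //; exact: continuous_cst.
have cf' := continuous_row_cons cf.
rewrite -circle_intZ.
- congr circle_int; apply/funext => t; rewrite IH//.
  exact: continuous_row_cons_sec.
- exact: (cube_int_continuous (F := fun t v => f (row_cons t v)) cf').
Qed.

Lemma cube_int_cst n (c : R) : cube_int (fun _ : 'rV[R]_n => c) = (2 * pi) ^+ n * c.
Proof.
elim: n => [|n IH]; first by rewrite mul1r.
by rewrite cube_intS ?IH ?circle_int_cst ?exprS ?mulrA//; exact: continuous_cst.
Qed.

Lemma cube_int_norm_le n (f : 'rV[R]_n -> R) (B : R) : continuous f ->
  (forall x, `|f x| <= B) -> `|cube_int f| <= (2 * pi) ^+ n * B.
Proof.
elim: n f B => [|n IH] f B cf fB; first by rewrite mul1r cube_int0.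
have cf' := continuous_row_cons cf.
rewrite cube_intS// exprS -mulrA; apply: circle_int_norm_le.
  exact: (cube_int_continuous (F := fun t v => f (row_cons t v)) cf').
move=> t _; apply: IH => //.
exact: continuous_row_cons_sec.
Qed.

Lemma cube_int_derive n (F G : R -> 'rV[R]_n -> R) :
  continuous (fun ht : R * 'rV[R]_n => F ht.1 ht.2) ->
  continuous (fun ht : R * 'rV[R]_n => G ht.1 ht.2) ->
  (forall (h : R) v, is_derive h 1 (F^~ v) (G h v)) ->
  forall h : R, is_derive h 1 (fun h => cube_int (F h)) (cube_int (G h)).
Proof.
elim: n F G => [|n IH] F G cF cG dF h; first exact: dF.
have csec (H : R -> 'rV[R]_n.+1 -> R) :
    continuous (fun w : R * 'rV[R]_n.+1 => H w.1 w.2) ->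
    continuous (fun wtv : (R * R) * 'rV[R]_n => H wtv.1.1 (row_cons wtv.1.2 wtv.2)).
  move=> cH.
  apply: (continuous_fcomp (f := fun wt => H wt.1 wt.2)
    (g := fun wtv : (R * R) * 'rV[R]_n => (wtv.1.1, row_cons wtv.1.2 wtv.2))) => //.
  apply: continuous_pair.
    exact: (continuous_fcomp (@continuous_fst _ _) (@continuous_fst _ _)).
  apply: (@continuous_row_mx R _ 1); last exact: continuous_snd.
  apply: (continuous_fcomp (@continuous_scalar1 R)).
  exact: (continuous_fcomp (@continuous_snd _ _) (@continuous_fst _ _)).
have E (H : R -> 'rV[R]_n.+1 -> R) :
    continuous (fun w : R * 'rV[R]_n.+1 => H w.1 w.2) ->
    (fun w => cube_int (H w)) =
    (fun w => circle_int (fun t => cube_int (fun v => H w (row_cons t v)))).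
  move=> cH; apply/funext => w; rewrite cube_intS//.
  exact: continuous_section cH.
rewrite (E F)// cube_intS; last exact: continuous_section cG.
apply: (@circle_int_derive R (fun h t => cube_int (fun v => F h (row_cons t v)))
  (fun h t => cube_int (fun v => G h (row_cons t v)))).
- exact: (cube_int_continuous (F := fun wt v => F wt.1 (row_cons wt.2 v)) (csec _ cF)).
- exact: (cube_int_continuous (F := fun wt v => G wt.1 (row_cons wt.2 v)) (csec _ cG)).
move=> h' t.
apply: (IH (fun h v => F h (row_cons t v)) (fun h v => G h (row_cons t v))).
- apply: (continuous_fcomp (csec _ cF) (g := fun hv => ((hv.1, t), hv.2))).
  apply: continuous_pair; last exact: continuous_snd.
  by apply: continuous_pair; [exact: continuous_fst|exact: continuous_cst].
- apply: (continuous_fcomp (csec _ cG) (g := fun hv => ((hv.1, t), hv.2))).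
  apply: continuous_pair; last exact: continuous_snd.
  by apply: continuous_pair; [exact: continuous_fst|exact: continuous_cst].
Qed.

End CubeIntegral.

(** * Complex numbers: modulus and e^(it) *)

Section ComplexModulus.
Local Open Scope complex_scope.
Context {R : realType}.
Implicit Types x y z : R[i].

Lemma cReD x y : complex.Re (x + y) = complex.Re x + complex.Re y.
Proof. by case: x y => [? ?] [? ?]. Qed.

Lemma cImD x y : complex.Im (x + y) = complex.Im x + complex.Im y.
Proof. by case: x y => [? ?] [? ?]. Qed.

Lemma cReN x : complex.Re (- x) = - complex.Re x.
Proof. by case: x. Qed.

Lemma cImN x : complex.Im (- x) = - complex.Im x.
Proof. by case: x. Qed.

Lemma cReM x y : complex.Re (x * y) =
  complex.Re x * complex.Re y - complex.Im x * complex.Im y.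
Proof. by case: x y => [? ?] [? ?]. Qed.

Lemma cImM x y : complex.Im (x * y) =
  complex.Re x * complex.Im y + complex.Im x * complex.Re y.
Proof. by case: x y => [? ?] [? ?]. Qed.

Lemma complex_eq x y :
  complex.Re x = complex.Re y -> complex.Im x = complex.Im y -> x = y.
Proof. by case: x y => [? ?] [? ?] /= -> ->. Qed.

Lemma cabs_ge0 x : 0 <= cabs x.
Proof. by case: x => a b; rewrite /cabs/= sqrtr_ge0. Qed.

Lemma cabsM x y : cabs (x * y) = cabs x * cabs y.
Proof. exact: ComplexField.Normc.normcM. Qed.

Lemma cabsD x y : cabs (x + y) <= cabs x + cabs y.
Proof. exact: le_normcD. Qed.

Lemma cabsN x : cabs (- x) = cabs x.
Proof. exact: normcN. Qed.

Lemma cabsB x y : cabs (x - y) <= cabs x + cabs y.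
Proof. by rewrite -(cabsN y) cabsD. Qed.

Lemma cabs0 : cabs (0 : R[i]) = 0.
Proof. exact: ComplexField.Normc.normc0. Qed.

Lemma cabs1 : cabs (1 : R[i]) = 1.
Proof. exact: ComplexField.Normc.normc1. Qed.

Lemma cabs_eq0 x : cabs x = 0 -> x = 0.
Proof. exact: ComplexField.Normc.eq0_normc. Qed.

Lemma cabs_real (r : R) : cabs r%:C = `|r|.
Proof. by rewrite /cabs/= expr0n/= addr0 sqrtr_sqr. Qed.

Lemma cabs_i : cabs (0 +i* 1 : R[i]) = 1.
Proof. by rewrite /cabs/= expr0n/= expr1n add0r sqrtr1. Qed.

Lemma cabs_Re x : `|complex.Re x| <= cabs x.
Proof.
case: x => a b; rewrite /cabs/= -sqrtr_sqr ler_sqrt ?lerDl ?sqr_ge0//.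
by rewrite addr_ge0// sqr_ge0.
Qed.

Lemma cabs_Im x : `|complex.Im x| <= cabs x.
Proof.
case: x => a b; rewrite /cabs/= -sqrtr_sqr ler_sqrt ?lerDr ?sqr_ge0//.
by rewrite addr_ge0// sqr_ge0.
Qed.

Lemma cabs_le_ReIm x : cabs x <= `|complex.Re x| + `|complex.Im x|.
Proof.
rewrite {1}(_ : x = (complex.Re x)%:C + (0 +i* 1) * (complex.Im x)%:C).
  by rewrite (le_trans (cabsD _ _))// cabsM cabs_i mul1r !cabs_real.
by case: x => a b; apply: complex_eq; rewrite ?cReD ?cImD ?cReM ?cImM/=; ring.
Qed.

Lemma cabs_sum (I : Type) (r : seq I) (P : pred I) (F : I -> R[i]) :
  cabs (\sum_(i <- r | P i) F i) <= \sum_(i <- r | P i) cabs (F i).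
Proof.
elim/big_ind2: _ => [|x a y b xa yb|//]; first by rewrite cabs0.
by rewrite (le_trans (cabsD _ _))// lerD.
Qed.

Lemma cRe_sum (I : Type) (r : seq I) (P : pred I) (F : I -> R[i]) :
  complex.Re (\sum_(i <- r | P i) F i) = \sum_(i <- r | P i) complex.Re (F i).
Proof. by elim/big_ind2: _ => [//|x a y b xa yb|//]; rewrite cReD xa yb. Qed.

Lemma cIm_sum (I : Type) (r : seq I) (P : pred I) (F : I -> R[i]) :
  complex.Im (\sum_(i <- r | P i) F i) = \sum_(i <- r | P i) complex.Im (F i).
Proof. by elim/big_ind2: _ => [//|x a y b xa yb|//]; rewrite cImD xa yb. Qed.

Lemma expiD (s t : R) : expi (s + t) = expi s * expi t.
Proof.
by apply: complex_eq; rewrite ?cReM ?cImM/= ?cosD ?sinD; ring.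
Qed.

Lemma expi0 : expi (0 : R) = 1.
Proof. by rewrite /expi cos0 sin0. Qed.

Lemma cabs_expi (t : R) : cabs (expi t) = 1.
Proof. by rewrite /cabs/= cos2Dsin2 sqrtr1. Qed.

Lemma expi_2pi_int (k : int) : expi (2 * pi * k%:~R : R) = 1.
Proof.
have N (m : nat) : expi (2 * pi * m%:R : R) = 1.
  elim: m => [|m IH]; first by rewrite mulr0 expi0.
  rewrite -(natr1 m) mulrDr mulr1 expiD IH mul1r /expi.
  by rewrite mulr_natl cos2pi sin2pi.
case: k => m; first exact: N.
rewrite NegzE mulrNz mulrN.
have := expiD (2 * pi * m.+1%:R : R) (- (2 * pi * m.+1%:R)).
by rewrite subrr expi0 N mul1r => <-.
Qed.

End ComplexModulus.

Section ComplexContinuity.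
Local Open Scope classical_set_scope.
Local Open Scope complex_scope.
Context {R : realType}.

(** Continuity is tested on real and imaginary parts, as in [smooth], so that integrals and limits
    reduce to real ones. *)
Definition ccont (T : topologicalType) (f : T -> R[i]) : Prop :=
  continuous (fun x => complex.Re (f x)) /\ continuous (fun x => complex.Im (f x)).

Variable T : topologicalType.
Implicit Types f g : T -> R[i].

Lemma ccont_cst (c : R[i]) : ccont (fun _ : T => c).
Proof. by split; exact: continuous_cst. Qed.

Lemma ccontD f g : ccont f -> ccont g -> ccont (fun x => f x + g x).
Proof.
move=> [f1 f2] [g1 g2]; split.
  by under eq_fun do rewrite cReD; exact: continuous_add.
by under eq_fun do rewrite cImD; exact: continuous_add.
Qed.

Lemma ccontM f g : ccont f -> ccont g -> ccont (fun x => f x * g x).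
Proof.
move=> [f1 f2] [g1 g2]; split.
  under eq_fun do rewrite cReM; apply: continuous_add; first exact: continuous_mul.
  by apply: continuous_opp; exact: continuous_mul.
by under eq_fun do rewrite cImM; apply: continuous_add; exact: continuous_mul.
Qed.

Lemma ccontZ (c : R[i]) f : ccont f -> ccont (fun x => c * f x).
Proof. by move=> cf; apply: ccontM => //; exact: ccont_cst. Qed.

Lemma ccontN f : ccont f -> ccont (fun x => - f x).
Proof.
by move=> /(@ccontZ (-1)); under [X in ccont X]eq_fun do rewrite mulN1r.
Qed.

Lemma ccontB f g : ccont f -> ccont g -> ccont (fun x => f x - g x).
Proof. by move=> cf cg; apply: ccontD => //; exact: ccontN. Qed.

Lemma ccont_sum (I : Type) (r : seq I) (P : pred I) (F : I -> T -> R[i]) :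
  (forall i, ccont (F i)) -> ccont (fun x => \sum_(i <- r | P i) F i x).
Proof.
move=> cF; elim: r => [|i r IH].
  by under eq_fun do rewrite big_nil; exact: ccont_cst.
under eq_fun do rewrite big_cons.
by case: (P i) => //; exact: ccontD.
Qed.

Lemma ccont_expi (f : T -> R) : continuous f -> ccont (fun x => expi (f x)).
Proof.
move=> cf; split => /=.
  exact: (continuous_fcomp (@continuous_cos R) cf).
exact: (continuous_fcomp (@continuous_sin R) cf).
Qed.

Lemma ccont_comp (U : topologicalType) (f : U -> R[i]) (g : T -> U) :
  ccont f -> continuous g -> ccont (fun x => f (g x)).
Proof.
move=> [f1 f2] cg; split.
  exact: (continuous_fcomp f1 cg).
exact: (continuous_fcomp f2 cg).
Qed.

End ComplexContinuity.

Section TorusIntegral.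
Local Open Scope classical_set_scope.
Local Open Scope complex_scope.
Context {R : realType}.

Lemma torus_integralE n (f : 'rV[R]_n -> R[i]) :
  torus_integral f = cube_int (fun x => complex.Re (f x))
                     +i* cube_int (fun x => complex.Im (f x)).
Proof. by []. Qed.

Lemma torus_integralD n (f g : 'rV[R]_n -> R[i]) : ccont f -> ccont g ->
  torus_integral (fun x => f x + g x) = torus_integral f + torus_integral g.
Proof.
move=> [f1 f2] [g1 g2]; rewrite !torus_integralE.
under [in LHS]eq_fun do rewrite cReD.
by under [X in _ +i* cube_int X]eq_fun do rewrite cImD; rewrite !cube_intD.
Qed.

Lemma torus_integralZ n (c : R[i]) (f : 'rV[R]_n -> R[i]) : ccont f ->
  torus_integral (fun x => c * f x) = c * torus_integral f.
Proof.
move=> [f1 f2]; rewrite !torus_integralE.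
under [in LHS]eq_fun do rewrite cReM -mulNr.
under [X in _ +i* cube_int X]eq_fun do rewrite cImM.
have cZ (k : R) (g : 'rV[R]_n -> R) : continuous g -> continuous (fun x => k * g x).
  by move=> cg; apply: continuous_mul => //; exact: continuous_cst.
rewrite !cube_intD ?cube_intZ//; try exact: cZ.
by case: c => a b /=; apply: complex_eq; rewrite ?cReM ?cImM/= ?mulNr.
Qed.

Lemma torus_integral_cst n (c : R[i]) :
  torus_integral (fun _ : 'rV[R]_n => c) = ((2 * pi) ^+ n)%:C * c.
Proof.
rewrite torus_integralE !cube_int_cst.
by apply: complex_eq; rewrite ?cReM ?cImM/= ?mul0r ?subr0 ?addr0.
Qed.

Lemma torus_integral0 n : torus_integral (fun _ : 'rV[R]_n => 0 : R[i]) = 0.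
Proof. by rewrite torus_integral_cst mulr0. Qed.

Lemma torus_integralB n (f g : 'rV[R]_n -> R[i]) : ccont f -> ccont g ->
  torus_integral (fun x => f x - g x) = torus_integral f - torus_integral g.
Proof.
move=> cf cg; rewrite -mulN1r -torus_integralZ// -torus_integralD//.
  by congr torus_integral; apply/funext => x; rewrite mulN1r.
exact: ccontZ.
Qed.

Lemma torus_integral_sum n (I : Type) (r : seq I) (P : pred I)
    (F : I -> 'rV[R]_n -> R[i]) : (forall i, ccont (F i)) ->
  torus_integral (fun x => \sum_(i <- r | P i) F i x) =
  \sum_(i <- r | P i) torus_integral (F i).
Proof.
move=> cF; elim: r => [|i r IH].
  by under eq_fun do rewrite big_nil; rewrite torus_integral0 big_nil.
under eq_fun do rewrite big_cons; rewrite big_cons.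
by case: ifP => // _; rewrite torus_integralD ?IH//; exact: ccont_sum.
Qed.

(** The factor 2 comes from bounding real and imaginary parts separately; only the existence of a
    constant matters later. *)
Lemma torus_integral_le n (f : 'rV[R]_n -> R[i]) (B : R) : ccont f ->
  (forall x, cabs (f x) <= B) ->
  cabs (torus_integral f) <= 2 * (2 * pi) ^+ n * B.
Proof.
move=> [f1 f2] fB; rewrite (le_trans (cabs_le_ReIm _))//= -mulrA mulr_natl mulr2n.
by apply: lerD; apply: cube_int_norm_le => // x; apply: le_trans (fB x);
  rewrite ?cabs_Re ?cabs_Im.
Qed.

Lemma torus_integral_continuous n (W : topologicalType) (F : W -> 'rV[R]_n -> R[i]) :
  ccont (fun w : W * 'rV[R]_n => F w.1 w.2) ->
  ccont (fun w => torus_integral (F w)).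
Proof.
move=> [F1 F2]; split.
  exact: (cube_int_continuous (F := fun w y => complex.Re (F w y))).
exact: (cube_int_continuous (F := fun w y => complex.Im (F w y))).
Qed.

End TorusIntegral.

(** * Integrals of derivatives of periodic functions *)

Section Periodic.
Local Open Scope classical_set_scope.
Context {R : realType}.

(** The chain rule in the case that occurs: L moves by h v' when its argument moves by h v. This
    covers translations, sections, projections and lines, including v' = 0. *)
Lemma is_derive_affine (V V' : normedModType R) (f : V' -> R) (L : V -> V')
    (x v : V) (v' : V') (l : R) :
  (forall h : R, L (h *: v + x) = h *: v' + L x) ->
  is_derive (L x) v' f l -> is_derive x v (fun y => f (L y)) l.
Proof.
move=> HL [df dE].
have E : (fun s : R => s^-1 *: (((fun y => f (L y)) \o shift x) (s *: v) - f (L x))) =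
         (fun s : R => s^-1 *: ((f \o shift (L x)) (s *: v') - f (L x))).
  by apply/funext => s /=; rewrite HL.
apply: DeriveDef.
  by rewrite /derivable/= in df *; rewrite E.
by rewrite /derive E -dE.
Qed.

Lemma row_cons0 n (t : R) (v : 'rV[R]_n) : row_cons t v 0 ord0 = t.
Proof.
rewrite /row_cons (_ : ord0 = lshift n (0 : 'I_1)); last exact: val_inj.
by apply: etrans (row_mxEl _ _ _ _) _; rewrite mxE eqxx.
Qed.

Lemma row_consS n (t : R) (v : 'rV[R]_n) j : row_cons t v 0 (lift ord0 j) = v 0 j.
Proof.
rewrite /row_cons (_ : lift ord0 j = rshift 1 j); last exact: val_inj.
exact: row_mxEr.
Qed.

Lemma row_cons_shift0 n (t h : R) (v : 'rV[R]_n) :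
  row_cons (h + t) v = h *: basis_vec ord0 + row_cons t v.
Proof.
apply/rowP => j; rewrite [RHS]mxE [X in _ = X + _]mxE [X in _ = _ * X + _]mxE eqxx/=.
case: (unliftP ord0 j) => [k ->|->]; first by rewrite !row_consS mulr0 add0r.
by rewrite !row_cons0 mulr1.
Qed.

Lemma row_cons_shiftS n (t h : R) (v : 'rV[R]_n) (j : 'I_n) :
  row_cons t (h *: basis_vec j + v) =
  h *: basis_vec (lift ord0 j) + row_cons t v.
Proof.
apply/rowP => i; rewrite [RHS]mxE [X in _ = X + _]mxE [X in _ = _ * X + _]mxE eqxx/=.
case: (unliftP ord0 i) => [k ->|->].
  by rewrite !row_consS !mxE eqxx/= (inj_eq lift_inj).
by rewrite !row_cons0 mulr0 add0r.
Qed.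

(** If j is a later coordinate, the inner integral of G already vanishes by induction. If j is the
    first one, the inner integral of G is the t-derivative of the inner integral of F, whose values
    at 0 and 2 pi agree by periodicity. *)
Lemma cube_int_partial0 n (F G : 'rV[R]_n -> R) (j : 'I_n) :
  continuous F -> continuous G -> periodic F ((2 * pi) *: basis_vec j) ->
  (forall x, is_derive x (basis_vec j) F (G x)) -> cube_int G = 0.
Proof.
elim: n F G j => [|n IH] F G j cF cG pF dF; first by case: j {pF dF}.
rewrite cube_intS//.
case: (unliftP ord0 j) => [k|] jE.
  rewrite -[RHS](mulr0 (2 * pi)) -circle_int_cst; congr circle_int.
  apply/funext => t.
  apply: (IH (fun v => F (row_cons t v)) _ k).
  - exact: continuous_row_cons_sec.
  - exact: continuous_row_cons_sec.
  - move=> v; rewrite addrC row_cons_shiftS addrC -jE; exact: pF.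
  - move=> v; apply: (is_derive_affine (L := row_cons t)
      (v' := basis_vec (lift ord0 k))); last first.
      by rewrite -jE; exact: (dF (row_cons t v)).
    by move=> h; rewrite row_cons_shiftS.
have D (h : R) : is_derive h 1 (fun t => cube_int (fun v => F (row_cons t v)))
    (cube_int (fun v => G (row_cons h v))).
  apply: (cube_int_derive (F := fun t v => F (row_cons t v))
    (G := fun t v => G (row_cons t v))).
  - exact: continuous_row_cons.
  - exact: continuous_row_cons.
  move=> h' v; apply: (@is_derive_affine R^o _ F (fun t => row_cons t v) h' 1
     (basis_vec ord0)); last by rewrite -jE; exact: (dF (row_cons h' v)).
  by move=> s; rewrite [s *: _]mulr1 row_cons_shift0.
rewrite (circle_int_FTC _ D).
  rewrite (_ : (fun v => F (row_cons (2 * pi) v)) = (fun v => F (row_cons 0 v))).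
    by rewrite subrr.
  apply/funext => v; rewrite -[X in row_cons X]addr0 row_cons_shift0 addrC -jE.
  exact: pF.
exact: (cube_int_continuous (F := fun t v => G (row_cons t v))
         (continuous_row_cons cG)).
Qed.

End Periodic.

(** * Uniqueness of Fourier coefficients *)

Section CircleUniqueness.
Local Open Scope classical_set_scope.
Local Open Scope complex_scope.
Context {R : realType}.
Implicit Types h : R -> R[i].

Let I1 h : R[i] := torus_integral (fun v : 'rV[R]_1 => h (v 0 0)).

Lemma torus_integral1E h : ccont h -> I1 h =
  circle_int (fun t => complex.Re (h t)) +i* circle_int (fun t => complex.Im (h t)).
Proof.
have C (g : R -> R) : continuous g -> continuous (fun v : 'rV[R]_1 => g (v 0 0)).
  by move=> cg; exact: (continuous_fcomp cg (@continuous_mx_entry R 1 1 0 0)).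
have E (g : R -> R) : continuous g ->
    cube_int (fun v : 'rV[R]_1 => g (v 0 0)) = circle_int g.
  move=> cg; rewrite (cube_intS (C _ cg)); congr circle_int; apply/funext => t.
  by rewrite cube_int0 (_ : row_cons t 0 0 0 = t)//; exact: row_cons0.
by move=> [h1 h2]; rewrite /I1 torus_integralE (E (fun t => complex.Re (h t)))//
  (E (fun t => complex.Im (h t))).
Qed.

(** The factor c + cos (t - t0) is a combination of 1, e^(it) and e^(-it), so multiplying by it
    turns the moment of index k into those of index k, k + 1 and k - 1. Quantifying over all k makes
    the induction on m go through. *)
Lemma circle_moment_zero h (c t0 : R) : ccont h ->
  (forall k : int, I1 (fun t => expi (t * k%:~R) * h t) = 0) ->
  forall (m : nat) (k : int),
    I1 (fun t => expi (t * k%:~R) * (((c + cos (t - t0)) ^+ m)%:C * h t)) = 0.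
Proof.
move=> ch H0; elim=> [|m IH] k.
  by under eq_fun do rewrite expr0 mul1r; exact: H0.
pose g (k : int) (v : 'rV[R]_1) := expi (v 0 0 * k%:~R) *
  (((c + cos (v 0 0 - t0)) ^+ m)%:C * h (v 0 0)).
have cv : continuous (fun v : 'rV[R]_1 => v 0 0) by exact: continuous_mx_entry.
have cg k' : ccont (g k').
  apply: ccontM.
    apply: ccont_expi; apply: continuous_mul => //; exact: continuous_cst.
  apply: ccontM; last exact: ccont_comp ch cv.
  split=> /=; last exact: continuous_cst.
  have cq : continuous (fun v : 'rV[R]_1 => c + cos (v 0 0 - t0)).
    apply: continuous_add; first exact: continuous_cst.
    apply: (continuous_fcomp (@continuous_cos R)).
    by apply: continuous_add => //; exact: continuous_cst.
  elim: m {IH g} => [|m IHm] /=.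
    by under eq_fun do rewrite expr0; exact: continuous_cst.
  by under eq_fun do rewrite exprS; exact: continuous_mul.
rewrite /I1 (_ : (fun v => _) = (fun v => (c%:C * g k v
   + (expi (- t0) / 2%:R) * g (k + 1) v) + (expi t0 / 2%:R) * g (k - 1) v)).
  rewrite torus_integralD; [|apply: ccontD; exact: ccontZ|exact: ccontZ].
  rewrite torus_integralD; [|exact: ccontZ|exact: ccontZ].
  have gk k' : torus_integral (g k') = 0 by exact: IH.
  by rewrite !torus_integralZ// !gk !mulr0 !addr0.
apply/funext => v; rewrite /g; set t := v 0 0.
have E1 : expi (t * (k + 1)%:~R) = expi (t * k%:~R) * expi t.
  by rewrite intrD mulrDr expiD mulr1.
have E2 : expi (t * (k - 1)%:~R) = expi (t * k%:~R) * expi (- t).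
  by rewrite intrB mulrBr expiD mulr1.
have Eq : (c + cos (t - t0))%:C = c%:C + (expi (- t0) / 2%:R) * expi t
   + (expi t0 / 2%:R) * expi (- t).
  have -> : (2%:R : R[i])^-1 = (2^-1 : R)%:C.
    by rewrite fmorphV rmorph_nat.
  apply: complex_eq; rewrite ?cReM ?cImM ?cReD ?cImD ?cReM ?cImM /=.
    by rewrite cosB !cosN !sinN; field.
  by rewrite !cosN !sinN; ring.
rewrite exprS rmorphM /= Eq E1 E2; ring.
Qed.

(* If Re h > 0 at t0, the powers of q = 1 - cos d + cos (t - t0) concentrate
   near t0, while q^m Re h integrates to 0. *)
Lemma circle_moment_Re_le0 h : ccont h ->
  (forall k : int, I1 (fun t => expi (t * k%:~R) * h t) = 0) ->
  forall t0 : R, 0 < t0 < 2 * pi -> complex.Re (h t0) <= 0.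
Proof.
move=> ch H0 t0 /andP[t00 t01]; rewrite leNgt; apply/negP => hpos.
have [h1 h2] := ch.
pose e := complex.Re (h t0) / 2.
have e0 : 0 < e by rewrite divr_gt0.
have [d [d0 dl dr hd]] : exists d : R, [/\ 0 < d, d <= t0, t0 + d <= 2 * pi &
    forall t, `|t - t0| <= d -> e <= complex.Re (h t)].
  have /cvgrPdist_le /(_ e e0) /nbhs_ballP[r /= r0 Hr] := h1 t0.
  pose d := Num.min (r / 2) (Num.min t0 (2 * pi - t0)).
  exists d; split.
  - by rewrite !lt_min divr_gt0//= t00 subr_gt0.
  - by rewrite !ge_min lexx orbT.
  - by rewrite -lerBrDl !ge_min lexx !orbT.
  move=> t td; have /Hr : ball t0 r t.
    rewrite /ball/= distrC (le_lt_trans td)// gt_min.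
    by rewrite ltr_pdivrMr// ltr_pMr// ltr1n.
  have E : complex.Re (h t0) = 2 * e by rewrite /e; field.
  by rewrite ler_norml E => /andP[_]; lra.
have dpi : d <= pi by lra.
have cosd (t : R) : `|t - t0| <= d -> cos d <= cos (t - t0).
  move=> td; rewrite -(cos_norm (t - t0)) le_eqVlt.
  move: td; rewrite le_eqVlt => /orP[/eqP ->|td]; first by rewrite eqxx.
  by rewrite ltr_cos ?td ?orbT// in_itv/= ?normr_ge0 ?(ltW d0) ?dpi//=; lra.
have cosd2 (t : R) : `|t - t0| <= d / 2 -> cos (d / 2) <= cos (t - t0).
  move=> td; rewrite -(cos_norm (t - t0)) le_eqVlt.
  move: td; rewrite le_eqVlt => /orP[/eqP ->|td]; first by rewrite eqxx.
  by rewrite ltr_cos ?td ?orbT// in_itv/= ?normr_ge0//=; lra.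
have cosout (t : R) : 0 <= t <= 2 * pi -> d <= `|t - t0| -> cos (t - t0) <= cos d.
  move=> /andP[tl tr] td; rewrite -(cos_norm (t - t0)).
  have tu : `|t - t0| <= 2 * pi - d.
    by rewrite ler_norml; apply/andP; split; lra.
  have [tp|tp] := leP `|t - t0| pi.
    rewrite le_eqVlt; move: td; rewrite le_eqVlt => /orP[/eqP ->|td].
      by rewrite eqxx.
    by rewrite ltr_cos ?td ?orbT// in_itv/= ?normr_ge0 ?(ltW d0)//=.
  (* Beyond distance pi the cosine is reflected. The reflected distance is still at least d, because
     the window around t0 lies inside the period. *)
  have -> : cos `|t - t0| = cos (2 * pi - `|t - t0|).
    by rewrite mulr_natl -[RHS]cosN opprB cosB cos2pi sin2pi mulr1 mulr0 addr0.
  rewrite le_eqVlt; move: tu; rewrite le_eqVlt => /orP[/eqP ->|tu].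
    by rewrite subKr eqxx.
  rewrite ltr_cos; first by apply/orP; right; lra.
  - by rewrite in_itv/=; apply/andP; split; lra.
  - by rewrite in_itv/=; apply/andP; split; lra.
pose q t := 1 - cos d + cos (t - t0).
(* On the period, q is at least 1 + s where |t - t0| <= d / 2, at least 1 where |t - t0| <= d, and
   of modulus at most 1 elsewhere. *)
pose s := cos (d / 2) - cos d.
have s0 : 0 < s.
  by rewrite subr_gt0 ltr_cos ?in_itv/=; [|apply/andP; split..]; lra.
have [M M0 HM] : exists2 M : R, 0 <= M & forall t, 0 <= t <= 2 * pi ->
    `|complex.Re (h t)| <= M.
  have [|||c _ Hc] := @compact_EVT_max R R (fun t => `|complex.Re (h t)|) `[0, 2 * pi].
  - by exists 0; rewrite /= in_itv/= lexx ltW// two_pi_gt0.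
  - exact: segment_compact.
  - apply: continuous_subspaceT.
    by move=> x; apply: cvg_norm; exact: h1.
  exists `|complex.Re (h c)| => // t tI; apply: Hc; rewrite inE/= in_itv//.
pose J : set R := `[t0 - d / 2, t0 + d / 2].
have main (m : nat) : e * (1 + s) ^+ m * d <= 2 * pi * M.
  pose f t := (q t) ^+ m * complex.Re (h t).
  have cq : continuous q.
    apply: continuous_add; first exact: continuous_cst.
    apply: (continuous_fcomp (@continuous_cos R)).
    by apply: continuous_add; [exact: continuous_id|exact: continuous_cst].
  have cqm : continuous (fun t => (q t) ^+ m).
    elim: (m) => [|m' IHm] /=.
      by under eq_fun do rewrite expr0; exact: continuous_cst.
    by under eq_fun do rewrite exprS; exact: continuous_mul.
  have cf : continuous f by exact: continuous_mul.
  have f0 : circle_int f = 0.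
    have := circle_moment_zero (1 - cos d) t0 ch H0 m 0.
    rewrite torus_integral1E; last first.
      apply: ccontM; first by apply: ccont_expi; apply: continuous_mul;
        [exact: continuous_id|exact: continuous_cst].
      by apply: ccontM => //; split => //=; exact: continuous_cst.
    move=> /(congr1 (@complex.Re R))/= <-; congr circle_int; apply/funext => t.
    by rewrite mulr0 expi0 mul1r cReM/= mul0r subr0.
  (* A minorant of q^m Re h: this product is at least e (1 + s)^m on J, nonnegative up to distance d
     from t0, and at least - M further away. *)
  pose b t := e * (1 + s) ^+ m * \1_J t - M.
  have JC : (@circ R) `&` J = J.
    apply/setIidPr => t; rewrite /J/circ/= in_itv/= => /andP[a1 a2].
    by apply/andP; split; lra.
  have mJ : measurable J by exact: measurable_itv.
  have iJ : (@lebesgue_measure R).-integrable (@circ R) (EFin \o (\1_J : R -> R)).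
    apply: (@integrableS _ _ _ _ setT) => //; first exact: measurable_circ.
    exact: integrable_indic_itv.
  have iJ' : (@lebesgue_measure R).-integrable (@circ R)
      (EFin \o (fun t => e * (1 + s) ^+ m * (\1_J t : R))).
    by apply: (integrableZl _ (e * (1 + s) ^+ m) iJ); exact: measurable_circ.
  have iM : (@lebesgue_measure R).-integrable (@circ R) (EFin \o (fun _ : R => M)).
    by apply: circ_integrable; exact: continuous_cst.
  have bE : circle_int b = e * (1 + s) ^+ m * d - 2 * pi * M.
    rewrite /circle_int /b RintegralB//; last exact: measurable_circ.
    rewrite RintegralZl//; last exact: measurable_circ.
    congr (_ * _ - _); last exact: circle_int_cst.
    rewrite /Rintegral integral_indic//; last exact: measurable_circ.
    rewrite setIC JC.
    suff E : @lebesgue_measure R J = d%:E.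
      by rewrite -[RHS]/(fine d%:E) -E.
    rewrite /J lebesgue_measure_itv/= lte_fin.
    have -> : t0 - d / 2 < t0 + d / 2 by lra.
    by rewrite -EFinB; congr (_%:E); field.
  have : circle_int b <= circle_int f.
    apply: circle_int_le.
    - by apply: (integrableB _ iJ' iM); exact: measurable_circ.
    - exact: circ_integrable.
    move=> t tI; rewrite /b /f indicE.
    have [tJ|tJ] := boolP (t \in J); rewrite /= ?mulr1 ?mulr0 ?sub0r.
      move: tJ; rewrite inE /J /= in_itv/= => /andP[t1 t2].
      have td : `|t - t0| <= d / 2 by rewrite ler_norml; apply/andP; split; lra.
      have := hd t; have -> : `|t - t0| <= d by lra.
      move=> /(_ isT) het.
      have := cosd2 _ td => c2.
      have qs : (1 + s) ^+ m <= (q t) ^+ m.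
        have sq : 1 + s <= q t by rewrite /s /q; lra.
        have s1 : 0 <= 1 + s by rewrite addr_ge0// ltW.
        by rewrite lerXn2r ?nnegrE// (le_trans s1).
      have s1 : 0 <= (1 + s) ^+ m by rewrite exprn_ge0//; lra.
      have : (1 + s) ^+ m * e <= (q t) ^+ m * complex.Re (h t).
        by apply: ler_pM => //; exact: ltW.
      lra.
    have [td|td] := leP `|t - t0| d.
      have q0 : 0 <= q t by rewrite /q; have := cosd _ td; lra.
      have := hd _ td => het.
      have : 0 <= (q t) ^+ m * complex.Re (h t).
        by rewrite mulr_ge0 ?exprn_ge0//; lra.
      lra.
    have c1 := cosout _ tI (ltW td).
    have qle : `|q t| <= 1.
      rewrite /q ler_norml; have := cos_geN1 (t - t0); have := cos_le1 d.
      by move=> *; apply/andP; split; lra.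
    have : `|(q t) ^+ m * complex.Re (h t)| <= M.
      rewrite normrM normrX -[M]mul1r ler_pM ?exprn_ge0//; last exact: HM.
      by rewrite exprn_ile1.
    by rewrite ler_norml => /andP[].
  rewrite bE f0; lra.
(* By Bernoulli's inequality 1 + m s <= (1 + s)^m, so a large m contradicts [main]. *)
have [m Hm] : exists m : nat, 2 * pi * M < e * d * (1 + m%:R * s).
  have ed : 0 < e * d * s by rewrite !mulr_gt0.
  have := truncnS_gt (2 * pi * M / (e * d * s)); rewrite ltr_pdivrMr//.
  move: (Num.truncn _) => N HN; exists N.+1.
  have ed0 : 0 < e * d by rewrite mulr_gt0.
  apply: lt_trans HN _.
  have -> : e * d * (1 + N.+1%:R * s) = e * d + N.+1%:R * (e * d * s) by ring.
  by rewrite ltrDr.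
have := main m.
have : 1 + m%:R * s <= (1 + s) ^+ m.
  elim: (m) => [|k IH]; first by rewrite mul0r addr0 expr0.
  rewrite exprS -natr1; apply: le_trans (_ : (1 + s) * (1 + k%:R * s) <= _); last first.
    by rewrite ler_pM2l//; lra.
  have : 0 <= k%:R * s * s by rewrite !mulr_ge0// ltW.
  lra.
move=> H1 H2; have ed : 0 < e * d by rewrite mulr_gt0.
have : e * d * (1 + m%:R * s) <= e * d * (1 + s) ^+ m by rewrite ler_pM2l.
lra.
Qed.

(** The previous lemma applies to c h for c = 1, -1, i, -i, which makes real and imaginary parts
    vanish inside the period. Continuity settles t = 0 and periodicity all other t. *)
Lemma circle_uniqueness h : ccont h -> (forall t, h (t + 2 * pi) = h t) ->
  (forall k : int, I1 (fun t => expi (t * k%:~R) * h t) = 0) -> forall t, h t = 0.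
Proof.
move=> ch per H0.
have cpt : continuous (fun v : 'rV[R]_1 => v 0 0) by exact: continuous_mx_entry.
have Hc (c : R[i]) (t0 : R) : 0 < t0 < 2 * pi -> complex.Re (c * h t0) <= 0.
  apply: (circle_moment_Re_le0 (h := fun t => c * h t)); first exact: ccontZ.
  move=> k; rewrite /I1.
  rewrite (_ : (fun v => _) =
    (fun v : 'rV[R]_1 => c * (expi (v 0 0 * k%:~R) * h (v 0 0)))).
    rewrite torus_integralZ; first by have := H0 k; rewrite /I1 => ->; rewrite mulr0.
    apply: ccontM; last exact: ccont_comp ch cpt.
    by apply: ccont_expi; apply: continuous_mul => //; exact: continuous_cst.
  by apply/funext => v; ring.
have H (t0 : R) : 0 < t0 < 2 * pi -> h t0 = 0.
  move=> tI.
  have := Hc 1 _ tI; have := Hc (-1) _ tI.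
  have := Hc (0 +i* 1) _ tI; have := Hc (0 +i* (-1)) _ tI.
  case: (h t0) => a b; rewrite !cReM/= => *.
  by apply: complex_eq => /=; lra.
have H00 (g : R -> R) : continuous g -> (forall t, 0 < t < 2 * pi -> g t = 0) -> g 0 = 0.
  move=> cg g0; apply/eqP; rewrite -normr_le0 leNgt; apply/negP => gp.
  have /cvgrPdist_lt /(_ _ gp) /nbhs_ballP[r /= r0 Hr] := cg 0.
  pose t := Num.min (r / 2) pi.
  have t0 : 0 < t by rewrite lt_min divr_gt0//= pi_gt0.
  have t2 : t < 2 * pi.
    rewrite gt_min; apply/orP; right; have := pi_gt0 R; lra.
  have /Hr : ball (0 : R) r t.
    rewrite /ball/= sub0r normrN gtr0_norm// gt_min; apply/orP; left.
    by rewrite ltr_pdivrMr// ltr_pMr// ltr1n.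
  by rewrite (g0 t) ?t0 ?t2// subr0 ltxx.
have h0 : h 0 = 0.
  case: ch => h1 h2; apply: complex_eq.
    by apply: (H00 (fun t => complex.Re (h t))) => // t /H ->.
  by apply: (H00 (fun t => complex.Im (h t))) => // t /H ->.
have Hn (k : nat) t : h (t + 2 * pi * k%:R) = h t.
  elim: k => [|k IH]; first by rewrite mulr0 addr0.
  by rewrite -(natr1 k) mulrDr mulr1 addrA per IH.
have Hz (k : int) t : h (t + 2 * pi * k%:~R) = h t.
  case: k => k; first exact: Hn.
  by rewrite -(Hn k.+1) NegzE mulrNz mulrN subrK.
move=> t; pose k := Num.floor (t / (2 * pi)).
have p0 := two_pi_gt0 (R := R).
have := floor_itv (t / (2 * pi)).
rewrite -/k ler_pdivlMr// ltr_pdivrMr// => /andP[k1 k2].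
have := Hz (- k) t; rewrite mulrNz mulrN => <-.
have : 0 <= t - 2 * pi * k%:~R by rewrite mulrC subr_ge0.
rewrite le_eqVlt => /orP[/eqP <-//|t0]; apply: H; rewrite t0/=.
move: k2; rewrite intrD mulrDl mul1r; lra.
Qed.

End CircleUniqueness.

(** * From the circle to the torus *)

Section TorusUniqueness.
Local Open Scope classical_set_scope.
Local Open Scope complex_scope.
Context {R : realType}.

Lemma dotDl n (x y : 'rV[R]_n) k : dot (x + y) k = dot x k + dot y k.
Proof. by rewrite /dot -big_split; apply: eq_bigr => j _; rewrite mxE mulrDl. Qed.

Lemma dotNl n (x : 'rV[R]_n) k : dot (- x) k = - dot x k.
Proof. by rewrite /dot -sumrN; apply: eq_bigr => j _; rewrite mxE mulNr. Qed.

Lemma dotBl n (x y : 'rV[R]_n) k : dot (x - y) k = dot x k - dot y k.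
Proof. by rewrite dotDl dotNl. Qed.

Lemma dotZl n (c : R) (x : 'rV[R]_n) k : dot (c *: x) k = c * dot x k.
Proof. by rewrite /dot mulr_sumr; apply: eq_bigr => j _; rewrite mxE mulrA. Qed.

Lemma dotDr n (x : 'rV[R]_n) k k' : dot x (k + k') = dot x k + dot x k'.
Proof.
by rewrite /dot -big_split; apply: eq_bigr => j _; rewrite mxE intrD mulrDr.
Qed.

Lemma dotNr n (x : 'rV[R]_n) k : dot x (- k) = - dot x k.
Proof. by rewrite /dot -sumrN; apply: eq_bigr => j _; rewrite mxE intrN mulrN. Qed.

Lemma dot0r n (x : 'rV[R]_n) : dot x 0 = 0.
Proof. by rewrite /dot big1// => j _; rewrite mxE mulr0. Qed.

Lemma dot_basis n (j : 'I_n) k : dot (basis_vec j : 'rV[R]_n) k = (k 0 j)%:~R.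
Proof.
rewrite /dot (bigD1 j)//= big1 ?addr0 ?mxE ?eqxx ?mul1r// => i ij.
by rewrite mxE eqxx/= (negbTE ij) mul0r.
Qed.

Lemma continuous_dot n (T : topologicalType) (f : T -> 'rV[R]_n) k :
  continuous f -> continuous (fun x => dot (f x) k).
Proof.
move=> cf; rewrite /dot; elim: (index_enum _) => [|i r IH].
  by under eq_fun do rewrite big_nil; exact: continuous_cst.
under eq_fun do rewrite big_cons.
apply: continuous_add => //; apply: continuous_mul; last exact: continuous_cst.
exact: (continuous_fcomp (@continuous_mx_entry R _ _ 0 i) cf).
Qed.

Definition int_cons n (k : int) (ks : 'rV[int]_n) : 'rV[int]_n.+1 :=
  row_mx (k%:M : 'rV[int]_1) ks.

Lemma int_cons0 n k (ks : 'rV[int]_n) : int_cons k ks 0 ord0 = k.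
Proof.
rewrite /int_cons (_ : ord0 = lshift n (0 : 'I_1)); last exact: val_inj.
by apply: etrans (row_mxEl _ _ _ _) _; rewrite mxE eqxx.
Qed.

Lemma int_consS n k (ks : 'rV[int]_n) j : int_cons k ks 0 (lift ord0 j) = ks 0 j.
Proof.
rewrite /int_cons (_ : lift ord0 j = rshift 1 j); last exact: val_inj.
exact: row_mxEr.
Qed.

Lemma dot_cons n (t : R) (v : 'rV[R]_n) k ks :
  dot (row_cons t v) (int_cons k ks) = t * k%:~R + dot v ks.
Proof.
rewrite /dot big_ord_recl row_cons0 int_cons0; congr (_ + _).
by apply: eq_bigr => j _; rewrite row_consS int_consS.
Qed.

Lemma row_cons_eta n (x : 'rV[R]_n.+1) :
  x = row_cons (x 0 ord0) (\row_j x 0 (lift ord0 j)).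
Proof.
apply/rowP => i; case: (unliftP ord0 i) => [k ->|->].
  by rewrite row_consS mxE.
by rewrite row_cons0.
Qed.

Lemma torus_integralS n (f : 'rV[R]_n.+1 -> R[i]) : ccont f ->
  torus_integral f = torus_integral (fun v : 'rV[R]_1 =>
    torus_integral (fun w => f (row_cons (v 0 0) w))).
Proof.
move=> cf; have [f1 f2] := cf.
rewrite (torus_integral1E (h := fun t => torus_integral (fun w => f (row_cons t w)))).
  by rewrite torus_integralE !cube_intS.
apply: (torus_integral_continuous (F := fun t w => f (row_cons t w))).
by split; [exact: (continuous_row_cons f1)|exact: (continuous_row_cons f2)].
Qed.

(** For a fixed first coordinate t, the induction hypothesis asks that the coefficients in the
    remaining variables vanish. As functions of t these are continuous and periodic, and their
    circle moments are coefficients of f, so [circle_uniqueness] applies to them. *)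
Lemma torus_uniqueness n (f : 'rV[R]_n -> R[i]) : ccont f -> torus_periodic f ->
  (forall k, torus_integral (fun y => expi (dot y k) * f y) = 0) ->
  forall x, f x = 0.
Proof.
elim: n f => [|n IH] f cf pf H0 x.
  have := H0 0; rewrite torus_integralE !cube_int0 dot0r expi0 mul1r.
  rewrite (_ : x = 0); last by apply/rowP; case.
  by case: (f 0) => a b.
have crc t : ccont (fun v => f (row_cons t v)).
  by case: cf => f1 f2; split;
    [exact: (continuous_row_cons_sec f1)|exact: (continuous_row_cons_sec f2)].
have crc2 : ccont (fun tv : R * 'rV[R]_n => f (row_cons tv.1 tv.2)).
  by case: cf => f1 f2; split;
    [exact: (continuous_row_cons f1)|exact: (continuous_row_cons f2)].
rewrite (row_cons_eta x); move: (\row_j _) => v; move: (x 0 ord0) => t.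
apply: (IH (fun v => f (row_cons t v))) => //.
  by move=> j w; rewrite addrC row_cons_shiftS addrC; exact: pf.
move=> ks.
apply: (circle_uniqueness
  (h := fun t => torus_integral (fun y => expi (dot y ks) * f (row_cons t y)))).
- apply: (torus_integral_continuous
    (F := fun t y => expi (dot y ks) * f (row_cons t y))).
  apply: ccontM => //; apply: ccont_expi; apply: continuous_dot.
  exact: continuous_snd.
- move=> s; congr torus_integral; apply/funext => y; congr (_ * _).
  rewrite addrC row_cons_shift0 addrC; exact: pf.
move=> k; rewrite -[RHS](H0 (int_cons k ks)).
rewrite (torus_integralS
  (f := fun y : 'rV[R]_n.+1 => expi (dot y (int_cons k ks)) * f y)); last first.
  by apply: ccontM => //; apply: ccont_expi; apply: continuous_dot; exact: continuous_id.
congr torus_integral; apply/funext => u; rewrite -torus_integralZ.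
  by congr torus_integral; apply/funext => y; rewrite dot_cons expiD mulrA.
apply: ccontM => //; apply: ccont_expi; apply: continuous_dot.
exact: continuous_id.
Qed.

End TorusUniqueness.

(** * Absolutely convergent sums over the lattice *)

Section LatticeSums.
Local Open Scope classical_set_scope.
Context {R : realType} {n : nat}.
Local Notation Z := 'rV[int]_n.

(** Summability of a nonnegative family, expressed by finite sums over duplicate-free lists, so that
    statements about infinite sums reduce to finite ones. *)
Definition sumbdd (b : Z -> R) : Prop :=
  (forall k, 0 <= b k) /\
  exists B : R, forall s : seq Z, uniq s -> \sum_(k <- s) b k <= B.

Lemma ler_sum_sub (T : eqType) (s s' : seq T) (F : T -> R) :
  uniq s -> uniq s' -> {subset s <= s'} -> (forall k, 0 <= F k) ->
  \sum_(k <- s) F k <= \sum_(k <- s') F k.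
Proof.
move=> us us' ss' F0.
rewrite (perm_big [seq k <- s' | k \in s]); last first.
  apply: uniq_perm => //; first exact: filter_uniq.
  by move=> k; rewrite mem_filter/=; case: (boolP (k \in s)) => //= /ss' ->.
rewrite big_filter big_mkcond ler_sum// => k _.
by case: ifP.
Qed.

Lemma sumbdd_le (b c : Z -> R) :
  (forall k, 0 <= b k <= c k) -> sumbdd c -> sumbdd b.
Proof.
move=> bc [c0 [B HB]]; split; first by move=> k; case/andP: (bc k).
exists B => s us; apply: le_trans (HB s us); apply: ler_sum => k _.
by case/andP: (bc k).
Qed.

Lemma sumbddD (b c : Z -> R) : sumbdd b -> sumbdd c -> sumbdd (fun k => b k + c k).
Proof.
move=> [b0 [B HB]] [c0 [C HC]]; split; first by move=> k; rewrite addr_ge0.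
by exists (B + C) => s us; rewrite big_split lerD ?HB ?HC.
Qed.

Lemma sumbddZ (r : R) (b : Z -> R) : 0 <= r -> sumbdd b -> sumbdd (fun k => r * b k).
Proof.
move=> r0 [b0 [B HB]]; split; first by move=> k; rewrite mulr_ge0.
by exists (r * B) => s us; rewrite -mulr_sumr ler_wpM2l// HB.
Qed.

Lemma esum_ge_seq (b : Z -> R) (s : seq Z) : (forall k, 0 <= b k) -> uniq s ->
  ((\sum_(k <- s) b k)%:E <= \esum_(k in setT) (b k)%:E)%E.
Proof.
move=> b0 us; apply: esum_ge; exists [set` s].
  by split => //; exact: finite_seq.
by rewrite -sumEFin (fsbig_seq _ _ us).
Qed.

Lemma esum_le_seq (b : Z -> R) (B : R) :
  (forall s : seq Z, uniq s -> \sum_(k <- s) b k <= B) ->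
  (\esum_(k in setT) (b k)%:E <= B%:E)%E.
Proof.
move=> HB; apply: ub_ereal_sup => _ /= [A [fA _] <-].
rewrite fsbig_finite//= sumEFin lee_fin; apply: HB; exact: finmap.fset_uniq.
Qed.

Lemma esum_fin (b : Z -> R) : sumbdd b ->
  (\esum_(k in setT) (b k)%:E)%E \is a fin_num.
Proof.
move=> [b0 [B HB]]; rewrite ge0_fin_numE.
  exact: le_lt_trans (esum_le_seq HB) (ltry _).
by apply: esum_ge0 => k _; rewrite lee_fin.
Qed.

Lemma esum_tail (b : Z -> R) (e : R) : sumbdd b -> 0 < e ->
  exists2 s0 : seq Z, uniq s0 & fine (\esum_(k in setT) (b k)%:E) - e
     <= \sum_(k <- s0) b k.
Proof.
move=> sb e0; have [b0 _] := sb; have := esum_fin sb.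
set S := esum _ _ => Sfin.
have [_ /= [A [fA _] <-]] := ub_ereal_sup_adherent e0 Sfin.
rewrite fsbig_finite//= sumEFin => H.
exists (finmap.enum_fset (fset_set A)); first exact: finmap.fset_uniq.
move: H; rewrite -[ereal_sup _]/S -(fineK Sfin) -EFinD lte_fin => H.
exact: ltW.
Qed.

Lemma sum_le_esum (b : Z -> R) (s : seq Z) : sumbdd b -> uniq s ->
  \sum_(k <- s) b k <= fine (\esum_(k in setT) (b k)%:E).
Proof.
move=> sb us; have [b0 _] := sb.
by rewrite -lee_fin fineK ?esum_fin//; exact: esum_ge_seq.
Qed.

(** The list s0 is extracted from the majorant b alone, so one list controls the tails of all g
    dominated by b. This uniformity is what continuity, integration and differentiation of series
    rest on. *)
Lemma rsum_tail (b : Z -> R) (e : R) : sumbdd b -> 0 < e ->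
  exists2 s0 : seq Z, uniq s0 & forall (g : Z -> R) (s : seq Z),
    (forall k, `|g k| <= b k) -> uniq s -> {subset s0 <= s} ->
    `|lattice_rsum g - \sum_(k <- s) g k| <= e.
Proof.
move=> sb e0; have [s0 us0 Hs0] := esum_tail sb e0; exists s0 => // g s gb us s0s.
have [b0 _] := sb.
have tail s' : uniq s' -> {subset s <= s'} ->
    `|\sum_(k <- s') g k - \sum_(k <- s) g k| <= e.
  move=> us' ss'.
  have pe : perm_eq s' (s ++ [seq k <- s' | k \notin s]).
    apply: uniq_perm => //.
      rewrite cat_uniq us filter_uniq//= andbT; apply/hasPn => k.
      by rewrite mem_filter => /andP[].
    move=> k; rewrite mem_cat mem_filter/=.
    by case: (boolP (k \in s)) => //= /ss' ->.
  rewrite (perm_big _ pe)/= big_cat/= [X in X - _]addrC addrK.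
  apply: le_trans (ler_norm_sum _ _ _) _.
  apply: le_trans (_ : \sum_(k <- [seq k <- s' | k \notin s]) b k <= _).
    exact: ler_sum.
  have : \sum_(k <- s0) b k + \sum_(k <- [seq k <- s' | k \notin s]) b k
      <= fine (\esum_(k in setT) (b k)%:E).
    rewrite -big_cat/=; apply: sum_le_esum => //.
    rewrite cat_uniq us0 filter_uniq//= andbT; apply/hasPn => k.
    rewrite mem_filter => /andP[/= ks _]; apply: contra ks; exact: s0s.
  lra.
have sp : sumbdd (fun k => Num.max (g k) 0).
  apply: sumbdd_le sb => k; rewrite le_max lexx orbT/= ge_max b0 andbT.
  exact: le_trans (ler_norm _) (gb k).
have sn : sumbdd (fun k => Num.max (- g k) 0).
  apply: sumbdd_le sb => k; rewrite le_max lexx orbT/= ge_max b0 andbT.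
  by rewrite (le_trans (ler_norm _))// normrN.
(* The sums of the positive and negative parts of g come with lists of their own; s is enlarged to
   contain both, at the further cost d. *)
apply/ler_addgt0Pr => d d0.
have d2 : 0 < d / 2 by rewrite divr_gt0.
have [s1 us1 H1] := esum_tail sp d2.
have [s2 us2 H2] := esum_tail sn d2.
pose s' := undup (s ++ s1 ++ s2).
have us' : uniq s' by exact: undup_uniq.
have ss' : {subset s <= s'} by move=> k; rewrite mem_undup mem_cat => ->.
have s1s' : {subset s1 <= s'}.
  by move=> k; rewrite mem_undup !mem_cat => ->; rewrite orbT.
have s2s' : {subset s2 <= s'}.
  by move=> k; rewrite mem_undup !mem_cat => ->; rewrite !orbT.
have m0 (f : Z -> R) k : 0 <= Num.max (f k) 0 by rewrite le_max lexx orbT.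
have h1 := ler_sum_sub us1 us' s1s' (m0 g).
have h2 := ler_sum_sub us2 us' s2s' (m0 (fun k => - g k)).
have h3 := sum_le_esum sp us'.
have h4 := sum_le_esum sn us'.
have E : \sum_(k <- s') g k =
    \sum_(k <- s') Num.max (g k) 0 - \sum_(k <- s') Num.max (- g k) 0.
  rewrite -sumrB; apply: eq_bigr => k _.
  case: (lerP (g k) 0) => gk.
    by rewrite maxC max_r ?oppr_ge0// sub0r opprK.
  by rewrite max_r ?subr0// oppr_le0 ltW.
have h5 := tail s' us' ss'.
have h6 : `|lattice_rsum g - \sum_(k <- s') g k| <= d.
  rewrite /lattice_rsum E ler_norml; apply/andP; split; lra.
have -> : lattice_rsum g - \sum_(k <- s) g k = (lattice_rsum g - \sum_(k <- s') g k)
  + (\sum_(k <- s') g k - \sum_(k <- s) g k) by ring.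
by rewrite (le_trans (ler_normD _ _))// addrC lerD.
Qed.

Lemma abs_summableP (f : Z -> R[i]) : abs_summable f <-> sumbdd (fun k => cabs (f k)).
Proof.
rewrite /abs_summable /summable.
under eq_esum => k _ do rewrite /= ger0_norm ?cabs_ge0//.
split=> [H|H]; last by have := esum_fin H; rewrite fin_numElt => /andP[].
split; first by move=> k; exact: cabs_ge0.
have Sfin : (\esum_(k in setT) (cabs (f k))%:E)%E \is a fin_num.
  by rewrite ge0_fin_numE//; apply: esum_ge0 => k _; rewrite lee_fin cabs_ge0.
exists (fine (\esum_(k in setT) (cabs (f k))%:E)) => s us.
by rewrite -lee_fin fineK//; apply: esum_ge_seq => // k; exact: cabs_ge0.
Qed.

Definition dominated (b : Z -> R) (f : Z -> R[i]) : Prop :=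
  sumbdd b /\ forall k, cabs (f k) <= b k.

Lemma dominated_summable b f : dominated b f -> abs_summable f.
Proof.
move=> [sb fb]; apply/abs_summableP; apply: sumbdd_le sb => k.
by rewrite cabs_ge0 fb.
Qed.

Lemma csum_tail (b : Z -> R) (e : R) : sumbdd b -> 0 < e ->
  exists2 s0 : seq Z, uniq s0 & forall (f : Z -> R[i]) (s : seq Z),
    (forall k, cabs (f k) <= b k) -> uniq s -> {subset s0 <= s} ->
    cabs (lattice_sum f - \sum_(k <- s) f k) <= e.
Proof.
move=> sb e0; have e2 : 0 < e / 2 by rewrite divr_gt0.
have [s0 us0 H] := rsum_tail sb e2; exists s0 => // f s fb us s0s.
apply: le_trans (cabs_le_ReIm _) _.
rewrite cReD cReN cImD cImN cRe_sum cIm_sum /=.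
have -> : e = e / 2 + e / 2 by field.
by apply: lerD; apply: H => // k; apply: le_trans (fb k);
  rewrite ?cabs_Re ?cabs_Im.
Qed.

Lemma cabs_small (z : R[i]) : (forall e : R, 0 < e -> cabs z <= e) -> z = 0.
Proof.
move=> H; apply: cabs_eq0; apply/eqP; rewrite eq_le cabs_ge0 andbT.
by apply/ler_addgt0Pr => e e0; rewrite add0r H.
Qed.

(** The pattern for the linear identities: infinite sums are replaced by finite sums over one list,
    chosen for a majorant that dominates every family involved, and the identity is clear for finite
    sums. *)
Lemma csumD b f c g : dominated b f -> dominated c g ->
  lattice_sum (fun k => f k + g k) = lattice_sum f + lattice_sum g.
Proof.
move=> [sb fb] [sc gc]; apply/subr0_eq/cabs_small => e e0.
have e3 : 0 < e / 3%:R by rewrite divr_gt0.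
have sbc := sumbddD sb sc.
have [s us H] := csum_tail sbc e3.
have [b0 _] := sb; have [c0 _] := sc.
have h1 := H f s _ us (fun _ => id).
have h2 := H g s _ us (fun _ => id).
have h3 := H (fun k => f k + g k) s _ us (fun _ => id).
have -> : lattice_sum (fun k => f k + g k) - (lattice_sum f + lattice_sum g) =
  (lattice_sum (fun k => f k + g k) - \sum_(k <- s) (f k + g k))
  - (lattice_sum f - \sum_(k <- s) f k) - (lattice_sum g - \sum_(k <- s) g k).
  by rewrite big_split/=; ring.
have -> : e = e / 3%:R + e / 3%:R + e / 3%:R by field.
apply: le_trans (cabsB _ _) _; apply: lerD; last first.
  by apply: h2 => k; rewrite (le_trans (gc k))// lerDr.
apply: le_trans (cabsB _ _) _; apply: lerD.
  by apply: h3 => k; rewrite (le_trans (cabsD _ _))// lerD.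
by apply: H => // k; rewrite (le_trans (fb k))// lerDl.
Qed.

Lemma csumZ b f (c : R[i]) : dominated b f ->
  lattice_sum (fun k => c * f k) = c * lattice_sum f.
Proof.
move=> [sb fb]; apply/subr0_eq/cabs_small => e e0.
have sbc := sumbddZ (addr_ge0 ler01 (cabs_ge0 c)) sb.
have c0 : 0 < 1 + cabs c by rewrite ltr_pwDl// cabs_ge0.
have e3 : 0 < e / (1 + (1 + cabs c)) by rewrite divr_gt0// addr_gt0.
have [b0 _] := sb.
have sbb := sumbddD sb sbc.
have [s us H] := csum_tail sbb e3.
have h1 : cabs (lattice_sum f - \sum_(k <- s) f k) <= e / (1 + (1 + cabs c)).
  apply: H => // k; rewrite (le_trans (fb k))// lerDl mulr_ge0//.
  exact: ltW.
have h3 : cabs (lattice_sum (fun k => c * f k) - \sum_(k <- s) c * f k)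
    <= e / (1 + (1 + cabs c)).
  apply: H => // k; rewrite cabsM.
  have : cabs c * cabs (f k) <= cabs c * b k by rewrite ler_wpM2l// cabs_ge0.
  have := b0 k; have := mulr_ge0 (cabs_ge0 c) (b0 k).
  by rewrite mulrDl mul1r; lra.
have -> : lattice_sum (fun k => c * f k) - c * lattice_sum f =
  (lattice_sum (fun k => c * f k) - \sum_(k <- s) c * f k)
  - c * (lattice_sum f - \sum_(k <- s) f k).
  by rewrite -mulr_sumr; ring.
apply: le_trans (cabsB _ _) _; rewrite cabsM.
have h4 : cabs c * cabs (lattice_sum f - \sum_(k <- s) f k) <=
   cabs c * (e / (1 + (1 + cabs c))) by rewrite ler_wpM2l// cabs_ge0.
apply: le_trans (lerD h3 h4) _.
set d := e / _ in e3 *.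
have -> : e = d * (1 + (1 + cabs c)).
  by rewrite /d divfK// gt_eqF// addr_gt0.
lra.
Qed.

Lemma csumN b f : dominated b f ->
  lattice_sum (fun k => - f k) = - lattice_sum f.
Proof.
move=> fb; rewrite -mulN1r -(csumZ _ fb); congr lattice_sum.
by apply/funext => k; rewrite mulN1r.
Qed.

Lemma dominatedN b f : dominated b f -> dominated b (fun k => - f k).
Proof. by move=> [sb fb]; split => // k; rewrite cabsN. Qed.

Lemma dominatedD b f c g : dominated b f -> dominated c g ->
  dominated (fun k => b k + c k) (fun k => f k + g k).
Proof.
move=> [sb fb] [sc gc]; split; first exact: sumbddD.
by move=> k; rewrite (le_trans (cabsD _ _))// lerD.
Qed.

Lemma dominatedZ b f c : dominated b f ->
  dominated (fun k => cabs c * b k) (fun k => c * f k).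
Proof.
move=> [sb fb]; split; first by apply: sumbddZ => //; exact: cabs_ge0.
by move=> k; rewrite cabsM ler_wpM2l// cabs_ge0.
Qed.

Lemma dominated0 : dominated (fun _ => 0) (fun _ => 0).
Proof.
split; last by move=> k; rewrite cabs0.
by split=> //; exists 0 => s _; rewrite big1.
Qed.

Lemma csumB b f c g : dominated b f -> dominated c g ->
  lattice_sum (fun k => f k - g k) = lattice_sum f - lattice_sum g.
Proof.
by move=> fb gc; rewrite (csumD fb (dominatedN gc)) (csumN gc).
Qed.

Lemma csum_le b f (B : R) : dominated b f ->
  (forall s : seq Z, uniq s -> \sum_(k <- s) b k <= B) ->
  cabs (lattice_sum f) <= B.
Proof.
move=> [sb fb] HB; apply/ler_addgt0Pr => e e0.
have [s us H] := csum_tail sb e0.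
have h := H f s fb us (fun _ => id).
have -> : lattice_sum f =
  \sum_(k <- s) f k + (lattice_sum f - \sum_(k <- s) f k) by ring.
rewrite (le_trans (cabsD _ _))// lerD//.
rewrite (le_trans (cabs_sum _ _ _))// (le_trans _ (HB s us))//.
exact: ler_sum.
Qed.

Lemma csum_single (f : Z -> R[i]) k0 : (forall k, k != k0 -> f k = 0) ->
  lattice_sum f = f k0.
Proof.
move=> f0; pose b k : R := if k == k0 then cabs (f k0) else 0.
have sb : sumbdd b.
  split; first by move=> k; rewrite /b; case: ifP => // _; exact: cabs_ge0.
  exists (cabs (f k0)) => s us; rewrite /b -big_mkcond/=.
  rewrite big_const_seq iter_addr_0.
  by rewrite count_uniq_mem//; case: (k0 \in s); rewrite ?mulr1n// mulr0n cabs_ge0.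
have fb k : cabs (f k) <= b k.
  rewrite /b; case: eqP => [->//|/eqP kk]; by rewrite f0// cabs0.
apply/subr0_eq/cabs_small => e e0.
have [s us H] := csum_tail sb e0.
have := H f (undup (k0 :: s)) fb (undup_uniq _).
have -> : \sum_(k <- undup (k0 :: s)) f k = f k0.
  rewrite (bigD1_seq k0) ?undup_uniq ?mem_undup ?inE ?eqxx//=.
  by rewrite big1 ?addr0.
by apply=> k ks; rewrite mem_undup inE ks orbT.
Qed.

(** Unordered sums of nonnegative terms are invariant under bijections, and [lattice_sum] is built
    from four of them. *)
Lemma csum_reindex (h h' : Z -> Z) (f : Z -> R[i]) : cancel h h' -> cancel h' h ->
  lattice_sum (fun k => f (h k)) = lattice_sum f.
Proof.
move=> hK h'K.
have E (g : Z -> \bar R) : (forall k, 0 <= g k)%E ->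
    (\esum_(k in setT) g (h k) = \esum_(k in setT) g k)%E.
  move=> g0; rewrite (reindex_esum setT setT h (fun k => g k))//.
  split=> //; first by move=> x y _ _; exact: (can_inj hK).
  by move=> k _; exists (h' k).
have rE (g : Z -> R) : lattice_rsum (fun k => g (h k)) = lattice_rsum g.
  rewrite /lattice_rsum.
  rewrite (E (fun k => (Num.max (g k) 0)%:E)); last first.
    by move=> k; rewrite lee_fin le_max lexx orbT.
  rewrite (E (fun k => (Num.max (- g k) 0)%:E))//.
  by move=> k; rewrite lee_fin le_max lexx orbT.
by rewrite /lattice_sum (rE (fun k => complex.Re (f k))) (rE (fun k => complex.Im (f k))).
Qed.

Lemma csum_sum (I : Type) (b : I -> Z -> R) (r : seq I) (P : pred I) (f : I -> Z -> R[i]) :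
  (forall i, dominated (b i) (f i)) ->
  lattice_sum (fun k => \sum_(i <- r | P i) f i k) =
  \sum_(i <- r | P i) lattice_sum (f i).
Proof.
move=> fb.
(* A majorant of the partial sum is carried through the induction, because [csumD] asks for one. *)
suff : (exists c, dominated c (fun k => \sum_(i <- r | P i) f i k)) /\
  lattice_sum (fun k => \sum_(i <- r | P i) f i k) =
  \sum_(i <- r | P i) lattice_sum (f i) by case.
elim: r => [|i r [[c IH1] IH2]].
  have -> : (fun k => \sum_(i <- [::] | P i) f i k) = (fun=> 0).
    by apply/funext => k; rewrite big_nil.
  rewrite big_nil; split; first by exists (fun=> 0); exact: dominated0.
  by rewrite (csum_single (k0 := 0)).
have -> : (fun k => \sum_(j <- i :: r | P j) f j k) = (fun k =>
    if P i then f i k + \sum_(j <- r | P j) f j k else \sum_(j <- r | P j) f j k).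
  by apply/funext => k; rewrite big_cons.
rewrite big_cons; case: (P i); last by split=> //; exists c.
split; last by rewrite (csumD (fb i) IH1) IH2.
by exists (fun k => b i k + c k); exact: dominatedD.
Qed.

(** The Weierstrass criterion: the majorant b does not depend on x, so one finite sum approximates
    the series at all points. *)
Lemma csum_ccont (T : topologicalType) (b : Z -> R) (f : Z -> T -> R[i]) :
  (forall k, ccont (f k)) -> (forall x, dominated b (f^~ x)) ->
  ccont (fun x => lattice_sum (f^~ x)).
Proof.
move=> cf fb.
have H (p : R[i] -> R) (pB : forall x y, `|p x - p y| <= cabs (x - y)) :
    (forall s : seq Z, continuous (fun x => p (\sum_(k <- s) f k x))) ->
    continuous (fun x => p (lattice_sum (f^~ x))).
  move=> cs x; have [sb _] := fb x; apply/cvgrPdist_le => /= e e0.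
  have e3 : 0 < e / 3%:R by rewrite divr_gt0.
  have [s us Hs] := csum_tail sb e3.
  have /cvgrPdist_le /(_ _ e3) := cs s x; apply: filterS => y Hy.
  have h1 := Hs (f^~ x) s (fb x).2 us (fun _ => id).
  have h2 := Hs (f^~ y) s (fb y).2 us (fun _ => id).
  have p1 := le_trans (pB _ _) h1; have p2 := le_trans (pB _ _) h2.
  have -> : p (lattice_sum (f^~ x)) - p (lattice_sum (f^~ y)) =
    (p (lattice_sum (f^~ x)) - p (\sum_(k <- s) f k x))
    + (p (\sum_(k <- s) f k x) - p (\sum_(k <- s) f k y))
    - (p (lattice_sum (f^~ y)) - p (\sum_(k <- s) f k y)) by ring.
  rewrite (le_trans (ler_normB _ _))//.
  have -> : e = e / 3%:R + e / 3%:R + e / 3%:R by field.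
  by rewrite lerD// (le_trans (ler_normD _ _))// lerD.
split.
  apply: (H (@complex.Re R)); first by move=> x y; rewrite -cReN -cReD cabs_Re.
  by move=> s; case: (ccont_sum s xpredT cf).
apply: (H (@complex.Im R)); first by move=> x y; rewrite -cImN -cImD cabs_Im.
by move=> s; case: (ccont_sum s xpredT cf).
Qed.

(** One list serves for the tails of the series at every point and for the tail of the series of
    integrals; the latter has the majorant c b, where c is the constant of [torus_integral_le]. *)
Lemma csum_torus_integral N (b : Z -> R) (f : Z -> 'rV[R]_N -> R[i]) :
  (forall k, ccont (f k)) -> (forall x, dominated b (f^~ x)) ->
  torus_integral (fun x => lattice_sum (f^~ x)) =
  lattice_sum (fun k => torus_integral (f k)).
Proof.
move=> cf fb; apply/subr0_eq/cabs_small => e e0.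
have [sb _] := fb 0; have [b0 _] := sb.
pose c : R := 2 * (2 * pi) ^+ N.
have c0 : 0 < c by rewrite mulr_gt0// exprn_gt0// two_pi_gt0.
have sbc := sumbddZ (ltW c0) sb.
have e2 : 0 < e / 2 by rewrite divr_gt0.
have e2c : 0 < e / 2 / c by rewrite divr_gt0.
have [s1 us1 H1] := csum_tail sb e2c.
have [s2 us2 H2] := csum_tail sbc e2.
pose s := undup (s1 ++ s2).
have us : uniq s by exact: undup_uniq.
have ss1 : {subset s1 <= s} by move=> k; rewrite mem_undup mem_cat => ->.
have ss2 : {subset s2 <= s} by move=> k; rewrite mem_undup mem_cat => ->; rewrite orbT.
have cfs : ccont (fun x => \sum_(k <- s) f k x) by exact: ccont_sum.
have h2 := H2 (fun k => torus_integral (f k)) s _ us ss2.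
have -> : torus_integral (fun x => lattice_sum (f^~ x)) -
   lattice_sum (fun k => torus_integral (f k)) =
   torus_integral (fun x => lattice_sum (f^~ x) - \sum_(k <- s) f k x)
   - (lattice_sum (fun k => torus_integral (f k))
      - \sum_(k <- s) torus_integral (f k)).
  rewrite torus_integralB//; last exact: (csum_ccont cf fb).
  by rewrite torus_integral_sum//; ring.
have -> : e = c * (e / 2 / c) + e / 2 by rewrite mulrCA divff ?gt_eqF// mulr1; field.
apply: le_trans (cabsB _ _) _; apply: lerD; last first.
  by apply: h2 => k; apply: torus_integral_le => // x; exact: (fb x).2.
apply: torus_integral_le.
  by apply: ccontB => //; exact: (csum_ccont cf fb).
by move=> x; apply: H1 => //; exact: (fb x).2.
Qed.

End LatticeSums.

(** * Termwise differentiation of series *)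

Section SumDerivative.
Local Open Scope classical_set_scope.
Context {R : realType}.

Lemma is_derive_epsE (V : normedModType R) (f : V -> R) (x v : V) (l : R) :
  is_derive x v f l -> forall e : R, 0 < e ->
     \forall h \near (0 : R), `|f (h *: v + x) - f x - h * l| <= e * `|h|.
Proof.
move=> [df dE] e e0.
have C : h^-1 *: ((f \o shift x) (h *: v) - f x) @[h --> 0^'] --> l.
  by rewrite -dE; exact: df.
move/cvgrPdist_le : C => /(_ e e0) /nbhs_ballP[r r0 Hr].
apply/nbhs_ballP; exists r => // h /= hr.
have [->|h0] := eqVneq h 0.
  by rewrite scale0r add0r subrr mul0r subr0 normr0 mulr0.
have := Hr h hr h0; rewrite /= => H.
have -> : f (h *: v + x) - f x - h * l =
  - (h * (l - h^-1 *: (f (h *: v + x) - f x))).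
  by rewrite [_ *: (_ - _)]/GRing.scale/=; field.
by rewrite normrN normrM mulrC ler_wpM2r.
Qed.

Lemma is_derive_of_line (V : normedModType R) (f : V -> R) (x v : V) (l : R) :
  is_derive (0 : R) 1 (fun h : R => f (h *: v + x)) l -> is_derive x v f l.
Proof.
move=> H; apply: is_derive_eps => e e0.
have := is_derive_epsE H e0; apply: filterS => h.
by rewrite [h *: 1]mulr1 addr0 scale0r add0r.
Qed.

(** The linearization error of each term, divided by h, is at most 2 c k by the mean value
    inequality. This majorant is independent of h, so the finite list is chosen before h; its
    finitely many terms are differentiated directly. *)
Lemma rsum_derive n (b c : 'rV[int]_n -> R) (g dg : 'rV[int]_n -> R -> R) :
  sumbdd b -> sumbdd c ->
  (forall k h, `|g k h| <= b k) -> (forall k h, `|dg k h| <= c k) ->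
  (forall k (h : R), is_derive h 1 (g k) (dg k h)) ->
  is_derive (0 : R) 1 (fun h : R => lattice_rsum (g^~ h)) (lattice_rsum (dg^~ 0)).
Proof.
move=> sb sc gb dgc dG; apply: is_derive_eps => e e0.
have e2 : 0 < e / 2 by rewrite divr_gt0.
have sc2 : sumbdd (fun k => 2 * c k) by apply: sumbddZ.
have [s us Hs] := rsum_tail sc2 e2.
have Dfin : is_derive (0 : R) 1 (fun h : R => \sum_(k <- s) g k h) (\sum_(k <- s) dg k 0).
  elim: (s) => [|k t IH].
    under eq_fun do rewrite big_nil; rewrite big_nil; exact: is_derive_cst.
  under eq_fun do rewrite big_cons; rewrite big_cons.
  exact: (is_deriveD (dG k 0) IH).
have := is_derive_epsE Dfin e2; apply: filterS => h.
rewrite [h *: 1]mulr1 addr0 => Hh.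
(* Linearity of the series for this combination, by comparison on one finite list; the majorant 2 b
   + (|h| + 1) c dominates all four families. *)
have lin : lattice_rsum (g^~ h) - lattice_rsum (g^~ 0) - h * lattice_rsum (dg^~ 0)
   = lattice_rsum (fun k => g k h - g k 0 - h * dg k 0).
  apply/eqP; rewrite -subr_eq0 -normr_le0; apply/ler_addgt0Pr => d d0; rewrite add0r.
  have h1 : 0 <= `|h| by [].
  have [b0 _] := sb; have [c0 _] := sc.
  have sbig := sumbddD (sumbddD sb sb) (sumbddD (sumbddZ h1 sc) sc).
  have d4 : 0 < d / (3%:R + `|h|) by rewrite divr_gt0// ltr_pwDl.
  have [t ut Ht] := rsum_tail sbig d4.
  have a1 := Ht (g^~ h) t _ ut (fun _ => id).
  have a2 := Ht (g^~ 0) t _ ut (fun _ => id).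
  have a3 := Ht (dg^~ 0) t _ ut (fun _ => id).
  have a4 := Ht (fun k => g k h - g k 0 - h * dg k 0) t _ ut (fun _ => id).
  have pos k : 0 <= `|h| * c k by rewrite mulr_ge0.
  have {}a1 : `|lattice_rsum (g^~ h) - \sum_(k <- t) g k h| <= d / (3%:R + `|h|).
    by apply: a1 => k; have := gb k h; have := b0 k; have := c0 k; have := pos k; lra.
  have {}a2 : `|lattice_rsum (g^~ 0) - \sum_(k <- t) g k 0| <= d / (3%:R + `|h|).
    by apply: a2 => k; have := gb k 0; have := b0 k; have := c0 k; have := pos k; lra.
  have {}a3 : `|lattice_rsum (dg^~ 0) - \sum_(k <- t) dg k 0| <= d / (3%:R + `|h|).
    by apply: a3 => k; have := dgc k 0; have := b0 k; have := c0 k; have := pos k; lra.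
  have {}a4 : `|lattice_rsum (fun k => g k h - g k 0 - h * dg k 0)
      - \sum_(k <- t) (g k h - g k 0 - h * dg k 0)| <= d / (3%:R + `|h|).
    apply: a4 => k; apply: le_trans (ler_normB _ _) _.
    have := ler_normB (g k h) (g k 0); rewrite normrM.
    have : `|h| * `|dg k 0| <= `|h| * c k by rewrite ler_wpM2l.
    by have := gb k h; have := gb k 0; have := c0 k; lra.
  have := a4; rewrite !sumrB -mulr_sumr => {}a4.
  have {}a3 : `|h * (lattice_rsum (dg^~ 0) - \sum_(k <- t) dg k 0)|
      <= `|h| * (d / (3%:R + `|h|)) by rewrite normrM ler_wpM2l.
  rewrite (_ : d = (3%:R + `|h|) * (d / (3%:R + `|h|))); last first.
    by rewrite mulrCA divff ?mulr1// gt_eqF// ltr_pwDl.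
  move: a1 a2 a3 a4; set q := d / _; rewrite !ler_norml mulrDl.
  move=> /andP[? ?] /andP[? ?] /andP[? ?] /andP[? ?].
  by apply/andP; split; lra.
rewrite lin.
have [->|h0] := eqVneq h 0.
  rewrite (_ : (fun k => _) = (fun=> 0)); last first.
    by apply/funext => k; rewrite mul0r subr0 subrr.
  rewrite /lattice_rsum !(esum1 (a := fun=> _)) ?subrr ?normr0 ?mulr0//.
    by move=> k _; rewrite oppr0 maxxx.
  by move=> k _; rewrite maxxx.
have nh : 0 < `|h| by rewrite normr_gt0.
have sg : sumbdd (fun k => 2 * `|h| * c k).
  by apply: sumbddZ => //; rewrite mulr_ge0.
have gh k : `|g k h - g k 0 - h * dg k 0| <= 2 * `|h| * c k.
  rewrite mulrAC; apply: (mvt_bound (df := dg k)).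
  move=> t _; rewrite (le_trans (ler_normB _ _))//.
  by have := dgc k t; have := dgc k 0; lra.
(* Division by h is what brings the errors under the majorant 2 c for which s was chosen. *)
have key : `|lattice_rsum (fun k => h^-1 * (g k h - g k 0 - h * dg k 0)) -
    \sum_(k <- s) h^-1 * (g k h - g k 0 - h * dg k 0)| <= e / 2.
  apply: Hs => // k; rewrite normrM normfV mulrC ler_pdivrMr//.
  by rewrite mulrAC; exact: gh.
have scal : lattice_rsum (fun k => h^-1 * (g k h - g k 0 - h * dg k 0)) =
    h^-1 * lattice_rsum (fun k => g k h - g k 0 - h * dg k 0).
  apply/eqP; rewrite -subr_eq0 -normr_le0; apply/ler_addgt0Pr => d d0; rewrite add0r.
  have sbb := sumbddD sg sc2.
  have d2 : 0 < d / (1 + `|h^-1|) by rewrite divr_gt0// ltr_pwDl.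
  have [t ut Ht] := rsum_tail sbb d2.
  have [c0 _] := sc.
  have a1 : `|lattice_rsum (fun k => g k h - g k 0 - h * dg k 0) -
      \sum_(k <- t) (g k h - g k 0 - h * dg k 0)| <= d / (1 + `|h^-1|).
    by apply: Ht => // k; rewrite (le_trans (gh k))// lerDl mulr_ge0.
  have a2 : `|lattice_rsum (fun k => h^-1 * (g k h - g k 0 - h * dg k 0)) -
      \sum_(k <- t) h^-1 * (g k h - g k 0 - h * dg k 0)| <= d / (1 + `|h^-1|).
    apply: Ht => // k; rewrite normrM normfV mulrC ler_pdivrMr//.
    rewrite (le_trans (gh k))// [X in _ <= X]mulrDl [X in _ <= _ + X]mulrAC.
    by rewrite lerDr mulr_ge0// mulr_ge0// mulr_ge0.
  have {}a1 : `|h^-1 * (lattice_rsum (fun k => g k h - g k 0 - h * dg k 0) -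
      \sum_(k <- t) (g k h - g k 0 - h * dg k 0))| <= `|h^-1| * (d / (1 + `|h^-1|)).
    by rewrite normrM ler_wpM2l.
  move: a2; rewrite -mulr_sumr => a2.
  rewrite (_ : d = (1 + `|h^-1|) * (d / (1 + `|h^-1|))); last first.
    by rewrite mulrCA divff ?mulr1// gt_eqF// ltr_pwDl.
  move: a1 a2; set q := d / _; rewrite !ler_norml mulrDl mul1r mulrBr.
  by move=> /andP[? ?] /andP[? ?]; apply/andP; split; lra.
move: key Hh; rewrite scal -mulr_sumr -mulrBr normrM normfV mulrC ler_pdivrMr//.
rewrite !sumrB -mulr_sumr => k1 k2.
set A := lattice_rsum _ in k1 *.
set B := _ - h * _ in k1 k2.
have -> : A = (A - B) + B by ring.
rewrite (le_trans (ler_normD _ _))//.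
have -> : e * `|h| = e / 2 * `|h| + e / 2 * `|h| by field.
exact: lerD.
Qed.

End SumDerivative.

(** * Smooth functions *)

Section Smoothness.
Local Open Scope classical_set_scope.
Local Open Scope complex_scope.
Context {R : realType}.

Definition is_partial n (j : 'I_n) (f : 'rV[R]_n -> R[i]) (x : 'rV[R]_n) (l : R[i]) :=
  is_derive x (basis_vec j) (fun y => complex.Re (f y)) (complex.Re l) /\
  is_derive x (basis_vec j) (fun y => complex.Im (f y)) (complex.Im l).

Section Dim.
Context {n : nat}.
Implicit Types (f g : 'rV[R]_n -> R[i]) (j : 'I_n).

Lemma is_partialE j f x l : is_partial j f x l -> partial j f x = l.
Proof. by case: l => a b [[_ d1] [_ d2]]; rewrite /partial d1 d2. Qed.

Lemma is_partial_cst j c x : is_partial j (fun=> c) x 0.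
Proof. by split; exact: is_derive_cst. Qed.

Lemma is_partialD j f g x l l' : is_partial j f x l -> is_partial j g x l' ->
  is_partial j (fun y => f y + g y) x (l + l').
Proof.
move=> [f1 f2] [g1 g2]; split.
  by under eq_fun do rewrite cReD; rewrite cReD; exact: is_deriveD.
by under eq_fun do rewrite cImD; rewrite cImD; exact: is_deriveD.
Qed.

Lemma is_derive_mul (f g : 'rV[R]_n -> R) x v (df dg : R) :
  is_derive x v f df -> is_derive x v g dg ->
  is_derive x v (fun y => f y * g y) (df * g x + f x * dg).
Proof.
move=> d1 d2; have := is_deriveM d1 d2.
by rewrite /GRing.scale/= addrC [_ * df]mulrC.
Qed.

Lemma is_partialM j f g x l l' : is_partial j f x l -> is_partial j g x l' ->
  is_partial j (fun y => f y * g y) x (l * g x + f x * l').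
Proof.
move=> [f1 f2] [g1 g2]; split.
  under eq_fun do rewrite cReM; rewrite cReD !cReM.
  have := is_deriveB (is_derive_mul f1 g1) (is_derive_mul f2 g2).
  by rewrite opprD addrACA.
under eq_fun do rewrite cImM; rewrite cImD !cImM.
have := is_deriveD (is_derive_mul f1 g2) (is_derive_mul f2 g1).
by rewrite addrACA.
Qed.

Lemma smooth_ccont f : smooth f -> ccont f.
Proof. by move=> /(_ [::])[]. Qed.

Lemma smooth_word f s : smooth f -> smooth (foldr partial f s).
Proof. by move=> sf t; have := sf (t ++ s); rewrite foldr_cat. Qed.

Lemma smooth_partial f j : smooth f -> smooth (partial j f).
Proof. exact: (@smooth_word f [:: j]). Qed.

Lemma smooth_is_partial f j x : smooth f -> is_partial j f x (partial j f x).
Proof.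
move=> sf; have [_ _ /(_ x j)[d1 d2]] := sf [::].
by split; [exact: (DeriveDef d1)|exact: (DeriveDef d2)].
Qed.

(** A coinduction principle: since [smooth] quantifies over all words of derivatives, it is enough
    to exhibit a class of continuous functions that contains f and is closed under partial
    derivatives. *)
Lemma smooth_coind (S : ('rV[R]_n -> R[i]) -> Prop) :
  (forall f, S f -> ccont f /\
     forall j, exists2 g, S g & forall x, is_partial j f x (g x)) ->
  forall f, S f -> smooth f.
Proof.
move=> HS f Sf s; have : S (foldr partial f s).
  elim: s => [//|j s IH] /=; have [_ /(_ j)[g Sg Hg]] := HS _ IH.
  by rewrite (_ : partial j _ = g)//; apply/funext => x; exact: is_partialE.
move: (foldr _ _ _) => g Sg; have [[c1 c2] Hj] := HS _ Sg; split=> // x j.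
by have [h _ /(_ x)[[d1 _] [d2 _]]] := Hj j.
Qed.

Lemma partial_cst j (c : R[i]) : partial j (fun=> c) = (fun=> 0).
Proof. by apply/funext => x; apply: is_partialE; exact: is_partial_cst. Qed.

Lemma smooth_cst (c : R[i]) : smooth (fun _ : 'rV[R]_n => c).
Proof.
apply: (smooth_coind (S := fun f => exists c, f = fun=> c)); last by exists c.
move=> f [c' ->]; split; first exact: ccont_cst.
by move=> j; exists (fun=> 0); [exists 0|move=> x; exact: is_partial_cst].
Qed.

Lemma partialD j f g : smooth f -> smooth g ->
  partial j (fun x => f x + g x) = (fun x => partial j f x + partial j g x).
Proof.
move=> sf sg; apply/funext => x; apply: is_partialE.
by apply: is_partialD; exact: smooth_is_partial.
Qed.

Lemma partialM j f g : smooth f -> smooth g ->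
  partial j (fun x => f x * g x) =
  (fun x => partial j f x * g x + f x * partial j g x).
Proof.
move=> sf sg; apply/funext => x; apply: is_partialE.
by apply: is_partialM; exact: smooth_is_partial.
Qed.

(** Finite sums of products of smooth functions. By the Leibniz rule the class is closed under
    derivatives, as [smooth_coind] requires, although single products are not. *)
Inductive prod_closure : ('rV[R]_n -> R[i]) -> Prop :=
| prod_closure_mul f g : smooth f -> smooth g -> prod_closure (fun x => f x * g x)
| prod_closure_add f g : prod_closure f -> prod_closure g ->
    prod_closure (fun x => f x + g x).

Lemma prod_closure_smooth f : prod_closure f -> smooth f.
Proof.
apply: smooth_coind => {}f; elim=> {f} [f g sf sg|f g Sf [cf Hf] Sg [cg Hg]].
  split; first by apply: ccontM; exact: smooth_ccont.
  move=> j; exists (fun x => partial j f x * g x + f x * partial j g x).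
    by apply: prod_closure_add; apply: prod_closure_mul; [exact: smooth_partial|exact: sg|exact: sf|exact: smooth_partial].
  by move=> x; apply: is_partialM; exact: smooth_is_partial.
split; first exact: ccontD.
move=> j; have [f' Sf' Hf'] := Hf j; have [g' Sg' Hg'] := Hg j.
exists (fun x => f' x + g' x); first exact: prod_closure_add.
by move=> x; exact: is_partialD.
Qed.

Lemma smoothM f g : smooth f -> smooth g -> smooth (fun x => f x * g x).
Proof. by move=> sf sg; apply: prod_closure_smooth; exact: prod_closure_mul. Qed.

Lemma smoothD f g : smooth f -> smooth g -> smooth (fun x => f x + g x).
Proof.
move=> sf sg; apply: prod_closure_smooth.
rewrite (_ : (fun x => _) = fun x => f x * 1 + g x * 1); last first.
  by apply/funext => x; rewrite !mulr1.
by apply: prod_closure_add; apply: prod_closure_mul; [exact: sf|exact: smooth_cst|exact: sg|exact: smooth_cst].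
Qed.

Lemma smoothZ (c : R[i]) f : smooth f -> smooth (fun x => c * f x).
Proof. exact: smoothM (smooth_cst c). Qed.

Lemma smoothN f : smooth f -> smooth (fun x => - f x).
Proof.
move=> sf; rewrite (_ : (fun x => - f x) = (fun x => -1 * f x)).
  exact: smoothZ.
by apply/funext => x; rewrite mulN1r.
Qed.

Lemma smoothB f g : smooth f -> smooth g -> smooth (fun x => f x - g x).
Proof. by move=> sf sg; exact: smoothD sf (smoothN sg). Qed.

Lemma smooth_sum (I : Type) (r : seq I) (P : pred I) (F : I -> 'rV[R]_n -> R[i]) :
  (forall i, smooth (F i)) -> smooth (fun x => \sum_(i <- r | P i) F i x).
Proof.
move=> sF; elim: r => [|i r IH].
  rewrite (_ : (fun x => _) = (fun=> 0)); first exact: smooth_cst.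
  by apply/funext => x; rewrite big_nil.
rewrite (_ : (fun x => _) = if P i then (fun x => F i x + \sum_(j <- r | P j) F j x)
  else (fun x => \sum_(j <- r | P j) F j x)).
  by case: (P i); [exact: smoothD (sF i) IH|exact: IH].
by apply/funext => x; rewrite big_cons; case: (P i).
Qed.

Lemma partialZ j c f : smooth f ->
  partial j (fun x => c * f x) = (fun x => c * partial j f x).
Proof.
move=> sf; rewrite (partialM _ (smooth_cst c) sf) partial_cst.
by apply/funext => x; rewrite mul0r add0r.
Qed.

Lemma wordD f g s : smooth f -> smooth g ->
  foldr partial (fun x => f x + g x) s =
  (fun x => foldr partial f s x + foldr partial g s x).
Proof.
move=> sf sg; elim: s => [//|j s /= ->].
exact: partialD (smooth_word s sf) (smooth_word s sg).
Qed.

Lemma wordZ c f s : smooth f ->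
  foldr partial (fun x => c * f x) s = (fun x => c * foldr partial f s x).
Proof.
move=> sf; elim: s => [//|j s /= ->]; exact: partialZ (smooth_word s sf).
Qed.

Lemma word_cst (c : R[i]) s :
  foldr partial (fun _ : 'rV[R]_n => c) s = (fun=> if s is [::] then c else 0).
Proof. by elim: s => [//|j s IH]; rewrite /= IH partial_cst; case: s {IH}. Qed.

Lemma word_sum (I : Type) (r : seq I) (P : pred I) (F : I -> 'rV[R]_n -> R[i]) s :
  (forall i, smooth (F i)) ->
  foldr partial (fun x => \sum_(i <- r | P i) F i x) s =
  (fun x => \sum_(i <- r | P i) foldr partial (F i) s x).
Proof.
move=> sF; elim: r => [|i r IH].
  rewrite (_ : (fun x => _) = (fun=> 0)); last first.
    by apply/funext => x; rewrite big_nil.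
  by rewrite word_cst; apply/funext => x; rewrite big_nil; case: s.
rewrite (_ : (fun x => \sum_(j <- _ | _) F j x) =
  if P i then (fun x => F i x + \sum_(j <- r | P j) F j x)
  else (fun x => \sum_(j <- r | P j) F j x)); last first.
  by apply/funext => x; rewrite big_cons; case: (P i).
under [RHS]eq_fun do rewrite big_cons.
case: (P i); last exact: IH.
by rewrite (wordD s (sF i) (smooth_sum r P sF)) IH.
Qed.

Lemma word_rcons f s j : foldr partial f (rcons s j) = foldr partial (partial j f) s.
Proof. by rewrite -cats1 foldr_cat. Qed.

End Dim.

(** * Composition with maps that send each coordinate direction to a coordinate direction or to 0 *)

Section Pullback.
Context {n m : nat} (L : 'rV[R]_n -> 'rV[R]_m) (sigma : 'I_n -> option 'I_m).
Hypothesis cL : continuous L.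
Hypothesis LE : forall j h x,
  L (h *: basis_vec j + x) = h *: oapp basis_vec 0 (sigma j) + L x.

Lemma is_derive_dir0 (V : normedModType R) (f : V -> R) x : is_derive x 0 f 0.
Proof.
apply: is_derive_eps => e e0; apply/nbhs_ballP; exists 1 => //= h _.
by rewrite scaler0 add0r subrr mulr0 subr0 normr0 mulr_ge0// ltW.
Qed.

Lemma is_partial_pullback f j x : smooth f -> is_partial j (fun y => f (L y)) x
  (if sigma j is Some i then partial i f (L x) else 0).
Proof.
move=> sf; have := LE j; case: (sigma j) => [i|] /= HL.
  have [d1 d2] := smooth_is_partial i (L x) sf.
  split.
    exact: (is_derive_affine (f := fun y => complex.Re (f y)) (fun h => HL h x) d1).
  exact: (is_derive_affine (f := fun y => complex.Im (f y)) (fun h => HL h x) d2).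
split.
  exact: (is_derive_affine (f := fun y => complex.Re (f y)) (fun h => HL h x)
    (is_derive_dir0 _ _)).
exact: (is_derive_affine (f := fun y => complex.Im (f y)) (fun h => HL h x)
  (is_derive_dir0 _ _)).
Qed.

Lemma smooth_pullback f : smooth f -> smooth (fun y => f (L y)).
Proof.
move=> sf; apply: (smooth_coind (S := fun g => exists2 f, smooth f & g = fun y => f (L y)));
  last by exists f.
move=> _ [g sg ->]; split; first exact: ccont_comp (smooth_ccont sg) cL.
move=> j; exists (fun y => if sigma j is Some i then partial i g (L y) else 0).
  case: (sigma j) => [i|]; first by exists (partial i g); [exact: smooth_partial|].
  by exists (fun=> 0); [exact: smooth_cst|].
by move=> x; exact: is_partial_pullback.
Qed.

(** The value [None] signals that some letter is a direction in which L is constant, so that the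
    derivative of the composite vanishes. *)
Fixpoint word_pullback (s : seq 'I_n) : option (seq 'I_m) :=
  if s is j :: s' then
    if (sigma j, word_pullback s') is (Some i, Some t) then Some (i :: t) else None
  else Some [::].

Lemma word_pullbackE f s : smooth f -> foldr partial (fun y => f (L y)) s =
  (fun y => if word_pullback s is Some t then foldr partial f t (L y) else 0).
Proof.
move=> sf; elim: s => [//|j s /= ->].
case: (word_pullback s) => [t|]; last by rewrite partial_cst; case: (sigma j).
apply/funext => x; rewrite (is_partialE (is_partial_pullback j x (smooth_word t sf))).
by case: (sigma j).
Qed.

Lemma word_pullback_size s t : word_pullback s = Some t -> size t = size s.
Proof.
elim: s t => [|j s IH] t /=; first by case=> <-.
case: (sigma j) => [i|//]; case: (word_pullback s) IH => [t'|//] IH [<-] /=.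
by rewrite (IH t').
Qed.

End Pullback.

Lemma word_pullback_map n m (tau : 'I_n -> 'I_m) s :
  word_pullback (fun j => Some (tau j)) s = Some (map tau s).
Proof. by elim: s => [//|j s /= ->]. Qed.

End Smoothness.

(** * Smooth dependence of integrals and series on parameters *)

Section ParametricSmoothness.
Local Open Scope classical_set_scope.
Local Open Scope complex_scope.
Context {R : realType}.

Lemma row_mx_shiftl N n (j : 'I_N) (h : R) (w : 'rV[R]_N) (y : 'rV[R]_n) :
  row_mx (h *: basis_vec j + w) y = h *: basis_vec (lshift n j) + row_mx w y.
Proof.
apply/rowP => i; rewrite -(splitK i); case: (fintype.split i) => k /=.
  rewrite row_mxEl [LHS]mxE [RHS]mxE row_mxEl; congr (_ + _).
  by rewrite !mxE eqxx/= (inj_eq (@lshift_inj _ _)).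
rewrite row_mxEr [RHS]mxE row_mxEr [X in _ = X + _]mxE mxE eqxx/=.
by rewrite eq_rlshift mulr0 add0r.
Qed.

Lemma row_mx_shiftr N n (j : 'I_n) (h : R) (w : 'rV[R]_N) (y : 'rV[R]_n) :
  row_mx w (h *: basis_vec j + y) = h *: basis_vec (rshift N j) + row_mx w y.
Proof.
apply/rowP => i; rewrite -(splitK i); case: (fintype.split i) => k /=.
  rewrite row_mxEl [RHS]mxE row_mxEl [X in _ = X + _]mxE mxE eqxx/=.
  by rewrite eq_lrshift mulr0 add0r.
rewrite row_mxEr [LHS]mxE [RHS]mxE row_mxEr; congr (_ + _).
by rewrite !mxE eqxx/= (inj_eq (@rshift_inj _ _)).
Qed.

Lemma ccont_row_mx N n (f : 'rV[R]_(N + n) -> R[i]) : ccont f ->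
  ccont (fun wy : 'rV[R]_N * 'rV[R]_n => f (row_mx wy.1 wy.2)).
Proof.
move=> cf; apply: ccont_comp cf _.
by apply: continuous_row_mx; [exact: continuous_fst|exact: continuous_snd].
Qed.

Lemma torus_integral_is_partial N n (f : 'rV[R]_(N + n) -> R[i]) (j : 'I_N) w :
  smooth f ->
  is_partial j (fun w => torus_integral (fun y : 'rV[R]_n => f (row_mx w y))) w
    (torus_integral (fun y => partial (lshift n j) f (row_mx w y))).
Proof.
move=> sf.
have cline (g : 'rV[R]_(N + n) -> R) : continuous g ->
    continuous (fun hy : R * 'rV[R]_n => g (row_mx (hy.1 *: basis_vec j + w) hy.2)).
  move=> cg; apply: (continuous_fcomp cg); apply: continuous_row_mx;
    last exact: continuous_snd.
  apply: continuous_mx => a b; under eq_fun do rewrite !mxE.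
  apply: continuous_add; last exact: continuous_cst.
  by apply: continuous_mul; [exact: continuous_fst|exact: continuous_cst].
have key (g dg : 'rV[R]_(N + n) -> R) : continuous g -> continuous dg ->
   (forall x, is_derive x (basis_vec (lshift n j)) g (dg x)) ->
   is_derive w (basis_vec j) (fun w => cube_int (fun y => g (row_mx w y)))
     (cube_int (fun y => dg (row_mx w y))).
  move=> cg cdg D; apply: is_derive_of_line.
  have := cube_int_derive (F := fun h y => g (row_mx (h *: basis_vec j + w) y))
   (G := fun h y => dg (row_mx (h *: basis_vec j + w) y)) (cline _ cg) (cline _ cdg).
  move=> /(_ _ 0); rewrite scale0r add0r; apply => h v.
  apply: (@is_derive_affine R R^o _ g (fun h => row_mx (h *: basis_vec j + w) v) h 1
     (basis_vec (lshift n j))).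
  by move=> s; rewrite [s *: 1]mulr1 scalerDl -addrA row_mx_shiftl.
have [c1 c2] := smooth_ccont sf.
have [d1 d2] := smooth_ccont (smooth_partial (lshift n j) sf).
split.
  by apply: (key _ _ c1 d1) => x; have [] := smooth_is_partial (lshift n j) x sf.
by apply: (key _ _ c2 d2) => x; have [] := smooth_is_partial (lshift n j) x sf.
Qed.

Lemma torus_integral_smooth N n (f : 'rV[R]_(N + n) -> R[i]) : smooth f ->
  smooth (fun w : 'rV[R]_N => torus_integral (fun y : 'rV[R]_n => f (row_mx w y))).
Proof.
move=> sf; apply: (smooth_coind (S := fun g => exists2 f : 'rV[R]_(N + n) -> R[i],
  smooth f & g = fun w => torus_integral (fun y : 'rV[R]_n => f (row_mx w y)))).
  move=> _ [g sg ->]; split.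
    apply: (torus_integral_continuous (F := fun w y => g (row_mx w y))).
    exact: ccont_row_mx (smooth_ccont sg).
  move=> j; exists (fun w => torus_integral (fun y => partial (lshift n j) g (row_mx w y))).
    by exists (partial (lshift n j) g); [exact: smooth_partial|].
  by move=> x; exact: torus_integral_is_partial.
by exists f.
Qed.

Lemma torus_integral_word N n (f : 'rV[R]_(N + n) -> R[i]) s : smooth f ->
  foldr partial (fun w : 'rV[R]_N =>
    torus_integral (fun y : 'rV[R]_n => f (row_mx w y))) s =
  (fun w => torus_integral (fun y =>
     foldr partial f (map (@lshift N n) s) (row_mx w y))).
Proof.
move=> sf; elim: s => [//|j s /= ->]; apply/funext => w; apply: is_partialE.
by apply: torus_integral_is_partial; exact: smooth_word.
Qed.

Section SumSmooth.
Context {N n : nat} (f : 'rV[int]_n -> 'rV[R]_N -> R[i]).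
Hypothesis sf : forall k, smooth (f k).
Hypothesis bf : forall s, exists2 b, sumbdd b &
  forall k x, cabs (foldr partial (f k) s x) <= b k.

Lemma csum_is_partial s j x :
  is_partial j (fun x => lattice_sum (fun k => foldr partial (f k) s x)) x
    (lattice_sum (fun k => foldr partial (f k) (j :: s) x)).
Proof.
have [b sb Hb] := bf s; have [c sc Hc] := bf (j :: s).
have line k h : is_partial j (foldr partial (f k) s) (h *: basis_vec j + x)
    (foldr partial (f k) (j :: s) (h *: basis_vec j + x)).
  exact: smooth_is_partial (smooth_word s (sf k)).
have E0 : (0 : R) *: basis_vec j + x = x by rewrite scale0r add0r.
split; apply: is_derive_of_line.
  have := @rsum_derive R n b c
    (fun k h => complex.Re (foldr partial (f k) s (h *: basis_vec j + x)))
    (fun k h => complex.Re (foldr partial (f k) (j :: s) (h *: basis_vec j + x))) sb sc.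
  rewrite E0; apply.
  - by move=> k h; apply: le_trans (cabs_Re _) (Hb _ _).
  - by move=> k h; apply: le_trans (cabs_Re _) (Hc _ _).
  by move=> k h; exact: (is_derive_line
    (f := fun y => complex.Re (foldr partial (f k) s y)) (line k h).1).
have := @rsum_derive R n b c
  (fun k h => complex.Im (foldr partial (f k) s (h *: basis_vec j + x)))
  (fun k h => complex.Im (foldr partial (f k) (j :: s) (h *: basis_vec j + x))) sb sc.
rewrite E0; apply.
- by move=> k h; apply: le_trans (cabs_Im _) (Hb _ _).
- by move=> k h; apply: le_trans (cabs_Im _) (Hc _ _).
by move=> k h; exact: (is_derive_line
  (f := fun y => complex.Im (foldr partial (f k) s y)) (line k h).2).
Qed.

(** The invariant class consists of the termwise differentiated series; the majorant available for
    each word makes every one of them continuous and differentiable. *)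
Lemma csum_smooth : smooth (fun x => lattice_sum (f^~ x)).
Proof.
apply: (smooth_coind (S := fun g => exists s, g =
  fun x => lattice_sum (fun k => foldr partial (f k) s x))); last by exists [::].
move=> _ [s ->]; split.
  have [b sb Hb] := bf s.
  apply: (csum_ccont (f := fun k => foldr partial (f k) s) (b := b)).
    by move=> k; exact: smooth_ccont (smooth_word s (sf k)).
  by move=> x; split=> // k; exact: Hb.
move=> j; exists (fun x => lattice_sum (fun k => foldr partial (f k) (j :: s) x)).
  by exists (j :: s).
exact: csum_is_partial.
Qed.

Lemma csum_word s : foldr partial (fun x => lattice_sum (f^~ x)) s =
  (fun x => lattice_sum (fun k => foldr partial (f k) s x)).
Proof.
elim: s => [//|j s /= ->]; apply/funext => x; apply: is_partialE.
exact: csum_is_partial.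
Qed.

End SumSmooth.

(** * Exponentials and summability over the lattice *)

Section Exponentials.
Context {n : nat}.
Implicit Types k : 'rV[int]_n.

Definition mode k (y : 'rV[R]_n) : R[i] := expi (dot y k).

Definition freq k (j : 'I_n) : R[i] := 0 +i* (k 0 j)%:~R.

Lemma mode_is_partial k j y : is_partial j (mode k) y (freq k j * mode k y).
Proof.
have E h : dot (h *: basis_vec j + y) k = h * (k 0 j)%:~R + dot y k.
  by rewrite dotDl dotZl dot_basis.
have Dlin : is_derive (0 : R) 1 (fun h : R => h * (k 0 j)%:~R + dot y k) (k 0 j)%:~R.
  apply: is_derive_eps => e e0; apply/nbhs_ballP; exists 1 => //= h _.
  rewrite [h *: 1]mulr1 addr0 (_ : _ - _ = 0) ?normr0 ?mulr_ge0// ?ltW//.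
  by ring.
split; apply: is_derive_of_line; rewrite ?cReM ?cImM /=.
  under eq_fun do rewrite E.
  have := @is_derive1_comp R (@cos R) (fun h : R => h * (k 0 j)%:~R + dot y k) 0
    _ _ (is_derive_cos _) Dlin.
  by rewrite mul0r add0r /= mulrC mulrN mul0r sub0r.
under eq_fun do rewrite E.
have := @is_derive1_comp R (@sin R) (fun h : R => h * (k 0 j)%:~R + dot y k) 0
  _ _ (is_derive_sin _) Dlin.
by rewrite mul0r add0r /= mul0r add0r mulrC.
Qed.

Lemma mode_smooth k : smooth (mode k).
Proof.
apply: (smooth_coind (S := fun g => exists c, g = fun y => c * mode k y)); last first.
  by exists 1; apply/funext => y; rewrite mul1r.
move=> _ [c ->]; split.
  by apply/ccontZ/ccont_expi/continuous_dot; exact: continuous_id.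
move=> j; exists (fun y => c * freq k j * mode k y); first by exists (c * freq k j).
move=> y; have := is_partialM (is_partial_cst j c y) (mode_is_partial k j y).
by rewrite mul0r add0r mulrA.
Qed.

Lemma mode_partial k j : partial j (mode k) = (fun y => freq k j * mode k y).
Proof. by apply/funext => y; apply: is_partialE; exact: mode_is_partial. Qed.

Lemma mode_word k s : foldr partial (mode k) s =
  (fun y => (\prod_(j <- s) freq k j) * mode k y).
Proof.
elim: s => [|j s /= ->]; first by apply/funext => y; rewrite big_nil mul1r.
rewrite (partialZ j _ (mode_smooth k)) mode_partial.
by apply/funext => y; rewrite big_cons mulrA [_ * freq k j]mulrC.
Qed.

Lemma cabs_mode k y : cabs (mode k y) = 1.
Proof. exact: cabs_expi. Qed.

Lemma mode_periodic k : torus_periodic (mode k).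
Proof. by move=> j y; rewrite /mode dotDl dotZl dot_basis expiD expi_2pi_int mulr1. Qed.

Lemma modeD k k' y : mode (k + k') y = mode k y * mode k' y.
Proof. by rewrite /mode dotDr expiD. Qed.

Lemma mode0 y : mode 0 y = 1.
Proof. by rewrite /mode dot0r expi0. Qed.

(** The l^1 analogue of the bracket. It splits into 1 and the |k_j|, which is how integration by
    parts produces it, and it dominates each 1 + |k_j|. *)
Definition size1 k : R := 1 + \sum_j `|(k 0 j)%:~R|.

Lemma size1_ge1 k : 1 <= size1 k.
Proof. by rewrite /size1 lerDl sumr_ge0. Qed.

Lemma size1_gt0 k : 0 < size1 k.
Proof. exact: lt_le_trans ltr01 (size1_ge1 k). Qed.

Lemma size1_ge0 k : 0 <= size1 k.
Proof. exact: ltW (size1_gt0 k). Qed.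

Lemma cabs_freq k j : cabs (freq k j) = `|(k 0 j)%:~R|.
Proof. by rewrite /cabs/= expr0n/= add0r sqrtr_sqr. Qed.

Lemma cabs_freq_le k j : cabs (freq k j) <= size1 k.
Proof.
rewrite cabs_freq /size1 (bigD1 j)//= addrCA lerDl addr_ge0//.
exact: sumr_ge0.
Qed.

Lemma cabs_prod_freq_le k s : cabs (\prod_(j <- s) freq k j) <= size1 k ^+ size s.
Proof.
elim: s => [|j s IH]; first by rewrite big_nil cabs1.
by rewrite big_cons cabsM exprS ler_pM ?cabs_ge0// cabs_freq_le.
Qed.

Lemma sum_inv_sq (N : nat) : \sum_(i < N) (1 + i%:R) ^- 2 <= 2 :> R.
Proof.
(* Strengthened so that the induction telescopes: with x = N + 1, the slack gained in one step is 1
   / (x (x + 1)^2). *)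
suff H : \sum_(i < N.+1) (1 + i%:R) ^- 2 <= 2 - (1 + N%:R)^-1 :> R.
  apply: le_trans (_ : \sum_(i < N.+1) (1 + i%:R) ^- 2 <= _).
    by rewrite big_ord_recr/= lerDl invr_ge0 exprn_ge0// addr_ge0.
  by rewrite (le_trans H)// gerBl invr_ge0 addr_ge0.
elim: N => [|N IH]; first by rewrite big_ord1 addr0 expr1n invr1; lra.
rewrite big_ord_recr/=; apply: le_trans (lerD IH (lexx _)) _.
have x0 : 0 < 1 + N%:R :> R by rewrite ltr_pwDl.
rewrite -(natr1 N) addrA; move: x0; set x : R := 1 + N%:R => x0.
rewrite -subr_ge0 (_ : _ - _ = (x * (x + 1) ^+ 2)^-1); last first.
  by field; rewrite !gt_eqF// addr_gt0.
by rewrite invr_ge0 mulr_ge0 ?exprn_ge0// ?ltW// addr_gt0.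
Qed.

(** The power 2n of [size1] dominates the product over j of (1 + |k_j|)^2, and the sum of the
    inverse product over a box factorizes into n one-dimensional sums, each at most 4. *)
Lemma sumbdd_size1 : sumbdd (fun k => size1 k ^- (2 * n)).
Proof.
pose w (k : int) : R := (1 + `|k%:~R|) ^- 2.
have w0 (k : int) : 0 <= w k by rewrite invr_ge0 exprn_ge0// addr_ge0.
have le1 (k : 'rV[int]_n) : size1 k ^- (2 * n) <= \prod_j w (k 0 j).
  rewrite /w prodfV lef_pV2 ?posrE ?exprn_gt0 ?size1_gt0//; last first.
    by rewrite prodr_gt0// => j _; rewrite exprn_gt0// ltr_pwDl.
  have -> : size1 k ^+ (2 * n) = \prod_(j < n) size1 k ^+ 2.
    by rewrite prodr_const card_ord exprM.
  apply: ler_prod => j _; rewrite exprn_ge0 ?addr_ge0//=.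
  rewrite lerXn2r ?nnegrE ?size1_ge0//.
  by rewrite /size1 lerD2l (bigD1 j)//= lerDl sumr_ge0.
split; first by move=> k; rewrite invr_ge0 exprn_ge0// size1_ge0.
exists (4 ^+ n) => s us.
apply: le_trans (_ : \sum_(k <- s) \prod_j w (k 0 j) <= _).
  by apply: ler_sum => k _; exact: le1.
pose az (k : 'rV[int]_n) j : nat := absz (k 0 j).
pose N := (\max_(k <- s) \max_(j < n) az k j)%N.
(* Integers of absolute value at most N are parametrized by a sign and a modulus. Zero occurs twice,
   which only enlarges the upper bound. *)
pose I := (bool * 'I_N.+1)%type.
pose phi (i : I) : int := (-1) ^+ i.1 * (i.2 : nat)%:Z.
pose Phi (f : {ffun 'I_n -> I}) : 'rV[int]_n := \row_j phi (f j).
pose Psi (k : 'rV[int]_n) : {ffun 'I_n -> I} :=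
  [ffun j => (k 0 j < 0, inord (az k j))].
have PK k : k \in s -> Phi (Psi k) = k.
  move=> ks; apply/rowP => j; rewrite mxE ffunE /phi/= inordK.
    rewrite /az abszE; have [k0|k0] := ltrP (k 0 j) 0.
      by rewrite expr1 mulN1r ltr0_norm// opprK.
    by rewrite expr0 mul1r ger0_norm.
  rewrite ltnS /N (big_rem _ ks)/= leq_max; apply/orP; left.
  exact: (leq_bigmax (F := az k) j).
have -> : \sum_(k <- s) \prod_j w (k 0 j) =
    \sum_(f <- map Psi s) \prod_j w (phi (f j)).
  rewrite big_map big_seq_cond [RHS]big_seq_cond; apply: eq_bigr => k.
  rewrite andbT => ks; rewrite -{1}(PK _ ks).
  by apply: eq_bigr => j _; rewrite mxE.
apply: le_trans (_ : \sum_(f : {ffun 'I_n -> I}) \prod_j w (phi (f j)) <= _).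
  apply: ler_sum_sub.
  - by rewrite map_inj_in_uniq// => k k' ks ks' /(congr1 Phi); rewrite !PK.
  - exact: index_enum_uniq.
  - by move=> f _; rewrite mem_index_enum.
  - by move=> f; apply: prodr_ge0.
rewrite -(bigA_distr_bigA (fun j i => w (phi i))) prodr_const card_ord.
apply: lerXn2r; rewrite ?nnegrE//.
  by apply: sumr_ge0.
rewrite -(pair_bigA _ (fun b i => w (phi (b, i))))/= big_bool/=.
have E b : \sum_(i < N.+1) w (phi (b, i)) <= 2.
  apply: le_trans (sum_inv_sq N.+1); apply: ler_sum => i _.
  rewrite /w /phi/= rmorphM rmorphXn rmorphN1/= normrM normrX normrN1 expr1n mul1r.
  by rewrite normr_nat.
by have := E true; have := E false; lra.
Qed.

End Exponentials.

End ParametricSmoothness.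

(** * Fourier series of smooth functions *)

Section FourierAnalysis.
Local Open Scope classical_set_scope.
Local Open Scope complex_scope.
Context {R : realType} {n : nat}.
Implicit Types (f g : 'rV[R]_n -> R[i]) (k : 'rV[int]_n) (j : 'I_n).

Lemma partial_periodic f j : smooth f -> torus_periodic f -> torus_periodic (partial j f).
Proof.
move=> sf pf i x; pose T := (2 * pi) *: basis_vec i : 'rV[R]_n.
have E : (fun y => f (y + T)) = f by apply/funext => y; exact: pf.
have HL (j' : 'I_n) (h : R) (y : 'rV[R]_n) :
    (h *: basis_vec j' + y) + T = h *: oapp basis_vec 0 (Some j') + (y + T).
  by rewrite addrA.
have := is_partial_pullback (L := fun y => y + T) HL j x sf.
by rewrite E => /is_partialE <-.
Qed.

Lemma word_periodic f s : smooth f -> torus_periodic f ->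
  torus_periodic (foldr partial f s).
Proof.
move=> sf pf; elim: s => [//|j s IH] /=.
exact: partial_periodic (smooth_word s sf) IH.
Qed.

Lemma smooth_torus_word f s : smooth_torus f -> smooth_torus (foldr partial f s).
Proof. by move=> [sf pf]; split; [exact: smooth_word|exact: word_periodic]. Qed.

Lemma smooth_torus_partial f j : smooth_torus f -> smooth_torus (partial j f).
Proof. exact: (@smooth_torus_word f [:: j]). Qed.

Lemma smooth_torusM f g : smooth_torus f -> smooth_torus g ->
  smooth_torus (fun x => f x * g x).
Proof.
move=> [sf pf] [sg pg]; split; first exact: smoothM.
by move=> j x; rewrite pf pg.
Qed.

Lemma smooth_torusD f g : smooth_torus f -> smooth_torus g ->
  smooth_torus (fun x => f x + g x).
Proof.
move=> [sf pf] [sg pg]; split; first exact: smoothD.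
by move=> j x; rewrite pf pg.
Qed.

Lemma smooth_torusZ c f : smooth_torus f -> smooth_torus (fun x => c * f x).
Proof.
move=> [sf pf]; split; first exact: smoothZ.
by move=> j x; rewrite pf.
Qed.

Lemma smooth_torus_mode k : smooth_torus (mode k : 'rV[R]_n -> R[i]).
Proof. by split; [exact: mode_smooth|exact: mode_periodic]. Qed.

Lemma torus_integral_partial0 f j : smooth_torus f -> torus_integral (partial j f) = 0.
Proof.
move=> [sf pf]; have [c1 c2] := smooth_ccont sf.
have [d1 d2] := smooth_ccont (smooth_partial j sf).
apply: complex_eq; rewrite torus_integralE /=.
  apply: (cube_int_partial0 (F := fun x => complex.Re (f x)) (j := j)) => //.
    by move=> x; rewrite pf.
  by move=> x; have [] := smooth_is_partial j x sf.
apply: (cube_int_partial0 (F := fun x => complex.Im (f x)) (j := j)) => //.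
  by move=> x; rewrite pf.
by move=> x; have [] := smooth_is_partial j x sf.
Qed.

(** The sign of the exponent is that of e^(i y k) in c, so this is (2 pi)^n times the usual
    coefficient at - k. Hence the minus sign in [fcoef_partial] and the modes at - k in the
    inversion formula. *)
Definition fcoef k f : R[i] := torus_integral (fun y => mode k y * f y).

Lemma fcoef_partial f j k : smooth_torus f ->
  fcoef k (partial j f) = - freq k j * fcoef k f.
Proof.
move=> tf; have [sf pf] := tf.
have := torus_integral_partial0 j (smooth_torusM (smooth_torus_mode k) tf).
rewrite (partialM j (mode_smooth k) sf) mode_partial torus_integralD.
- move=> /eqP; rewrite addrC addr_eq0 => /eqP.
  rewrite /fcoef => ->; rewrite mulNr; congr (- _); rewrite -torus_integralZ.
    by congr torus_integral; apply/funext => y; rewrite mulrA.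
  by apply: ccontM; [exact: smooth_ccont (mode_smooth k)|exact: smooth_ccont].
- by apply: ccontM; [exact: ccontZ (smooth_ccont (mode_smooth k))|exact: smooth_ccont].
- apply: ccontM; [exact: smooth_ccont (mode_smooth k)|].
  exact: smooth_ccont (smooth_partial j sf).
Qed.

Lemma fcoef_inj f g : smooth_torus f -> smooth_torus g ->
  (forall k, fcoef k f = fcoef k g) -> f = g.
Proof.
move=> [sf pf] [sg pg] E; apply/funext => x; apply/subr0_eq.
have cf := smooth_ccont sf; have cg := smooth_ccont sg.
apply: (torus_uniqueness (f := fun x => f x - g x)).
- exact: ccontB.
- by move=> j' y; rewrite pf pg.
move=> k; rewrite (_ : (fun y => _) = (fun y => mode k y * f y - mode k y * g y)).
  rewrite torus_integralB; first by have := E k; rewrite /fcoef => ->; rewrite subrr.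
    by apply: ccontM cf; exact: smooth_ccont (mode_smooth k).
  by apply: ccontM cg; exact: smooth_ccont (mode_smooth k).
by apply/funext => y; rewrite mulrBr.
Qed.

(* Both sides are smooth and periodic, and have the same Fourier coefficients. *)
Lemma partial_comm f i j : smooth_torus f ->
  partial i (partial j f) = partial j (partial i f).
Proof.
move=> tf; have ti i' := smooth_torus_partial i' tf.
apply: fcoef_inj (smooth_torus_partial i (ti j)) (smooth_torus_partial j (ti i)) _.
move=> k; have E1 := etrans (fcoef_partial i k (ti j))
  (congr1 ( *%R (- freq k i)) (fcoef_partial j k tf)).
have E2 := etrans (fcoef_partial j k (ti i))
  (congr1 ( *%R (- freq k j)) (fcoef_partial i k tf)).
exact: etrans E1 (etrans (mulrCA _ _ _) (esym E2)).
Qed.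

Lemma word_rem f s j : smooth_torus f -> j \in s ->
  foldr partial f s = partial j (foldr partial f (rem j s)).
Proof.
move=> tf; elim: s => [//|i s IH]; rewrite inE /=.
have [->//|ij /= js] := eqVneq i j.
rewrite (IH js); exact: partial_comm (smooth_torus_word _ tf).
Qed.

Lemma word_perm f s t : smooth_torus f -> perm_eq s t ->
  foldr partial f s = foldr partial f t.
Proof.
move=> tf; elim: t s => [|j t IH] s st; first by rewrite (perm_nilP st).
have js : j \in s by rewrite (perm_mem st) inE eqxx.
rewrite (word_rem tf js) /= (IH (rem j s))//.
by rewrite -(perm_cons j) -(permPl (perm_to_rem js)).
Qed.

Definition mi_word (alpha : 'I_n -> nat) : seq 'I_n :=
  flatten [seq nseq (alpha j) j | j <- enum 'I_n].

Lemma mi_compE (F : Type) (op : 'I_n -> F -> F) (alpha : 'I_n -> nat) (f : F) :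
  mi_comp (fun j m => iter m (op j)) alpha f = foldr op f (mi_word alpha).
Proof.
rewrite /mi_comp /mi_word; elim: (enum _) => [//|j s /= ->].
by rewrite foldr_cat; elim: (alpha j) => [//|m /= ->].
Qed.

Lemma deriv_miE alpha f : deriv_mi alpha f = foldr partial f (mi_word alpha).
Proof. exact: mi_compE. Qed.

Lemma size_mi_word alpha : size (mi_word alpha) = mi_size alpha.
Proof.
rewrite /mi_word /mi_size size_flatten /shape -map_comp sumnE big_map.
by rewrite big_enum/=; apply: eq_bigr => j _; rewrite /= size_nseq.
Qed.

Lemma count_mi_word alpha j : count_mem j (mi_word alpha) = alpha j.
Proof.
rewrite /mi_word count_flatten -map_comp sumnE big_map big_enum/=.
rewrite (bigD1 j)//= count_nseq/= eqxx mul1n big1 ?addn0// => i ij.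
by rewrite count_nseq/= (negbTE ij) mul0n.
Qed.

Lemma perm_mi_word s : perm_eq s (mi_word (fun j => count_mem j s)).
Proof. by apply/allP => j _ /=; rewrite count_mi_word. Qed.

Lemma wordE f s : smooth_torus f ->
  foldr partial f s = deriv_mi (fun j => count_mem j s) f.
Proof. by move=> tf; rewrite deriv_miE; exact: word_perm tf (perm_mi_word s). Qed.

Lemma mi_size_count s : mi_size (fun j => count_mem j s) = size s.
Proof. by rewrite -size_mi_word; exact/esym/perm_size/perm_mi_word. Qed.

Lemma periodic_int f x k : torus_periodic f ->
  f (x + \sum_j ((2 * pi) * (k 0 j)%:~R) *: basis_vec j) = f x.
Proof.
move=> pf.
have Hn (m : nat) j y : f (y + ((2 * pi) * m%:R) *: basis_vec j) = f y.
  elim: m => [|m IH]; first by rewrite mulr0 scale0r addr0.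
  by rewrite -(natr1 m) mulrDr mulr1 scalerDl addrA pf.
have Hz (z : int) j y : f (y + ((2 * pi) * z%:~R) *: basis_vec j) = f y.
  case: z => m; first exact: Hn.
  by rewrite -(Hn m.+1 j) NegzE mulrNz mulrN scaleNr subrK.
elim: (index_enum _) x => [|j s IH] x; first by rewrite big_nil addr0.
by rewrite big_cons addrA IH Hz.
Qed.

Lemma periodic_bounded f : ccont f -> torus_periodic f ->
  exists C : R, forall x, cabs (f x) <= C.
Proof.
move=> [c1 c2] pf.
have cpt := @rV_compact R n (fun=> `[0, 2 * pi]) (fun=> @segment_compact R 0 (2 * pi)).
set A := (X in compact X) in cpt.
have A0 : A !=set0.
  by exists 0 => i; rewrite /= mxE in_itv/= lexx ltW// two_pi_gt0.
have bnd (h : 'rV[R]_n -> R) : continuous h -> exists C, forall x, A x -> `|h x| <= C.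
  move=> ch.
  have [|c _ Hc] := @compact_EVT_max _ R (fun x => `|h x|) A A0 cpt.
    apply: continuous_subspaceT => x; exact: cvg_norm (ch x).
  by exists `|h c| => x Ax; apply: Hc; rewrite inE.
have [C1 H1] := bnd _ c1; have [C2 H2] := bnd _ c2.
exists (C1 + C2) => x.
(* The translation by periods that brings x into the compact cube [0, 2 pi]^n. *)
pose k : 'rV[int]_n := \row_j - Num.floor (x 0 j / (2 * pi)).
rewrite -(periodic_int x k pf); set y := x + _.
have Ay : A y.
  move=> j; rewrite /= /y mxE summxE (bigD1 j)//= big1; last first.
    by move=> i ij; rewrite !mxE eqxx/= eq_sym (negbTE ij) mulr0.
  rewrite addr0 !mxE !eqxx/= mulr1 mulrNz mulrN in_itv/=.
  have p0 := two_pi_gt0 (R := R).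
  have := floor_itv (x 0 j / (2 * pi)).
  rewrite ler_pdivlMr// ltr_pdivrMr// intrD mulrDl mul1r => /andP[h1 h2].
  by apply/andP; split; lra.
by apply: le_trans (cabs_le_ReIm _) _; apply: lerD; [exact: H1|exact: H2].
Qed.

End FourierAnalysis.

(** * Families of functions with uniform bounds on derivatives *)

Section OrderClasses.
Local Open Scope classical_set_scope.
Local Open Scope complex_scope.
Context {R : realType}.

(** Symbol bounds for a family with parameter q: W is the size and lam the price of one derivative,
    while C depends only on the word. For symbols W and lam are powers of <xi>; where k is large
    compared with xi, both become powers of [size1 k]. *)
Record family_order (P : Type) (D : P -> Prop) (n : nat) (W lam : P -> R)
    (F : P -> 'rV[R]_n -> R[i]) : Prop := FamilyOrder {
  order_smooth : forall q, D q -> smooth (F q);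
  order_pos : forall q, D q -> 0 <= W q /\ 1 <= lam q;
  order_bound : forall s : seq 'I_n, exists2 C : R, 0 <= C & forall q w, D q ->
    cabs (foldr partial (F q) s w) <= C * W q * lam q ^+ size s }.

Variables (P : Type) (D : P -> Prop).
Implicit Types (W lam : P -> R).

Lemma order_partial n W lam (F : P -> 'rV[R]_n -> R[i]) j :
  family_order D W lam F ->
  family_order D (fun q => W q * lam q) lam (fun q => partial j (F q)).
Proof.
move=> [sF pF bF]; split.
- by move=> q Dq; exact: smooth_partial (sF q Dq).
- move=> q Dq; have [W0 l1] := pF q Dq; split=> //.
  by rewrite mulr_ge0// (le_trans ler01).
move=> s; have [C C0 HC] := bF (rcons s j); exists C => // q w Dq.
rewrite -word_rcons (le_trans (HC _ _ Dq))// size_rcons exprS.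
by rewrite !mulrA.
Qed.

Lemma order_word n W lam (F : P -> 'rV[R]_n -> R[i]) s :
  family_order D W lam F ->
  family_order D (fun q => W q * lam q ^+ size s) lam (fun q => foldr partial (F q) s).
Proof.
move=> [sF pF bF]; split.
- by move=> q Dq; exact: smooth_word (sF q Dq).
- move=> q Dq; have [W0 l1] := pF q Dq; split=> //.
  by rewrite mulr_ge0// exprn_ge0// (le_trans ler01).
move=> t; have [C C0 HC] := bF (t ++ s); exists C => // q w Dq.
by rewrite -foldr_cat (le_trans (HC _ _ Dq))// size_cat addnC exprD !mulrA.
Qed.

Lemma orderD n W lam (F G : P -> 'rV[R]_n -> R[i]) :
  family_order D W lam F -> family_order D W lam G ->
  family_order D W lam (fun q x => F q x + G q x).
Proof.
move=> [sF pF bF] [sG pG bG]; split; last 1 first; last exact: pF; last first.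
  by move=> q Dq; exact: smoothD (sF q Dq) (sG q Dq).
move=> s; have [C C0 HC] := bF s; have [C' C0' HC'] := bG s.
exists (C + C'); first exact: addr_ge0.
move=> q w Dq; rewrite (wordD s (sF q Dq) (sG q Dq)) (le_trans (cabsD _ _))//.
by rewrite !mulrDl lerD ?HC ?HC'.
Qed.

(** Induction on the length of the word by its last letter, the derivative taken first. It falls on
    one of the two factors, and [order_partial] charges lam to the weight of that factor, so the
    induction runs over all families and weights. *)
Lemma orderM n W W' lam (F G : P -> 'rV[R]_n -> R[i]) :
  family_order D W lam F -> family_order D W' lam G ->
  family_order D (fun q => W q * W' q) lam (fun q x => F q x * G q x).
Proof.
move=> oF oG; have [sF pF bF] := oF; have [sG pG bG] := oG; split.
- by move=> q Dq; exact: smoothM (sF q Dq) (sG q Dq).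
- move=> q Dq; have [W0 l1] := pF q Dq; have [W0' _] := pG q Dq.
  by rewrite mulr_ge0.
move=> s; have [m sm] : exists m, size s = m by exists (size s).
elim: m s sm F G W W' oF oG {sF sG pF pG bF bG} => [|m IH] s sm F G W W' oF oG.
  have [C C0 HC] := order_bound oF [::]; have [C' C0' HC'] := order_bound oG [::].
  exists (C * C'); first exact: mulr_ge0.
  move=> q w Dq; rewrite (size0nil sm) /= cabsM mulr1 mulrACA.
  have := HC q w Dq; have := HC' q w Dq; rewrite !mulr1 => h1 h2.
  by rewrite ler_pM ?cabs_ge0.
case/lastP: s sm => [//|s j]; rewrite size_rcons => -[sm].
have [C C0 HC] := IH s sm _ _ _ _ (order_partial j oF) oG.
have [C' C0' HC'] := IH s sm _ _ _ _ oF (order_partial j oG).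
exists (C + C'); first exact: addr_ge0.
move=> q w Dq.
have [sF sG] := (order_smooth oF Dq, order_smooth oG Dq).
rewrite word_rcons (partialM j sF sG).
rewrite (wordD s (smoothM (smooth_partial j sF) sG) (smoothM sF (smooth_partial j sG))).
rewrite (le_trans (cabsD _ _))// !mulrDl; apply: lerD.
  by rewrite (le_trans (HC q w Dq))// exprS !mulrA (mulrAC (C * W q)).
by rewrite (le_trans (HC' q w Dq))// exprS !mulrA.
Qed.

Lemma order_cst n (c : P -> R[i]) W lam : (forall q, D q -> 0 <= W q /\ 1 <= lam q) ->
  (exists2 C, 0 <= C & forall q, D q -> cabs (c q) <= C * W q) ->
  family_order D W lam (fun q (_ : 'rV[R]_n) => c q).
Proof.
move=> pW [C C0 HC]; split; [by move=> q _; exact: smooth_cst|exact: pW|].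
move=> s; exists C => // q w Dq; have [W0 l1] := pW q Dq.
rewrite word_cst; case: s => [|j s]; first by rewrite mulr1 HC.
by rewrite cabs0 !mulr_ge0// exprn_ge0// (le_trans ler01).
Qed.

Lemma orderZ n (c : R[i]) W lam (F : P -> 'rV[R]_n -> R[i]) :
  family_order D W lam F -> family_order D W lam (fun q x => c * F q x).
Proof.
move=> [sF pF bF]; split; [by move=> q Dq; exact: smoothZ (sF q Dq)|exact: pF|].
move=> s; have [C C0 HC] := bF s; exists (cabs c * C).
  by rewrite mulr_ge0// cabs_ge0.
move=> q w Dq; rewrite (wordZ c s (sF q Dq)) cabsM -!mulrA ler_wpM2l ?cabs_ge0//.
by rewrite mulrA HC.
Qed.

Lemma order_le n W W' lam lam' (F : P -> 'rV[R]_n -> R[i]) :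
  (exists2 c, 0 <= c & forall q, D q -> W q <= c * W' q) ->
  (exists2 c, 0 <= c & forall q, D q -> lam q <= c * lam' q) ->
  (forall q, D q -> 0 <= W' q /\ 1 <= lam' q) ->
  family_order D W lam F -> family_order D W' lam' F.
Proof.
move=> [c c0 Hc] [d d0 Hd] pW' [sF pF bF]; split; [exact: sF|exact: pW'|move=> s].
have [C C0 HC] := bF s; exists (C * c * d ^+ size s).
  by rewrite !mulr_ge0// exprn_ge0.
move=> q w Dq; rewrite (le_trans (HC q w Dq))//.
have [W0 l1] := pF q Dq; have l0 := le_trans ler01 l1.
have -> : C * c * d ^+ size s * W' q * lam' q ^+ size s =
   C * (c * W' q) * (d * lam' q) ^+ size s by rewrite exprMn; ring.
rewrite ler_pM ?mulr_ge0 ?exprn_ge0//; first by rewrite ler_wpM2l// Hc.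
by rewrite lerXn2r ?nnegrE ?Hd// (le_trans l0 (Hd q Dq)).
Qed.

Lemma order_reparam (P' : Type) (D' : P' -> Prop) (h : P' -> P) n W lam
    (F : P -> 'rV[R]_n -> R[i]) : (forall q, D' q -> D (h q)) ->
  family_order D W lam F ->
  family_order D' (fun q => W (h q)) (fun q => lam (h q)) (fun q => F (h q)).
Proof.
move=> hD [sF pF bF]; split.
- by move=> q /hD; exact: sF.
- by move=> q /hD; exact: pF.
by move=> s; have [C C0 HC] := bF s; exists C => // q w /hD; exact: HC.
Qed.

Lemma order_pullback n m (L : P -> 'rV[R]_n -> 'rV[R]_m)
    (sigma : 'I_n -> option 'I_m) W lam (F : P -> 'rV[R]_m -> R[i]) :
  (forall q, continuous (L q)) ->
  (forall q j h x, L q (h *: basis_vec j + x) =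
     h *: oapp basis_vec 0 (sigma j) + L q x) ->
  family_order D W lam F -> family_order D W lam (fun q x => F q (L q x)).
Proof.
move=> cL LE [sF pF bF]; split; last 1 first; last exact: pF; last first.
  by move=> q Dq; exact: smooth_pullback (cL q) (LE q) _ (sF q Dq).
move=> s; case E : (word_pullback sigma s) => [t|].
  have [C C0 HC] := bF t; exists C => // q w Dq.
  by rewrite (word_pullbackE (LE q) _ (sF q Dq)) E -(word_pullback_size E) HC.
exists 0 => // q w Dq; rewrite (word_pullbackE (LE q) _ (sF q Dq)) E cabs0.
by rewrite !mul0r.
Qed.

Lemma order_periodic n W lam (F : P -> 'rV[R]_n -> R[i]) j :
  family_order D W lam F -> (forall q, D q -> torus_periodic (F q)) ->
  forall q, D q -> torus_periodic (partial j (F q)).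
Proof.
by move=> oF pF q Dq; exact: partial_periodic (order_smooth oF Dq) (pF q Dq).
Qed.

(** Integration by parts: one factor [size1 k] is 1 plus the sum of the |k_j|, and |k_j| times a
    coefficient of F is, in modulus, a coefficient of its derivative in direction j, a family of
    weight W lam. *)
Lemma fcoef_decay n W lam (F : P -> 'rV[R]_n -> R[i]) (K : nat) :
  family_order D W lam F -> (forall q, D q -> torus_periodic (F q)) ->
  exists2 C : R, 0 <= C & forall q k, D q ->
    size1 k ^+ K * cabs (fcoef k (F q)) <= C * W q * lam q ^+ K.
Proof.
elim: K F W => [|K IH] F W oF pF.
  have [C C0 HC] := order_bound oF [::].
  exists (2 * (2 * pi) ^+ n * C).
    by rewrite !mulr_ge0// exprn_ge0// ltW// two_pi_gt0.
  move=> q k Dq; rewrite mul1r mulr1 -mulrA; apply: torus_integral_le.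
    apply: ccontM; first exact: smooth_ccont (mode_smooth k).
    exact: smooth_ccont (order_smooth oF Dq).
  by move=> x; rewrite cabsM cabs_mode mul1r; have := HC q x Dq; rewrite /= mulr1.
have [C0 C00 H0] := IH F W oF pF.
have /choice[C HC] : forall j, exists C, 0 <= C /\ forall q k, D q ->
    size1 k ^+ K * cabs (fcoef k (partial j (F q))) <= C * (W q * lam q) * lam q ^+ K.
  move=> j; have [C Cge HC] := IH _ _ (order_partial j oF) (order_periodic j oF pF).
  by exists C.
exists (C0 + \sum_j C j).
  by rewrite addr_ge0// sumr_ge0// => j _; have [] := HC j.
move=> q k Dq; have [W0 l1] := order_pos oF Dq.
have l0 := le_trans ler01 l1.
rewrite exprSr -mulrA {2}/size1 mulrDl mul1r mulrDr !mulrDl; apply: lerD.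
  rewrite (le_trans (H0 q k Dq))// ler_wpM2l ?mulr_ge0// exprS ler_peMl//.
  exact: exprn_ge0.
rewrite !mulr_suml mulr_sumr; apply: ler_sum => j _.
have [_ Hj] := HC j; have := Hj q k Dq.
rewrite fcoef_partial; last by split; [exact: order_smooth oF q Dq|exact: pF].
by rewrite mulNr cabsN cabsM cabs_freq exprS !mulrA.
Qed.

End OrderClasses.

(** * Fourier inversion *)

Section FourierInversion.
Local Open Scope classical_set_scope.
Local Open Scope complex_scope.
Context {R : realType} {n : nat}.
Implicit Types (f g : 'rV[R]_n -> R[i]) (k : 'rV[int]_n).

Lemma smooth_torus_order f : smooth_torus f ->
  family_order (fun _ : unit => True) (fun=> 1) (fun=> 1) (fun=> f).
Proof.
move=> [sf pf]; split; [by move=> _ _; exact: sf|by []|].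
move=> s; have [C HC] := periodic_bounded (smooth_ccont (smooth_word s sf))
  (word_periodic s sf pf).
exists C; first exact: le_trans (cabs_ge0 _) (HC 0).
by move=> _ w _; rewrite expr1n !mulr1.
Qed.

Lemma fcoef_rapid f (K : nat) : smooth_torus f -> exists2 C : R, 0 <= C &
  forall k, size1 k ^+ K * cabs (fcoef k f) <= C.
Proof.
move=> tf; have [_ pf] := tf.
have [C C0 HC] := fcoef_decay K (smooth_torus_order tf) (fun _ _ => pf).
by exists C => // k; have := HC tt k I; rewrite expr1n !mulr1.
Qed.

Lemma rapid_le (z C : R) k (K : nat) : size1 k ^+ K * z <= C -> z <= C * size1 k ^- K.
Proof.
by move=> H; rewrite ler_pdivlMr ?exprn_gt0 ?size1_gt0// mulrC.
Qed.

Lemma sumbdd_rapid (C : R) : 0 <= C ->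
  sumbdd (fun k : 'rV[int]_n => C * size1 k ^- (2 * n)).
Proof. by move=> C0; exact: sumbddZ C0 sumbdd_size1. Qed.

Lemma fcoef_mode k k' : fcoef k (mode k' : 'rV[R]_n -> R[i]) =
  if k + k' == 0 then ((2 * pi) ^+ n)%:C else 0.
Proof.
have E : (fun y : 'rV[R]_n => mode k y * mode k' y) = mode (k + k').
  by apply/funext => y; rewrite modeD.
rewrite /fcoef E; case: eqP => [->|/eqP kk].
  rewrite (_ : mode 0 = fun=> 1); last by apply/funext => y; rewrite mode0.
  by rewrite torus_integral_cst mulr1.
have [j jk] : exists j, (k + k') 0 j != 0.
  apply/existsP; apply: contraNT kk; rewrite negb_exists => /forallP H.
  by apply/eqP/rowP => j; rewrite [RHS]mxE; apply/eqP; have := H j; rewrite negbK.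
have := torus_integral_partial0 j (smooth_torus_mode (R := R) (k + k')).
rewrite mode_partial torus_integralZ; last exact: smooth_ccont (mode_smooth _).
move=> /eqP; rewrite mulf_eq0 => /orP[|/eqP//].
by rewrite /freq eq_complex/= eqxx/= intr_eq0 (negbTE jk).
Qed.

Lemma two_pi_mnE : ((2 * pi) ^+ n)%:C * two_pi_mn (n := n) = 1 :> R[i].
Proof.
rewrite /two_pi_mn -rmorphM/= divff// expf_neq0// gt_eqF//.
exact: two_pi_gt0.
Qed.

Lemma size1N k : size1 (- k) = size1 k :> R.
Proof.
rewrite /size1; congr (_ + _); apply: eq_bigr => j _.
by rewrite mxE intrN normrN.
Qed.

(** Rapid decay makes the series converge to a continuous periodic function. By orthogonality of the
    modes it has the Fourier coefficients of f, and uniqueness applies to the difference. *)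
Lemma fourier_inversion f z : smooth_torus f ->
  f z = lattice_sum (fun k => mode (- k) z * (two_pi_mn (n := n) * fcoef k f)).
Proof.
move=> tf; have [sf pf] := tf.
have [C C0 HC] := fcoef_rapid (2 * n) tf.
pose c k := two_pi_mn (n := n) * fcoef k f.
pose b k : R := cabs (two_pi_mn (n := n) : R[i]) * C * size1 k ^- (2 * n).
have sb : sumbdd b by apply: sumbdd_rapid; rewrite mulr_ge0// cabs_ge0.
have cb k : cabs (c k) <= b k.
  by rewrite cabsM /b -mulrA ler_wpM2l ?cabs_ge0//; exact: rapid_le.
have domz z' : dominated b (fun k => mode (- k) z' * c k).
  by split=> // k; rewrite cabsM cabs_mode mul1r.
have cm k : ccont (mode k : 'rV[R]_n -> R[i]).
  exact: smooth_ccont (mode_smooth k).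
have cterm k : ccont (fun z => mode (- k) z * c k).
  by apply: ccontM => //; exact: ccont_cst.
have cg := csum_ccont cterm domz.
apply/subr0_eq; apply: (torus_uniqueness
  (f := fun z => f z - lattice_sum (fun k => mode (- k) z * c k))).
- by apply: ccontB => //; exact: smooth_ccont.
- move=> j x; rewrite pf; congr (_ - _); congr lattice_sum; apply/funext => k.
  by rewrite mode_periodic.
move=> k0.
rewrite (_ : (fun y => _) = (fun y => mode k0 y * f y -
  lattice_sum (fun k => mode k0 y * (mode (- k) y * c k)))); last first.
  by apply/funext => y; rewrite mulrBr (csumZ _ (domz y)).
have dom2 y : dominated b (fun k => mode k0 y * (mode (- k) y * c k)).
  by split=> // k; rewrite !cabsM !cabs_mode !mul1r; have := cb k; rewrite cabsM.
have cterm2 k : ccont (fun y => mode k0 y * (mode (- k) y * c k)).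
  by apply: ccontM => //; exact: cterm.
rewrite torus_integralB; first last.
- exact: (csum_ccont cterm2 dom2).
- by apply: ccontM => //; exact: smooth_ccont.
rewrite (csum_torus_integral cterm2 dom2).
have E k : torus_integral (fun y => mode k0 y * (mode (- k) y * c k)) =
    c k * fcoef k0 (mode (- k)).
  rewrite /fcoef -torus_integralZ; last exact: ccontM.
  by congr torus_integral; apply/funext => y; ring.
under [X in lattice_sum X]eq_fun do rewrite E fcoef_mode.
rewrite (csum_single (k0 := k0)); last first.
  by move=> k kk; rewrite subr_eq0 eq_sym (negbTE kk) mulr0.
by rewrite subrr eqxx /c mulrC mulrA two_pi_mnE mul1r subrr.
Qed.

End FourierInversion.

(** * Discrete Taylor expansion *)

Section DiscreteTaylor.
Local Open Scope complex_scope.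
Context {R : realType} {n : nat}.
Local Notation Z := 'rV[int]_n.
Implicit Types (k x : Z) (s : Z -> R[i]) (j : 'I_n).

Lemma diff_step_comm i j s : diff_step i (diff_step j s) = diff_step j (diff_step i s).
Proof.
apply/funext => x; rewrite /diff_step.
by rewrite (addrAC x); ring.
Qed.

Lemma diff_miE alpha s : diff_mi alpha s = foldr diff_step s (mi_word alpha).
Proof. exact: mi_compE. Qed.

Lemma diff_word_rem s (d : seq 'I_n) j : j \in d ->
  foldr diff_step s d = diff_step j (foldr diff_step s (rem j d)).
Proof.
elim: d => [//|i d IH]; rewrite inE /=.
have [->//|ij /= jd] := eqVneq i j.
by rewrite (IH jd) diff_step_comm.
Qed.

Lemma diff_word_perm s (d d' : seq 'I_n) : perm_eq d d' ->
  foldr diff_step s d = foldr diff_step s d'.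
Proof.
elim: d' d => [|j d' IH] d dd'; first by rewrite (perm_nilP dd').
have jd : j \in d by rewrite (perm_mem dd') inE eqxx.
rewrite (diff_word_rem s jd) /= (IH (rem j d))//.
by rewrite -(perm_cons j) -(permPl (perm_to_rem jd)).
Qed.

Lemma diff_wordE s (d : seq 'I_n) :
  foldr diff_step s d = diff_mi (fun j => count_mem j d) s.
Proof. by rewrite diff_miE; exact: diff_word_perm (perm_mi_word d). Qed.

Lemma diff_word_rcons s d j :
  foldr diff_step s (rcons d j) = foldr diff_step (diff_step j s) d.
Proof. by rewrite -cats1 foldr_cat. Qed.

Lemma diff_wordD s s' d x :
  foldr diff_step (fun x => s x + s' x) d x =
  foldr diff_step s d x + foldr diff_step s' d x.
Proof. by elim: d x => [//|j d IH] x /=; rewrite {1}/diff_step !IH /diff_step; ring. Qed.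

Lemma diff_mi_incr (alpha : 'I_n -> nat) j s :
  diff_mi (fun i => alpha i + (i == j))%N s = diff_mi alpha (diff_step j s).
Proof.
rewrite !diff_miE -diff_word_rcons; apply: diff_word_perm.
apply/allP => i _ /=; rewrite -cats1 count_cat !count_mi_word /=.
by rewrite addn0 (eq_sym j).
Qed.

Definition norm1 k : nat := (\sum_j absz (k 0%R j))%N.

Lemma size1E k : size1 k = 1 + (norm1 k)%:R :> R.
Proof.
rewrite /size1 /norm1 natr_sum; congr (_ + _); apply: eq_bigr => j _.
by rewrite -intr_norm -abszE.
Qed.

Lemma norm1_eq0 k : norm1 k = 0%N -> k = 0.
Proof.
move=> /eqP; rewrite /norm1 sum_nat_eq0 => /forallP H.
by apply/rowP => j; rewrite mxE; apply/eqP; rewrite -absz_eq0; exact: H.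
Qed.

Lemma norm1_update k k' j : (forall i, i != j -> k' 0 i = k 0 i) ->
  absz (k 0 j) = (absz (k' 0 j)).+1 -> norm1 k = (norm1 k').+1.
Proof.
move=> H E; rewrite /norm1 (bigD1 j)//= [in RHS](bigD1 j)//= E addSn.
by congr (_ + _).+1; apply: eq_bigr => i ij; rewrite H.
Qed.

(** Walk from k to 0 by unit steps that decrease [norm1]. The path has [norm1 k] steps and stays
    among points of norm at most N, where the differences are bounded by B. *)
Lemma lattice_path_bound (g : Z -> R[i]) (N : nat) (B : R) :
  g 0 = 0 ->
  (forall j k, (norm1 k <= N)%N -> cabs (g (k + delta_mx 0 j) - g k) <= B) ->
  forall k, (norm1 k <= N)%N -> cabs (g k) <= (norm1 k)%:R * B.
Proof.
move=> g0 HB k kN; have [m mk] : exists m, norm1 k = m by exists (norm1 k).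
elim: m k kN mk => [|m IH] k kN mk.
  by rewrite (norm1_eq0 mk) g0 cabs0 -(norm1_eq0 mk) mk mul0r.
have [j kj] : exists j, k 0 j != 0.
  have k0 : k != 0.
    by apply: contra_eq_neq mk => ->; rewrite /norm1 big1// => i _; rewrite mxE.
  apply/existsP; apply: contraNT k0; rewrite negb_exists => /forallP H.
  by apply/eqP/rowP => j; rewrite mxE; apply/eqP; have := H j; rewrite negbK.
have Dj : (delta_mx 0 j : Z) 0 j = 1 by rewrite mxE !eqxx.
have Di i : i != j -> (delta_mx 0 j : Z) 0 i = 0.
  by move=> ij; rewrite mxE eqxx/= (negbTE ij).
have [kpos|kneg] := ltrP 0 (k 0 j).
  pose k' := k - delta_mx 0 j.
  have mk' : norm1 k' = m.
    apply/eq_add_S; rewrite -mk; apply/esym/(norm1_update (j := j)).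
      by move=> i ij; rewrite mxE mxE Di// subr0.
    rewrite mxE [X in (_ + X)%R]mxE Dj; move: kpos; case: (k 0 j) => [[|p]|p]//= _.
    by rewrite subn1.
  have k'N : (norm1 k' <= N)%N by rewrite mk' (leq_trans _ kN)// mk.
  have := HB j k' k'N; rewrite subrK => h1.
  have := IH k' k'N mk'; rewrite mk' => h2.
  have -> : g k = (g k - g k') + g k' by ring.
  by rewrite (le_trans (cabsD _ _))// mk -natr1 mulrDl mul1r addrC lerD.
have {}kneg : k 0 j < 0 by rewrite lt_neqAle kj kneg.
pose k' := k + delta_mx 0 j.
have mk' : norm1 k' = m.
  apply/eq_add_S; rewrite -mk; apply/esym/(norm1_update (j := j)).
    by move=> i ij; rewrite mxE Di// addr0.
  rewrite mxE Dj; move: kneg; case: (k 0 j) => [p|p]//= _.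
  have -> : Negz p + 1 = - (p%:Z) by rewrite NegzE -[in p.+1]addn1 PoszD opprD subrK.
  by rewrite abszN.
have k'N : (norm1 k' <= N)%N by rewrite mk' (leq_trans _ kN)// mk.
have h1 := HB j k kN.
have := IH k' k'N mk'; rewrite mk' => h2.
have -> : g k = g k' - (g k' - g k) by ring.
by rewrite (le_trans (cabsB _ _))// mk -natr1 mulrDl mul1r lerD.
Qed.

Definition falling (x : R[i]) (m : nat) : R[i] := \prod_(i < m) (x - i%:R).

Lemma fallingS (y : R[i]) m : falling y m.+1 = falling y m * (y - m%:R).
Proof. by rewrite /falling big_ord_recr. Qed.

Lemma falling_step (y : R[i]) m :
  falling (y + 1) m.+1 - falling y m.+1 = m.+1%:R * falling y m.
Proof.
have E : falling (y + 1) m.+1 = (y + 1) * falling y m.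
  rewrite /falling big_ord_recl /= subr0; congr (_ * _).
  by apply: eq_bigr => i _; rewrite /bump/= -natr1; ring.
by rewrite E fallingS -natr1; ring.
Qed.

Definition mi_falling k (alpha : 'I_n -> nat) : R[i] :=
  \prod_j falling (k 0 j)%:~R (alpha j).

Definition mi_sum (M : nat) (G : ('I_n -> nat) -> R[i]) : R[i] :=
  \sum_(alpha : {ffun 'I_n -> 'I_M} | (mi_size (fun j => alpha j) < M)%N)
    G (fun j => alpha j).

Lemma mi_size_ge (alpha : 'I_n -> nat) j : (alpha j <= mi_size alpha)%N.
Proof. by rewrite /mi_size (bigD1 j)//= leq_addr. Qed.

Lemma mi_sum_widen M N (G : ('I_n -> nat) -> R[i]) : (M <= N)%N ->
  mi_sum M G = \sum_(alpha : {ffun 'I_n -> 'I_N} |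
    (mi_size (fun j => alpha j) < M)%N) G (fun j => alpha j).
Proof.
case: M => [|M] MN; first by rewrite /mi_sum !big_pred0.
pose h (a : {ffun 'I_n -> 'I_M.+1}) : {ffun 'I_n -> 'I_N} :=
  [ffun j => widen_ord MN (a j)].
pose h' (b : {ffun 'I_n -> 'I_N}) : {ffun 'I_n -> 'I_M.+1} :=
  [ffun j => inord (b j)].
rewrite (reindex_onto h h'); last first.
  move=> b bM; apply/ffunP => j; apply/val_inj; rewrite !ffunE /= inordK//.
  exact: leq_ltn_trans (mi_size_ge (fun j => b j) j) bM.
have E (a : {ffun 'I_n -> 'I_M.+1}) : (fun j => h a j : nat) = (fun j => a j : nat).
  by apply/funext => j; rewrite ffunE.
rewrite /mi_sum; apply: eq_big => [a|a _]; last by rewrite E.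
rewrite E (_ : h' (h a) == a) ?andbT//.
by apply/eqP/ffunP => j; rewrite !ffunE /= inord_val.
Qed.

(** Adding e_j is a bijection from the multi-indices with |alpha| < M onto those with |alpha| < M +
    1 and alpha_j > 0; the others contribute 0 by assumption. *)
Lemma mi_sum_shift M j (G : ('I_n -> nat) -> R[i]) :
  (forall alpha, alpha j = 0%N -> G alpha = 0) ->
  mi_sum M.+1 G = mi_sum M (fun alpha => G (fun i => alpha i + (i == j))%N).
Proof.
move=> G0; rewrite (mi_sum_widen _ (leqnSn M)) /mi_sum.
rewrite (bigID (fun a : {ffun 'I_n -> 'I_M.+1} => (0 < a j)%N))/= [X in _ + X]big1.
  rewrite addr0.
  pose h (a : {ffun 'I_n -> 'I_M.+1}) : {ffun 'I_n -> 'I_M.+1} :=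
    [ffun i => inord (a i + (i == j))].
  pose h' (a : {ffun 'I_n -> 'I_M.+1}) : {ffun 'I_n -> 'I_M.+1} :=
    [ffun i => inord (a i - (i == j))].
  have hE (a : {ffun 'I_n -> 'I_M.+1}) : (mi_size (fun i => a i) < M)%N ->
      (fun i => h a i : nat) = (fun i => a i + (i == j))%N.
    move=> aM; apply/funext => i; rewrite ffunE inordK//.
    have := leq_ltn_trans (mi_size_ge (fun i => a i : nat) i) aM.
    by case: (i == j) => /= H; rewrite ?addn1 ?addn0 ltnS// ltnW.
  have sz (a : 'I_n -> nat) : mi_size (fun i => a i + (i == j))%N = (mi_size a).+1.
    rewrite /mi_size big_split/= -addn1; congr addn.
    by rewrite (bigD1 j)//= eqxx big1 ?addn0// => i /negbTE ->.
  rewrite (reindex_onto h h').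
    apply: eq_big => [a|a /andP[/andP[a1 a2] /eqP a3]].
      apply/idP/idP => [/andP[/andP[a1 a2] /eqP a3]|aM].
        (* If a_j were M, [inord] would send M + 1 to its default 0, against the positivity of the
           j-th entry of [h a]. *)
        have aj : (a j < M)%N.
          rewrite ltn_neqAle -ltnS ltn_ord andbT; apply/negP => /eqP aM.
          move: a2; rewrite ffunE eqxx addn1 aM /inord /insubd insubF ?ltnn//.
        have hE' : (fun i => h a i : nat) = (fun i => a i + (i == j))%N.
          apply/funext => i; rewrite ffunE inordK//.
          case: eqP => [->|_]; first by rewrite addn1 ltnS.
          by rewrite addn0 ltn_ord.
        by move: a1; rewrite hE' sz ltnS.
      have hE' := hE _ aM.
      have hj i : (h a i : nat) = (a i + (i == j))%N by rewrite -[LHS]/((fun i => h a i : nat) i) hE'.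
      rewrite hE' sz ltnS aM hj eqxx addn1 /=.
      apply/eqP/ffunP => i; rewrite ffunE hj addnK.
      by rewrite inord_val.
    rewrite hE//.
    have aM : (mi_size (fun i => a i) < M)%N.
      have aj : (a j < M)%N.
        rewrite ltn_neqAle -ltnS ltn_ord andbT; apply/negP => /eqP aM.
        move: a2; rewrite ffunE eqxx addn1 aM /inord /insubd insubF ?ltnn//.
      have hE' : (fun i => h a i : nat) = (fun i => a i + (i == j))%N.
        apply/funext => i; rewrite ffunE inordK//.
        case: eqP => [->|_]; first by rewrite addn1 ltnS.
        by rewrite addn0 ltn_ord.
      by move: a1; rewrite hE' sz ltnS.
    exact: aM.
  move=> a /andP[a1 a2]; apply/ffunP => i; apply/val_inj; rewrite !ffunE.
  have ai : (a i < M.+1)%N by exact: ltn_ord.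
  have ah : (inord (a i - (i == j)) : 'I_M.+1) = (a i - (i == j))%N :> nat.
    by rewrite inordK// (leq_ltn_trans (leq_subr _ _) ai).
  by rewrite ah subnK ?inord_val//; case: eqP => // ->.
by move=> a /andP[_]; rewrite -eqn0Ngt => /eqP aj; exact: G0.
Qed.

Lemma eq_mi_sum M (G G' : ('I_n -> nat) -> R[i]) :
  (forall alpha, (mi_size alpha < M)%N -> G alpha = G' alpha) ->
  mi_sum M G = mi_sum M G'.
Proof. by move=> E; apply: eq_bigr => a aM; exact: E. Qed.

Definition taylor_remainder (M : nat) s x k : R[i] :=
  s (x + k) - mi_sum M (fun alpha =>
    (mi_fact alpha)%:R^-1 * mi_falling k alpha * diff_mi alpha s x).

Lemma mi_falling_step k j alpha :
  mi_falling (k + delta_mx 0 j) (fun i => alpha i + (i == j))%N -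
  mi_falling k (fun i => alpha i + (i == j))%N =
  (alpha j).+1%:R * mi_falling k alpha.
Proof.
have E k' : mi_falling k' (fun i => alpha i + (i == j))%N =
    falling (k' 0 j)%:~R (alpha j).+1 *
    \prod_(i | i != j) falling (k' 0 i)%:~R (alpha i).
  rewrite /mi_falling (bigD1 j)//= eqxx addn1; congr (_ * _).
  by apply: eq_bigr => i /negbTE ->; rewrite addn0.
rewrite !E.
have -> : \prod_(i | i != j) falling ((k + delta_mx 0 j) 0 i)%:~R (alpha i) =
    \prod_(i | i != j) falling (k 0 i)%:~R (alpha i).
  by apply: eq_bigr => i ij; rewrite !mxE eqxx/= (negbTE ij) addr0.
rewrite -mulrBl !mxE !eqxx/= intrD falling_step.
by rewrite /mi_falling [in RHS](bigD1 j)//= mulrA.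
Qed.

Lemma mi_falling_eq k k' j alpha : alpha j = 0%N ->
  (forall i, i != j -> k 0 i = k' 0 i) -> mi_falling k alpha = mi_falling k' alpha.
Proof.
move=> aj H; rewrite /mi_falling; apply: eq_bigr => i _.
have [->|/H ->//] := eqVneq i j.
by rewrite aj /falling !big_ord0.
Qed.

Lemma mi_fact_incr alpha j :
  mi_fact (fun i => alpha i + (i == j))%N = ((alpha j).+1 * mi_fact alpha)%N.
Proof.
rewrite /mi_fact (bigD1 j)//= eqxx addn1 [in RHS](bigD1 j)//= factS mulnA.
by congr muln; apply: eq_bigr => i /negbTE ->; rewrite addn0.
Qed.

(** The difference of a falling power lowers its degree by one, as differentiation does for powers,
    so Delta_j acts on the Taylor polynomial as on s. This recursion takes the place of a closed
    formula for the remainder. *)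
Lemma taylor_remainder_step M s x k j :
  taylor_remainder M.+1 s x (k + delta_mx 0 j) - taylor_remainder M.+1 s x k =
  taylor_remainder M (diff_step j s) x k.
Proof.
rewrite /taylor_remainder.
set A := mi_sum _ _; set B := mi_sum _ _; set C := mi_sum _ _.
have -> : C = A - B.
  rewrite /A /B /mi_sum -sumrB.
  apply/esym; apply: etrans (@mi_sum_shift M j (fun alpha =>
    (mi_fact alpha)%:R^-1 * mi_falling (k + delta_mx 0 j) alpha * diff_mi alpha s x -
    (mi_fact alpha)%:R^-1 * mi_falling k alpha * diff_mi alpha s x) _) _ => [alpha aj|];
    last first.
    apply: eq_mi_sum => alpha _; apply/esym.
    rewrite -mulrBl -mulrBr mi_falling_step mi_fact_incr diff_mi_incr natrM.
    rewrite invfM; congr (_ * _); rewrite mulrA; congr (_ * _).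
    by rewrite mulrAC mulVf ?mul1r// pnatr_eq0.
  rewrite (mi_falling_eq (k' := k) aj) ?subrr// => i ij.
  by rewrite !mxE eqxx/= (negbTE ij) addr0.
by rewrite /diff_step addrA; ring.
Qed.

Lemma taylor_remainder0 M s x : taylor_remainder M.+1 s x 0 = 0.
Proof.
rewrite /taylor_remainder addr0 /mi_sum (bigD1 [ffun=> ord0])/=; last first.
  by rewrite /mi_size big1// => j _; rewrite ffunE.
rewrite big1 ?addr0; last first.
  move=> a /andP[_ a0].
  have [j aj] : exists j, (a j : nat) != 0%N.
    apply/existsP; apply: contraNT a0; rewrite negb_exists => /forallP H.
    apply/eqP/ffunP => j; rewrite ffunE; apply/val_inj/eqP; have := H j.
    by rewrite negbK.
  rewrite /mi_falling (bigD1 j)//= mxE; case: (nat_of_ord (a j)) aj => [//|m] _.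
  by rewrite /falling big_ord_recl/= subr0 !mul0r mulr0 mul0r.
have E0 : (fun j => [ffun=> ord0 : 'I_M.+1] j : nat) = (fun _ : 'I_n => 0%N).
  by apply/funext => j; rewrite ffunE.
rewrite E0.
have -> : mi_fact (fun _ : 'I_n => 0%N) = 1%N by rewrite /mi_fact big1.
have -> : mi_falling 0 (fun=> 0%N) = 1.
  by rewrite /mi_falling big1// => j _; rewrite /falling big_ord0.
have -> : diff_mi (fun _ : 'I_n => 0%N) s x = s x.
  rewrite diff_miE (_ : mi_word (fun _ : 'I_n => 0%N) = [::])//.
  by rewrite /mi_word; elim: (enum _).
by rewrite invr1 !mul1r subrr.
Qed.

(** Induction on M: the remainder vanishes at k = 0 and its unit steps are remainders of lower
    order, so each order costs one factor N along the path to k. Only differences of s at points x +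
    k' with |k'| <= N enter. *)
Lemma taylor_remainder_bound M s x (N : nat) (B : R) : 0 <= B ->
  (forall d k, size d = M -> (norm1 k <= N)%N ->
     cabs (foldr diff_step s d (x + k)) <= B) ->
  forall k, (norm1 k <= N)%N -> cabs (taylor_remainder M s x k) <= N%:R ^+ M * B.
Proof.
move=> B0; elim: M s => [|M IH] s HB k kN.
  rewrite /taylor_remainder /mi_sum big_pred0// subr0 mul1r.
  exact: (HB [::]).
have step j k' : (norm1 k' <= N)%N ->
    cabs (taylor_remainder M.+1 s x (k' + delta_mx 0 j) - taylor_remainder M.+1 s x k')
    <= N%:R ^+ M * B.
  move=> k'N; rewrite taylor_remainder_step; apply: IH => // d k2 dM k2N.
  by rewrite -diff_word_rcons; apply: HB => //; rewrite size_rcons dM.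
have := lattice_path_bound (taylor_remainder0 M s x) step kN.
move=> /le_trans; apply; rewrite exprS -mulrA ler_wpM2r ?ler_nat//.
by rewrite mulr_ge0 ?exprn_ge0.
Qed.

End DiscreteTaylor.

(** * Symbol estimates *)

Section JapaneseBracket.
Context {R : realType} {n : nat}.
Local Notation Z := 'rV[int]_n.
Implicit Types (x k : Z).
Local Notation J := (@japanese R n).

Lemma exists_nat_ge (y : R) : exists K : nat, y <= K%:R.
Proof. by exists (Num.truncn y).+1; apply: ltW; exact: truncnS_gt. Qed.

Lemma powRDp (y r t : R) : 0 < y -> y `^ (r + t) = y `^ r * y `^ t.
Proof. by move=> y0; rewrite powRD// (gt_eqF y0) implybT. Qed.

Lemma powR_expn (y r : R) (m : nat) : (y `^ r) ^+ m = y `^ (r * m%:R).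
Proof. by rewrite powRrM powR_mulrn// powR_ge0. Qed.

Lemma sqr_japanese x : J x ^+ 2 = 1 + \sum_j ((x 0 j)%:~R) ^+ 2.
Proof. by rewrite sqr_sqrtr// addr_ge0// sumr_ge0// => j _; rewrite sqr_ge0. Qed.

Lemma japanese_ge1 x : 1 <= J x.
Proof.
rewrite -[X in X <= _]sqrtr1 ler_sqrt ?lerDl ?addr_ge0// sumr_ge0// => j _;
by rewrite sqr_ge0.
Qed.

Lemma japanese_gt0 x : 0 < J x.
Proof. exact: lt_le_trans ltr01 (japanese_ge1 x). Qed.

Lemma norm_le_japanese x j : `|(x 0 j)%:~R| <= J x.
Proof.
rewrite -[X in X <= _]sqrtr_sqr ler_sqrt; last first.
  by rewrite addr_ge0// sumr_ge0// => i _; rewrite sqr_ge0.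
rewrite (bigD1 j)//= addrCA lerDl addr_ge0// sumr_ge0// => i _.
by rewrite sqr_ge0.
Qed.

Lemma norm1E k : (norm1 k)%:R = \sum_j `|(k 0 j)%:~R| :> R.
Proof. by apply: (@addrI _ 1); rewrite -size1E. Qed.

Lemma japaneseD_le x k : J (x + k) <= J x + (norm1 k)%:R.
Proof.
rewrite -(@ler_pXn2r _ 2)// ?nnegrE ?(ltW (japanese_gt0 _))//; last first.
  by rewrite addr_ge0// ltW// japanese_gt0.
rewrite sqr_japanese sqrrD sqr_japanese norm1E.
have h1 : \sum_j (x 0 j)%:~R * (k 0 j)%:~R <= J x * \sum_j `|(k 0 j)%:~R| :> R.
  rewrite mulr_sumr; apply: ler_sum => j _; apply: le_trans (ler_norm _) _.
  by rewrite normrM ler_wpM2r// norm_le_japanese.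
have h2 : \sum_j ((k 0 j)%:~R) ^+ 2 <= (\sum_j `|(k 0 j)%:~R|) ^+ 2 :> R.
  rewrite expr2 mulr_suml; apply: ler_sum => j _.
  rewrite -real_normK ?num_real// expr2 ler_wpM2l// (bigD1 j)//= lerDl.
  exact: sumr_ge0.
have -> : \sum_j (((x + k) 0 j)%:~R : R) ^+ 2 = \sum_j ((x 0 j)%:~R) ^+ 2
   + (\sum_j (x 0 j)%:~R * (k 0 j)%:~R) *+ 2 + \sum_j ((k 0 j)%:~R) ^+ 2.
  rewrite -sumrMnl -!big_split/=; apply: eq_bigr => j _.
  by rewrite mxE intrD sqrrD.
move: h1 h2; lra.
Qed.

Lemma norm1N k : norm1 (- k) = norm1 k.
Proof. by rewrite /norm1; apply: eq_bigr => j _; rewrite mxE abszN. Qed.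

Lemma japaneseD_ge x k : J x <= J (x + k) + (norm1 k)%:R.
Proof. by rewrite -[X in J X <= _](addrK k) -(norm1N k) japaneseD_le. Qed.

Lemma japanese_le_size1 x : J x <= size1 x.
Proof.
have := japaneseD_le 0 x; rewrite add0r size1E => /le_trans; apply.
rewrite lerD2r /japanese big1 ?addr0 ?sqrtr1// => j _.
by rewrite mxE expr0n.
Qed.

(** Orders of symbols have either sign: for e >= 0 the upper bound on Y is decisive, for e < 0 the
    lower one. *)
Lemma powR_comparable (Y y e : R) : 0 < y -> y / 2 <= Y -> Y <= 2 * y ->
  Y `^ e <= 2 `^ `|e| * y `^ e.
Proof.
move=> y0 h1 h2; have Y0 : 0 < Y by lra.
have [e0|e0] := lerP 0 e.
  rewrite ger0_norm// -powRM ?(ltW y0)//.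
  by rewrite ge0_ler_powR ?nnegrE ?(ltW Y0)// mulr_ge0// ltW.
rewrite ltr0_norm//.
have -> : 2 `^ (- e) * y `^ e = (y / 2) `^ e.
  by rewrite powRM ?(ltW y0)// mulrC -powR_inv1// -powRrM mulN1r.
rewrite -[e]opprK (powRN Y) (powRN (y / 2)) lef_pV2 ?posrE ?powR_gt0 ?divr_gt0//.
by rewrite ge0_ler_powR ?nnegrE ?oppr_ge0 ?(ltW e0) ?(ltW Y0)// ltW// divr_gt0.
Qed.

(** A crude bound with exponent |e|, for points where Y is controlled only from above. *)
Lemma powR_dominated (Y c y e : R) : 1 <= Y -> 1 <= c -> 1 <= y -> Y <= c * y ->
  Y `^ e <= c `^ `|e| * y `^ `|e|.
Proof.
move=> Y1 c1 y1 h; have := ler_powR Y1 (ler_norm e) => /le_trans; apply.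
by rewrite -powRM ?ge0_ler_powR ?nnegrE//; lra.
Qed.

End JapaneseBracket.

(** * Symbols as families *)

Section SymbolClasses.
Local Open Scope classical_set_scope.
Local Open Scope complex_scope.
Context {R : realType} {n : nat}.
Local Notation Z := 'rV[int]_n.
Local Notation J := (@japanese R n).

(** The class S^m with parameters rho, delta for functions of N variables, taken with N = n for p
    and N = n + n for a. Differences are words, like derivatives, and the lattice variable comes
    first so that F is a family indexed by it. *)
Definition symbol_order N (m rho delta : R) (F : Z -> 'rV[R]_N -> R[i]) : Prop :=
  (forall x, smooth_torus (F x)) /\
  forall d, family_order (fun _ => True) (fun x => J x `^ (m - rho * (size d)%:R))
    (fun x => J x `^ delta) (fun x w => foldr diff_step (F^~ w) d x).

Lemma smooth_torus_sum N (I : Type) (r : seq I) (P : pred I)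
    (F : I -> 'rV[R]_N -> R[i]) : (forall i, smooth_torus (F i)) ->
  smooth_torus (fun x => \sum_(i <- r | P i) F i x).
Proof.
move=> tF; split; first by apply: smooth_sum => i; case: (tF i).
by move=> j x; apply: eq_bigr => i _; case: (tF i) => _ ->.
Qed.

Lemma smooth_torusB N (f g : 'rV[R]_N -> R[i]) : smooth_torus f -> smooth_torus g ->
  smooth_torus (fun x => f x - g x).
Proof.
move=> [sf pf] [sg pg]; split; first exact: smoothB.
by move=> j x; rewrite pf pg.
Qed.

Lemma smooth_torus_diff N (F : Z -> 'rV[R]_N -> R[i]) d x :
  (forall x, smooth_torus (F x)) ->
  smooth_torus (fun w => foldr diff_step (F^~ w) d x).
Proof.
move=> tF; elim: d x => [|j d IH] x /=; first exact: tF.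
by rewrite /diff_step; exact: smooth_torusB (IH _) (IH _).
Qed.

Lemma word_diff N (F : Z -> 'rV[R]_N -> R[i]) d x s w :
  (forall x, smooth_torus (F x)) ->
  foldr partial (fun w => foldr diff_step (F^~ w) d x) s w =
  foldr diff_step (fun x => foldr partial (F x) s w) d x.
Proof.
move=> tF; elim: d x => [//|j d IH] x /=; rewrite {1}/diff_step.
have [s1 _] := smooth_torus_diff d (x + delta_mx 0 j) tF.
have [s2 _] := smooth_torus_diff d x tF.
rewrite [LHS](congr1 (fun f => f w) (wordD s s1 (smoothN s2))) IH.
rewrite [RHS]/(_ - _) -(IH x); congr (_ + _).
rewrite (_ : (fun y => - foldr diff_step (F^~ y) d x) =
    (fun y => -1 * foldr diff_step (F^~ y) d x)).
  by rewrite (wordZ _ _ s2) mulN1r.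
by apply/funext => y; rewrite mulN1r.
Qed.

Lemma symbol_order_family N m rho delta (F : Z -> 'rV[R]_N -> R[i]) :
  symbol_order m rho delta F ->
  family_order (fun _ => True) (fun x => J x `^ m) (fun x => J x `^ delta) F.
Proof.
by move=> [_ /(_ [::])]; rewrite mulr0 subr0.
Qed.

Lemma symbol_order_diff N m rho delta (F : Z -> 'rV[R]_N -> R[i]) j :
  symbol_order m rho delta F ->
  symbol_order (m - rho) rho delta (fun x w => diff_step j (F^~ w) x).
Proof.
move=> [tF oF]; split; first by move=> x; exact: (smooth_torus_diff [:: j] x tF).
move=> d; have := oF (rcons d j); rewrite size_rcons -natr1 mulrDr mulr1.
rewrite (_ : m - _ = m - rho - rho * (size d)%:R); last by ring.
congr family_order; apply/funext => x; apply/funext => w.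
by rewrite diff_word_rcons.
Qed.

Lemma symbol_order_le N m m' rho delta (F : Z -> 'rV[R]_N -> R[i]) : m <= m' ->
  symbol_order m rho delta F -> symbol_order m' rho delta F.
Proof.
move=> mm [tF oF]; split; first exact: tF.
move=> d; apply: order_le (oF d).
- exists 1 => // x _; rewrite mul1r ler_powR ?japanese_ge1// lerD2r//.
- by exists 1 => // x _; rewrite mul1r.
move=> x _; rewrite powR_ge0; split=> //.
by have [_] := order_pos (oF [::]) (q := x) I.
Qed.

Lemma symbol_orderD N m rho delta (F G : Z -> 'rV[R]_N -> R[i]) :
  symbol_order m rho delta F -> symbol_order m rho delta G ->
  symbol_order m rho delta (fun x w => F x w + G x w).
Proof.
move=> [tF oF] [tG oG]; split; first by move=> x; exact: smooth_torusD (tF x) (tG x).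
move=> d; have := orderD (oF d) (oG d); congr family_order.
by apply/funext => x; apply/funext => w; rewrite diff_wordD.
Qed.

(** The shift is F + Delta_j F, and Delta_j F has order m - rho <= m; this avoids comparing <xi +
    e_j> with <xi>. *)
Lemma symbol_order_shift N m rho delta (F : Z -> 'rV[R]_N -> R[i]) j : 0 <= rho ->
  symbol_order m rho delta F ->
  symbol_order m rho delta (fun x w => F (x + delta_mx 0 j) w).
Proof.
move=> rho0 oF.
have := symbol_orderD oF (symbol_order_le _ (symbol_order_diff j oF)).
have E : (fun x w => F x w + diff_step j (F^~ w) x) =
    (fun x w => F (x + delta_mx 0 j) w).
  by apply/funext => x; apply/funext => w; rewrite /diff_step addrC subrK.
by rewrite E; apply; lra.
Qed.

End SymbolClasses.

(** * The Taylor remainder of the symbol *)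

Section RemainderCoefficients.
Local Open Scope classical_set_scope.
Local Open Scope complex_scope.
Context {R : realType} {n : nat}.
Local Notation Z := 'rV[int]_n.
Local Notation J := (@japanese R n).
Context (m l rho delta : R).
Hypotheses (rho0 : 0 <= rho) (delta0 : 0 <= delta) (delta1 : delta < 1).
Context (A : Z -> 'rV[R]_(n + n) -> R[i]) (p : Z -> 'rV[R]_n -> R[i]).
Hypothesis tA : forall x, smooth_torus (A x).
Hypothesis oA : family_order (fun _ => True) (fun x => J x `^ m)
  (fun x => J x `^ delta) A.
Hypothesis op : symbol_order l rho delta p.
Variable M : nat.

Definition symbol_remainder (x k : Z) (y : 'rV[R]_n) : R[i] :=
  taylor_remainder M (p^~ y) x k.

Lemma symbol_remainder_smooth x k : smooth_torus (symbol_remainder x k).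
Proof.
have [tp _] := op; apply: smooth_torusB (tp _) _.
apply: smooth_torus_sum => a; apply: smooth_torusZ.
under eq_fun do rewrite diff_miE.
exact: smooth_torus_diff.
Qed.

Lemma symbol_remainder_word s x k y : foldr partial (symbol_remainder x k) s y =
  taylor_remainder M (fun x => foldr partial (p x) s y) x k.
Proof.
have [tp _] := op.
have tD alpha : smooth_torus (fun y => diff_mi alpha (p^~ y) x).
  by under eq_fun do rewrite diff_miE; exact: smooth_torus_diff.
rewrite /symbol_remainder /taylor_remainder /mi_sum.
pose S (y : 'rV[R]_n) := \sum_(a : {ffun 'I_n -> 'I_M} | (mi_size (fun j => a j) < M)%N)
  (mi_fact (fun j => a j))%:R^-1 * mi_falling k (fun j => a j) *
     diff_mi (fun j => a j) (p^~ y) x.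
have sS : smooth S.
  by apply: smooth_sum => a; apply: smoothZ; case: (tD (fun j => a j)).
have [sp _] := tp (x + k).
have -> : (fun y => p (x + k) y - S y) = (fun y => p (x + k) y + (-1) * S y).
  by apply/funext => z; rewrite mulN1r.
rewrite (wordD s sp (smoothZ (-1) sS)) (wordZ _ _ sS) mulN1r; congr (_ - _).
rewrite /S word_sum; last by move=> a; apply: smoothZ; case: (tD (fun j => a j)).
apply: eq_bigr => a _; rewrite wordZ; last by case: (tD (fun j => a j)).
congr (_ * _); rewrite !diff_miE.
have E : (fun y => diff_mi (fun j => a j : nat) (p^~ y) x) =
   (fun y => foldr diff_step (p^~ y) (mi_word (fun j => a j : nat)) x).
  by apply/funext => z; rewrite diff_miE.
by rewrite E word_diff.
Qed.

(** Stated for an arbitrary family of pairs (xi, k), so as to serve for small and for large k alike.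
    The two cases differ in how the powers of <xi + k'>, |k'| <= |k|, are bounded, which is isolated
    in the second hypothesis. *)
Lemma remainder_order (P : Type) (D : P -> Prop) (xi kap : P -> Z) (W lam : P -> R) :
  (forall q, D q -> 0 <= W q /\ 1 <= lam q) ->
  (forall t : nat, exists2 c, 0 <= c & forall q k, D q ->
     (norm1 k <= norm1 (kap q))%N ->
     J (xi q + k) `^ (l - rho * M%:R + delta * t%:R) <= c * W q * lam q ^+ t) ->
  family_order D (fun q => size1 (kap q) ^+ M * W q) lam
    (fun q => symbol_remainder (xi q) (kap q)).
Proof.
move=> pW H; split.
- by move=> q Dq; case: (symbol_remainder_smooth (xi q) (kap q)).
- move=> q Dq; have [W0 l1] := pW q Dq; split=> //.
  by rewrite mulr_ge0// exprn_ge0// size1_ge0.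
move=> s; have [tp o] := op; have [c c0 Hc] := H (size s).
have /choice[C HC] : forall d : M.-tuple 'I_n, exists C, 0 <= C /\ forall x y,
    cabs (foldr diff_step (fun x => foldr partial (p x) s y) d x) <=
    C * J x `^ (l - rho * M%:R + delta * (size s)%:R).
  move=> d; have [C C0 HC] := order_bound (o d) s; exists C; split=> // x y.
  rewrite -word_diff//; apply: le_trans (HC x y I) _.
  by rewrite powR_expn -mulrA -powRDp ?japanese_gt0// size_tuple.
(* One constant for all words of M differences, of which there are finitely many. *)
pose C' := \sum_d C d.
have C'0 : 0 <= C' by apply: sumr_ge0 => d _; case: (HC d).
exists (C' * c); first exact: mulr_ge0.
move=> q y Dq; rewrite symbol_remainder_word.
have [W0 l1] := pW q Dq; have l0 := le_trans ler01 l1.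
have := @taylor_remainder_bound R n M (fun x => foldr partial (p x) s y) (xi q)
  (norm1 (kap q)) (C' * (c * W q * lam q ^+ size s)).
move=> /(_ _ _ (kap q) (leqnn _)).
have B0 : 0 <= C' * (c * W q * lam q ^+ size s).
  by rewrite !mulr_ge0// exprn_ge0.
move=> /(_ B0) HT; apply: le_trans (HT _) _.
  move=> d k dM kN; have dM' : size d == M by rewrite dM.
  have [Cd0 Hd] := HC (Tuple dM').
  apply: le_trans (Hd _ _) _; apply: le_trans (_ : C (Tuple dM') *
    (c * W q * lam q ^+ size s) <= _).
    by rewrite ler_wpM2l// Hc.
  rewrite ler_wpM2r//; first by rewrite !mulr_ge0// exprn_ge0.
  by rewrite /C' (bigD1 (Tuple dM'))//= lerDl sumr_ge0// => d' _; case: (HC d').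
have nk : (norm1 (kap q))%:R ^+ M <= size1 (kap q) ^+ M :> R.
  by rewrite lerXn2r ?nnegrE ?size1_ge0// size1E lerDr.
apply: le_trans (_ : size1 (kap q) ^+ M * (C' * (c * W q * lam q ^+ size s)) <= _).
  by rewrite ler_wpM2r.
by rewrite le_eqVlt; apply/orP; left; apply/eqP; ring.
Qed.

End RemainderCoefficients.

(** * Functions of two groups of variables *)

Section Blocks.
Local Open Scope classical_set_scope.
Local Open Scope complex_scope.
Context {R : realType}.

Lemma periodic_pullback N m (L : 'rV[R]_N -> 'rV[R]_m) (sigma : 'I_N -> option 'I_m) f :
  (forall j h x, L (h *: basis_vec j + x) = h *: oapp basis_vec 0 (sigma j) + L x) ->
  torus_periodic f -> torus_periodic (fun w => f (L w)).
Proof.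
move=> LE pf j x; rewrite addrC LE addrC.
by case: (sigma j) => [i|] /=; [exact: pf|rewrite scaler0 addr0].
Qed.

Lemma smooth_torus_pullback N m (L : 'rV[R]_N -> 'rV[R]_m)
    (sigma : 'I_N -> option 'I_m) f : continuous L ->
  (forall j h x, L (h *: basis_vec j + x) = h *: oapp basis_vec 0 (sigma j) + L x) ->
  smooth_torus f -> smooth_torus (fun w => f (L w)).
Proof.
move=> cL LE [sf pf]; split; first exact: smooth_pullback cL LE _ sf.
exact: periodic_pullback LE pf.
Qed.

Definition lblock N n (j : 'I_(N + n)) : option 'I_N :=
  if fintype.split j is inl i then Some i else None.

Definition rblock N n (j : 'I_(N + n)) : option 'I_n :=
  if fintype.split j is inr i then Some i else None.

Lemma lblock_lshift N n (i : 'I_N) : lblock (lshift n i) = Some i.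
Proof. by rewrite /lblock (unsplitK (inl i)). Qed.

Lemma lblock_rshift N n (i : 'I_n) : lblock (rshift N i) = None.
Proof. by rewrite /lblock (unsplitK (inr i)). Qed.

Lemma rblock_lshift N n (i : 'I_N) : rblock (lshift n i) = None.
Proof. by rewrite /rblock (unsplitK (inl i)). Qed.

Lemma rblock_rshift N n (i : 'I_n) : rblock (rshift N i) = Some i.
Proof. by rewrite /rblock (unsplitK (inr i)). Qed.

Lemma lsubmx_shift N n (j : 'I_(N + n)) h (x : 'rV[R]_(N + n)) :
  lsubmx (h *: basis_vec j + x) = h *: oapp basis_vec 0 (lblock j) + lsubmx x.
Proof.
rewrite -(splitK j); case: (fintype.split j) => i /=;
  rewrite ?lblock_lshift ?lblock_rshift -{1}(hsubmxK x) /=.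
  by rewrite -row_mx_shiftl row_mxKl.
by rewrite -row_mx_shiftr row_mxKl scaler0 add0r.
Qed.

Lemma rsubmx_shift N n (j : 'I_(N + n)) h (x : 'rV[R]_(N + n)) :
  rsubmx (h *: basis_vec j + x) = h *: oapp basis_vec 0 (rblock j) + rsubmx x.
Proof.
rewrite -(splitK j); case: (fintype.split j) => i /=;
  rewrite ?rblock_lshift ?rblock_rshift -{1}(hsubmxK x) /=.
  by rewrite -row_mx_shiftl row_mxKr scaler0 add0r.
by rewrite -row_mx_shiftr row_mxKr.
Qed.

Lemma row_mxl_shift N n (y : 'rV[R]_n) (j : 'I_N) h x :
  row_mx (h *: basis_vec j + x) y =
  h *: oapp basis_vec 0 (Some (lshift n j)) + row_mx x y.
Proof. exact: row_mx_shiftl. Qed.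

Lemma row_mxr_shift N n (x : 'rV[R]_N) (j : 'I_n) h y :
  row_mx x (h *: basis_vec j + y) =
  h *: oapp basis_vec 0 (Some (rshift N j)) + row_mx x y.
Proof. exact: row_mx_shiftr. Qed.

Lemma continuous_row_mxl N n (y : 'rV[R]_n) : continuous (fun x : 'rV[R]_N => row_mx x y).
Proof. by apply: continuous_row_mx; [exact: continuous_id|exact: continuous_cst]. Qed.

Lemma continuous_row_mxr N n (x : 'rV[R]_N) : continuous (fun y : 'rV[R]_n => row_mx x y).
Proof. by apply: continuous_row_mx; [exact: continuous_cst|exact: continuous_id]. Qed.

Context {N n : nat}.
Implicit Types (f B : 'rV[R]_(N + n) -> R[i]) (g : 'rV[R]_n -> R[i])
  (h : 'rV[R]_N -> R[i]).

Lemma smooth_torus_sectionl f y : smooth_torus f -> smooth_torus (fun x => f (row_mx x y)).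
Proof.
exact: smooth_torus_pullback (@continuous_row_mxl N n y) (@row_mxl_shift N n y).
Qed.

Lemma smooth_torus_sectionr f x : smooth_torus f -> smooth_torus (fun y => f (row_mx x y)).
Proof.
exact: smooth_torus_pullback (@continuous_row_mxr N n x) (@row_mxr_shift N n x).
Qed.

Lemma smooth_torus_lsubmx h : smooth_torus h ->
  smooth_torus (fun w : 'rV[R]_(N + n) => h (lsubmx w)).
Proof. exact: smooth_torus_pullback (@continuous_lsubmx R 1 N n) (@lsubmx_shift N n). Qed.

Lemma smooth_torus_rsubmx g : smooth_torus g ->
  smooth_torus (fun w : 'rV[R]_(N + n) => g (rsubmx w)).
Proof. exact: smooth_torus_pullback (@continuous_rsubmx R 1 N n) (@rsubmx_shift N n). Qed.

Lemma word_sectionl f y s : smooth f -> foldr partial (fun x => f (row_mx x y)) s =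
  (fun x => foldr partial f (map (@lshift N n) s) (row_mx x y)).
Proof.
move=> sf; rewrite (word_pullbackE (@row_mxl_shift N n y) s sf).
by rewrite word_pullback_map.
Qed.

Lemma word_sectionr f x s : smooth f -> foldr partial (fun y => f (row_mx x y)) s =
  (fun y => foldr partial f (map (@rshift N n) s) (row_mx x y)).
Proof.
move=> sf; rewrite (word_pullbackE (@row_mxr_shift N n x) s sf).
by rewrite word_pullback_map.
Qed.

Lemma word_lshift_mul g B s : smooth g -> smooth B ->
  foldr partial (fun w => g (rsubmx w) * B w) (map (@lshift N n) s) =
  (fun w => g (rsubmx w) * foldr partial B (map (@lshift N n) s) w).
Proof.
move=> sg sB.
have sgr := smooth_pullback (@continuous_rsubmx R 1 N n) (@rsubmx_shift N n) sg.
elim: s => [//|j s /= ->].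
rewrite (partialM _ sgr (smooth_word (map (@lshift N n) s) sB)).
apply/funext => w.
rewrite (is_partialE (is_partial_pullback (@rsubmx_shift N n) (lshift n j) w sg)).
by rewrite rblock_lshift mul0r add0r.
Qed.

Lemma word_rshift_mul g h s : smooth g -> smooth h ->
  foldr partial (fun w => g (rsubmx w) * h (lsubmx w)) (map (@rshift N n) s) =
  (fun w => foldr partial g s (rsubmx w) * h (lsubmx w)).
Proof.
move=> sg sh.
have shl := smooth_pullback (@continuous_lsubmx R 1 N n) (@lsubmx_shift N n) sh.
elim: s => [//|j s /= ->].
have sgs := smooth_word s sg.
have sgr := smooth_pullback (@continuous_rsubmx R 1 N n) (@rsubmx_shift N n) sgs.
rewrite (partialM _ sgr shl).
apply/funext => w.
rewrite (is_partialE (is_partial_pullback (@rsubmx_shift N n) (rshift N j) w sgs)).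
rewrite (is_partialE (is_partial_pullback (@lsubmx_shift N n) (rshift N j) w sh)).
by rewrite rblock_rshift lblock_rshift mulr0 addr0.
Qed.

Lemma word_lshift_lsubmx h s : smooth h ->
  foldr partial (fun w : 'rV[R]_(N + n) => h (lsubmx w)) (map (@lshift N n) s) =
  (fun w => foldr partial h s (lsubmx w)).
Proof.
move=> sh; rewrite (word_pullbackE (@lsubmx_shift N n) _ sh).
suff -> : word_pullback (@lblock N n) (map (@lshift N n) s) = Some s by [].
by elim: s => [//|j s /= ->]; rewrite lblock_lshift.
Qed.

(** The letters of the second group stand last, hence are applied first, as in [deriv2_mi]. *)
Definition split_word (s : seq 'I_N) (t : seq 'I_n) : seq 'I_(N + n) :=
  map (@lshift N n) s ++ map (@rshift N n) t.

Lemma word_split_mul g h s t : smooth g -> smooth h ->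
  foldr partial (fun w => g (rsubmx w) * h (lsubmx w)) (split_word s t) =
  (fun w => foldr partial g t (rsubmx w) * foldr partial h s (lsubmx w)).
Proof.
move=> sg sh; rewrite /split_word foldr_cat (word_rshift_mul t sg sh).
have shl := smooth_pullback (@continuous_lsubmx R 1 N n) (@lsubmx_shift N n) sh.
by rewrite (word_lshift_mul s (smooth_word t sg) shl) (word_lshift_lsubmx s sh).
Qed.

Lemma size_split_word s t : size (split_word s t) = (size s + size t)%N.
Proof. by rewrite size_cat !size_map. Qed.

End Blocks.

(** * Estimate of the kernel *)

Section RemainderSum.
Local Open Scope classical_set_scope.
Local Open Scope complex_scope.
Context {R : realType} {n : nat}.
Local Notation Z := 'rV[int]_n.
Local Notation J := (@japanese R n).
Context (m l rho delta : R).
Hypotheses (rho0 : 0 <= rho) (delta0 : 0 <= delta) (delta1 : delta < 1).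
Context (A : Z -> 'rV[R]_(n + n) -> R[i]) (p : Z -> 'rV[R]_n -> R[i]).
Hypothesis tA : forall x, smooth_torus (A x).
Hypothesis oA : family_order (fun _ => True) (fun x => J x `^ m)
  (fun x => J x `^ delta) A.
Hypothesis op : symbol_order l rho delta p.
Variable M : nat.
Local Notation rem := (symbol_remainder p M).

(** The word s records derivatives in x. They fall on A alone, because the Taylor remainder of p
    depends on y, xi and k only. *)
Definition remainder_density (s : seq 'I_n) (x : 'rV[R]_n) (xi k : Z) (y : 'rV[R]_n) : R[i] :=
  foldr partial (A xi) (map (@lshift n n) s) (row_mx x y) * rem xi k y.

Lemma remainder_density_torus s x xi k : smooth_torus (remainder_density s x xi k).
Proof.
apply: smooth_torusM (symbol_remainder_smooth op _ _ _).
exact: smooth_torus_sectionr x (smooth_torus_word _ (tA xi)).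
Qed.

Let P := ('rV[R]_n * Z * Z)%type.

Lemma amplitude_word_order (D : P -> Prop) s :
  family_order D (fun q => J q.1.2 `^ m * (J q.1.2 `^ delta) ^+ size s)
    (fun q => J q.1.2 `^ delta)
    (fun q y => foldr partial (A q.1.2) (map (@lshift n n) s) (row_mx q.1.1 y)).
Proof.
have := order_word (map (@lshift n n) s) oA; rewrite size_map.
move=> /(order_reparam (D' := D) (h := fun q => q.1.2) (fun _ _ => I)).
move=> /(order_pullback (L := fun q y => row_mx q.1.1 y) (sigma := fun j => Some (rshift n j))).
apply; first by move=> q; exact: continuous_row_mxr.
by move=> q j h y; exact: row_mxr_shift.
Qed.

(** The term in M combines the gain rho of each difference with the loss delta of each of the M
    integrations by parts that compensate |k|^M. N counts the remaining derivatives, in x or from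
    integrations by parts. *)
Definition remainder_exponent (N : nat) : R :=
  m + l - (rho - delta) * M%:R + delta * N%:R.

(* Here xi + k' has the size of xi whenever |k'| <= |k|, so the discrete Taylor
   remainder is O(|k|^M <xi>^(l - rho M)), with scale <xi>^delta for derivatives. *)
Lemma remainder_near s N : exists2 C : R, 0 <= C & forall x xi k,
  2 * (norm1 k)%:R <= J xi ->
  size1 k ^+ (2 * n + N) * cabs (fcoef k (remainder_density s x xi k)) <=
  C * J xi `^ (remainder_exponent (2 * n + N + size s)).
Proof.
pose D (q : P) := 2 * (norm1 q.2)%:R <= J q.1.2.
have oR := @remainder_order R n l rho delta p op M P D (fun q => q.1.2) (fun q => q.2)
  (fun q => J q.1.2 `^ (l - rho * M%:R)) (fun q => J q.1.2 `^ delta).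
have {}oR := oR _ _.
(* M of these integrations by parts are cancelled below against the factor |k|^M of the Taylor
   remainder. *)
have [|||C C0 HC] := fcoef_decay (M + (2 * n + N)) (orderM (amplitude_word_order D s) (oR _ _)).
- move=> q _; rewrite powR_ge0; split=> //.
  by rewrite -[X in X <= _](powRr0 (J q.1.2)) ler_powR ?japanese_ge1.
- move=> t; exists (2 `^ `|l - rho * M%:R + delta * t%:R|); first exact: powR_ge0.
  move=> q k Dq kn; rewrite -mulrA powR_expn -powRDp ?japanese_gt0//.
  have kn' : (norm1 k)%:R <= (norm1 q.2)%:R :> R by rewrite ler_nat.
  have J0 := japanese_gt0 (R := R) q.1.2.
  have h1 := japaneseD_ge (R := R) q.1.2 k; have h2 := japaneseD_le (R := R) q.1.2 k.
  rewrite /D in Dq.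
  by apply: powR_comparable => //; lra.
- by move=> q Dq; case: (remainder_density_torus s q.1.1 q.1.2 q.2).
exists C => // x xi k Dk.
have := HC (x, xi, k) k Dk; rewrite /= exprD.
have k0 : 0 < size1 k ^+ M :> R by rewrite exprn_gt0// size1_gt0.
rewrite -mulrA.
have -> : C * (J xi `^ m * (J xi `^ delta) ^+ size s *
   (size1 k ^+ M * J xi `^ (l - rho * M%:R))) * (J xi `^ delta) ^+ (M + (2 * n + N)) =
   size1 k ^+ M * (C * (J xi `^ m * (J xi `^ delta) ^+ size s *
    J xi `^ (l - rho * M%:R) * (J xi `^ delta) ^+ (M + (2 * n + N)))) by ring.
rewrite ler_pM2l// => /le_trans; apply; rewrite le_eqVlt; apply/orP; left; apply/eqP.
congr (_ * _); rewrite !powR_expn -!powRDp ?japanese_gt0//; congr powR.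
by rewrite /remainder_exponent !natrD; ring.
Qed.

(* Here <xi> = O(size1 k), and each integration by parts gains size1 k^(delta - 1):
   sufficiently many of them absorb any power of <xi>. *)
Lemma remainder_far s N : exists2 C : R, 0 <= C & forall x xi k,
  J xi < 2 * (norm1 k)%:R ->
  size1 k ^+ (2 * n + N) * cabs (fcoef k (remainder_density s x xi k)) <=
  C * J xi `^ (remainder_exponent (2 * n + N + size s)).
Proof.
pose D (q : P) := J q.1.2 < 2 * (norm1 q.2)%:R.
have kge (q : P) : 1 <= size1 q.2 :> R by exact: size1_ge1.
have Dk q : D q -> J q.1.2 <= 2 * size1 q.2.
  by move=> Dq; rewrite /D in Dq; rewrite size1E; lra.
have lam1 (q : P) : 1 <= size1 q.2 `^ delta.
  by rewrite -[X in X <= _](powRr0 (size1 q.2)) ler_powR.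
pose e := m + delta * (size s)%:R.
have oA' : family_order D (fun q => size1 q.2 `^ `|e|) (fun q => size1 q.2 `^ delta)
    (fun q y => foldr partial (A q.1.2) (map (@lshift n n) s) (row_mx q.1.1 y)).
  apply: order_le (amplitude_word_order D s).
  - exists (2 `^ `|e|); first exact: powR_ge0.
    move=> q Dq; rewrite powR_expn -powRDp ?japanese_gt0//.
    by apply: powR_dominated; rewrite ?japanese_ge1 ?Dk ?ler1n.
  - exists (2 `^ `|delta|); first exact: powR_ge0.
    move=> q Dq; rewrite -[X in _ <= _ * _ `^ X](ger0_norm delta0).
    by apply: powR_dominated; rewrite ?japanese_ge1 ?Dk ?ler1n.
  - by move=> q _; rewrite powR_ge0.
have oR := @remainder_order R n l rho delta p op M P D (fun q => q.1.2) (fun q => q.2)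
  (fun q => size1 q.2 `^ (`|l| + rho * M%:R)) (fun q => size1 q.2 `^ delta).
pose T := remainder_exponent (2 * n + N + size s).
(* The total power of [size1 k] in the crude bounds for the density, before any integration by
   parts. *)
pose E := `|e| + (M%:R + (`|l| + rho * M%:R)).
have d1 : 0 < 1 - delta by rewrite subr_gt0.
(* K integrations by parts gain K (1 - delta) powers of [size1 k]. They have to cover E, the 2n + N
   powers in the claim, and |T| further ones that are traded for powers of <xi>. *)
have [K] := exists_nat_ge ((E + (2 * n + N)%:R + `|T|) / (1 - delta)).
rewrite ler_pdivrMr// mulrC => HK.
have [|||C C0 HC] := fcoef_decay K (orderM oA' (oR _ _)).
- by move=> q _; rewrite powR_ge0.
(* The constant 3 is that of <xi + k'> <= <xi> + |k'| < 3 |k|, valid for |k'| <= |k| in this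
   region. *)
- move=> t; exists (3%:R `^ `|l - rho * M%:R + delta * t%:R|); first exact: powR_ge0.
  move=> q k Dq kn; rewrite -mulrA powR_expn -powRDp ?size1_gt0//.
  have kn' : (norm1 k)%:R <= (norm1 q.2)%:R :> R by rewrite ler_nat.
  have h2 := japaneseD_le (R := R) q.1.2 k.
  apply: le_trans (powR_dominated (c := 3%:R) (y := size1 q.2) _ _ _ (kge q) _) _.
  - exact: japanese_ge1.
  - by rewrite ler1n.
  - by rewrite /D in Dq; rewrite size1E; lra.
  rewrite ler_wpM2l ?powR_ge0// ler_powR//.
  apply: le_trans (ler_normD _ _) _.
  have t0 : 0 <= delta * t%:R by rewrite mulr_ge0.
  have r0 : 0 <= rho * M%:R by rewrite mulr_ge0.
  rewrite (ger0_norm t0) lerD2r (le_trans (ler_normB _ _))//.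
  by rewrite (ger0_norm r0).
- by move=> q Dq; case: (remainder_density_torus s q.1.1 q.1.2 q.2).
exists (C * 2 `^ `|T|); first by rewrite mulr_ge0// powR_ge0.
move=> x xi k Dq.
have k1 := size1_ge1 (R := R) k; have k0 := size1_gt0 (R := R) k.
pose F := cabs (fcoef k (remainder_density s x xi k)).
have : size1 k ^+ K * F <= C * (size1 k `^ `|e| *
    (size1 k ^+ M * size1 k `^ (`|l| + rho * M%:R))) * (size1 k `^ delta) ^+ K.
  exact: (HC (x, xi, k) k Dq).
rewrite -/F.
have -> : C * (size1 k `^ `|e| * (size1 k ^+ M * size1 k `^ (`|l| + rho * M%:R))) *
    (size1 k `^ delta) ^+ K = C * size1 k `^ (E + delta * K%:R).
  rewrite powR_expn -(powR_mulrn M (ltW k0)) -!powRDp// -mulrA -powRDp//.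
rewrite -(powR_mulrn K (ltW k0)) -(powR_mulrn (2 * n + N) (ltW k0)) => H.
have F0 : 0 <= F by exact: cabs_ge0.
have H2 : size1 k `^ (2 * n + N)%:R * F <= C * size1 k `^ (- `|T|).
  have -> : (2 * n + N)%:R = (2 * n + N)%:R - K%:R + K%:R :> R by ring.
  rewrite powRDp// -mulrA.
  apply: le_trans (ler_wpM2l (powR_ge0 _ _) H) _.
  rewrite mulrCA ler_wpM2l// -powRDp// ler_powR//; move: HK; lra.
apply: le_trans H2 _; rewrite -mulrA ler_wpM2l//.
have J1 := japanese_ge1 (R := R) xi; have J0 := japanese_gt0 (R := R) xi.
have h : J xi `^ `|T| <= 2 `^ `|T| * size1 k `^ `|T|.
  have := @powR_dominated R (J xi) 2 (size1 k) `|T| J1 _ k1 (Dk (x, xi, k) Dq).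
  by rewrite ler1n normr_id; apply.
apply: le_trans (_ : 2 `^ `|T| * J xi `^ (- `|T|) <= _); last first.
  rewrite ler_wpM2l ?powR_ge0// ler_powR//.
  by rewrite lerNl -normrN ler_norm.
rewrite !powRN ler_pdivlMr ?powR_gt0// mulrC ler_pdivrMr ?powR_gt0//.
Qed.

End RemainderSum.

(** * Summation over k *)

Section RemainderKernel.
Local Open Scope classical_set_scope.
Local Open Scope complex_scope.
Context {R : realType} {n : nat}.
Local Notation Z := 'rV[int]_n.
Local Notation J := (@japanese R n).

Lemma perm_split_word N (s : seq 'I_(N + n)) :
  perm_eq s (split_word (pmap (@lblock N n) s) (pmap (@rblock N n) s)).
Proof.
elim: s => [//|j s IH]; rewrite -(splitK j); case: (fintype.split j) => i /=.
  by rewrite lblock_lshift rblock_lshift /= perm_cons.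
rewrite lblock_rshift rblock_rshift /split_word /=.
by rewrite perm_sym (perm_catCA _ [:: _]) perm_cons perm_sym.
Qed.

Context (m l rho delta : R).
Hypotheses (rho0 : 0 <= rho) (delta0 : 0 <= delta) (delta1 : delta < 1).
Context (A : Z -> 'rV[R]_(n + n) -> R[i]) (p : Z -> 'rV[R]_n -> R[i]).
Hypothesis tA : forall x, smooth_torus (A x).
Hypothesis oA : family_order (fun _ => True) (fun x => J x `^ m)
  (fun x => J x `^ delta) A.
Hypothesis op : symbol_order l rho delta p.
Variable M : nat.
Local Notation rem := (symbol_remainder p M).
Local Notation dens := (remainder_density A p M).
Local Notation rexp := (remainder_exponent m l rho delta M).

Lemma coef_estimate s N : exists2 C : R, 0 <= C & forall x xi k,
  size1 k ^+ (2 * n + N) * cabs (fcoef k (dens s x xi k)) <=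
  C * J xi `^ rexp (2 * n + N + size s).
Proof.
have [C C0 HC] := remainder_near delta0 tA oA op M s N.
have [C' C0' HC'] := remainder_far rho0 delta0 delta1 tA oA op M s N.
exists (C + C'); first exact: addr_ge0.
move=> x xi k; rewrite mulrDl.
have [h|h] := lerP (2 * (norm1 k)%:R) (J xi).
  by rewrite (le_trans (HC x xi k h))// lerDl mulr_ge0// powR_ge0.
by rewrite (le_trans (HC' x xi k h))// lerDr mulr_ge0// powR_ge0.
Qed.

Definition remainder_coef (xi k : Z) (x : 'rV[R]_n) : R[i] :=
  two_pi_mn (n := n) * fcoef k (dens [::] x xi k).

Let g xi k (y : 'rV[R]_n) := mode k y * rem xi k y.

Let tg xi k : smooth_torus (g xi k).
Proof. exact: smooth_torusM (smooth_torus_mode k) (symbol_remainder_smooth op M xi k). Qed.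

Let G xi k (w : 'rV[R]_(n + n)) := g xi k (rsubmx w) * A xi w.

Let tG xi k : smooth_torus (G xi k).
Proof. exact: smooth_torusM (smooth_torus_rsubmx (tg xi k)) (tA xi). Qed.

Let coefE xi k : remainder_coef xi k =
  (fun x => two_pi_mn (n := n) * torus_integral (fun y => G xi k (row_mx x y))).
Proof.
apply/funext => x; congr (_ * torus_integral _); apply/funext => y.
by rewrite /remainder_density /G /g row_mxKr /=; ring.
Qed.

Lemma remainder_coef_smooth xi k : smooth_torus (remainder_coef xi k).
Proof.
rewrite coefE; apply: smooth_torusZ; have [sG pG] := tG xi k.
split; first exact: torus_integral_smooth.
move=> j x; congr torus_integral; apply/funext => y.
by rewrite addrC row_mx_shiftl addrC pG.
Qed.

Lemma remainder_coef_word xi k s : foldr partial (remainder_coef xi k) s =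
  (fun x => two_pi_mn (n := n) * fcoef k (dens s x xi k)).
Proof.
have [sG _] := tG xi k.
rewrite coefE (wordZ _ s (torus_integral_smooth sG)) (torus_integral_word _ sG).
apply/funext => x; congr (_ * torus_integral _); apply/funext => y.
have [sg _] := tg xi k; have [sA _] := tA xi.
rewrite (word_lshift_mul s sg sA) row_mxKr /remainder_density /g.
by rewrite -mulrA [rem _ _ _ * _]mulrC.
Qed.

Definition kernel_term (xi k : Z) (w : 'rV[R]_(n + n)) : R[i] :=
  mode (- k) (rsubmx w) * remainder_coef xi k (lsubmx w).

Lemma kernel_term_smooth xi k : smooth_torus (kernel_term xi k).
Proof.
exact: smooth_torusM (smooth_torus_rsubmx (smooth_torus_mode _))
  (smooth_torus_lsubmx (remainder_coef_smooth xi k)).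
Qed.

(** Each z-derivative brings down a factor |k_j| from the mode, compensated by one more integration
    by parts in y. The 2n that are left over give the summable factor. *)
Lemma kernel_term_estimate s t : exists2 C : R, 0 <= C & forall xi k w,
  cabs (foldr partial (kernel_term xi k) (split_word s t) w) <=
  C * J xi `^ rexp (2 * n + (size s + size t)) * size1 k ^- (2 * n).
Proof.
have [C C0 HC] := coef_estimate s (size t).
pose c : R := cabs (two_pi_mn (n := n) : R[i]).
have c0 : 0 <= c by exact: cabs_ge0.
exists (c * C); first exact: mulr_ge0.
move=> xi k w; have [sc _] := remainder_coef_smooth xi k.
rewrite (word_split_mul s t (mode_smooth _) sc) mode_word remainder_coef_word.
rewrite !cabsM cabs_mode mulr1 -/c.
rewrite ler_pdivlMr ?exprn_gt0 ?size1_gt0//.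
have h1 := @cabs_prod_freq_le R n (- k) t; rewrite size1N in h1.
have h2 := HC (lsubmx w) xi k.
set F := cabs (fcoef _ _) in h2 *; set f := cabs _ in h1 *.
have F0 : 0 <= F by exact: cabs_ge0.
have -> : c * C * J xi `^ rexp (2 * n + (size s + size t)) =
   c * (C * J xi `^ rexp (2 * n + size t + size s)).
  by rewrite mulrA -addnA (addnC (size t)).
have -> : f * (c * F) * size1 k ^+ (2 * n) = c * (f * (size1 k ^+ (2 * n) * F)) by ring.
rewrite ler_wpM2l//; apply: le_trans h2.
rewrite exprD (mulrC (_ ^+ _) (_ ^+ size t)) -mulrA ler_wpM2r//.
by rewrite mulr_ge0// exprn_ge0// size1_ge0.
Qed.

Lemma kernel_term_word xi s : exists2 b, sumbdd b &
  forall k w, cabs (foldr partial (kernel_term xi k) s w) <= b k.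
Proof.
have [C C0 HC] := kernel_term_estimate (pmap (@lblock n n) s) (pmap (@rblock n n) s).
eexists; last first.
  move=> k w; rewrite (word_perm (kernel_term_smooth xi k) (perm_split_word s)).
  exact: HC.
by apply: sumbdd_rapid; rewrite mulr_ge0// powR_ge0.
Qed.

Definition remainder_kernel (xi : Z) (w : 'rV[R]_(n + n)) : R[i] :=
  lattice_sum (fun k => kernel_term xi k w).

Lemma remainder_kernel_smooth xi : smooth_torus (remainder_kernel xi).
Proof.
split.
  apply: (csum_smooth (f := kernel_term xi)) (kernel_term_word xi).
  by move=> k; case: (kernel_term_smooth xi k).
move=> j w; congr lattice_sum; apply/funext => k.
by have [_] := kernel_term_smooth xi k; apply.
Qed.

Lemma remainder_kernel_bound s t : exists2 C : R, 0 <= C & forall xi w,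
  cabs (foldr partial (remainder_kernel xi) (split_word s t) w) <=
  C * J xi `^ rexp (2 * n + (size s + size t)).
Proof.
have [C C0 HC] := kernel_term_estimate s t.
have [_ [B HB]] := sumbdd_size1 (R := R) (n := n).
have B0 : 0 <= B by have := HB [::] isT; rewrite big_nil.
exists (C * B); first exact: mulr_ge0.
move=> xi w.
have sk k : smooth (kernel_term xi k) by case: (kernel_term_smooth xi k).
rewrite (csum_word sk (kernel_term_word xi)).
have h0 : 0 <= C * J xi `^ rexp (2 * n + (size s + size t)).
  by rewrite mulr_ge0// powR_ge0.
apply: csum_le; first by split; [exact: sumbdd_rapid h0|move=> k; exact: HC].
move=> r ur; rewrite /= -mulr_sumr [X in _ <= X]mulrAC ler_wpM2l//; exact: HB.
Qed.

End RemainderKernel.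

(** * The composed amplitude *)

Section NegatedDerivatives.
Local Open Scope complex_scope.
Context {R : realType} {n : nat}.
Implicit Types (f : 'rV[R]_n -> R[i]) (k : 'rV[int]_n) (j : 'I_n).

Let step j (c : R[i]) f := fun z => - D_ j f z - c * f z.

Lemma negD_stepE j c f :
  step j c f = (fun z => - (0 +i* 1)^-1 * partial j f z + - c * f z).
Proof. by apply/funext => z; rewrite /step /D_ !mulNr. Qed.

Lemma smooth_torus_negD_step j c f : smooth_torus f -> smooth_torus (step j c f).
Proof.
move=> tf; rewrite negD_stepE.
exact: smooth_torusD (smooth_torusZ _ (smooth_torus_partial j tf)) (smooth_torusZ _ tf).
Qed.

Lemma fcoefD f g k : smooth_torus f -> smooth_torus g ->
  fcoef k (fun x => f x + g x) = fcoef k f + fcoef k g.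
Proof.
move=> tf tg; rewrite /fcoef -torus_integralD.
- by congr torus_integral; apply/funext => y; rewrite mulrDr.
- by case: (smooth_torusM (smooth_torus_mode k) tf) => /smooth_ccont.
- by case: (smooth_torusM (smooth_torus_mode k) tg) => /smooth_ccont.
Qed.

Lemma fcoefZ c f k : smooth_torus f -> fcoef k (fun x => c * f x) = c * fcoef k f.
Proof.
move=> tf; rewrite /fcoef -torus_integralZ.
  by congr torus_integral; apply/funext => y; rewrite mulrCA.
by case: (smooth_torusM (smooth_torus_mode k) tf) => /smooth_ccont.
Qed.

Lemma freqE k j : freq k j = (0 +i* 1) * (k 0 j)%:~R :> R[i].
Proof.
have -> : (k 0 j)%:~R = ((k 0 j)%:~R : R)%:C by rewrite rmorph_int.
by apply: complex_eq; rewrite ?cReM ?cImM /= ?mul0r ?mulr0 ?mul1r ?subr0 ?add0r.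
Qed.

(** In the convention of [fcoef] the multiplier of - D_j is k_j, its eigenvalue on the mode e^(-izk)
    that carries the coefficient of index k. *)
Lemma fcoef_negD_step j c f k : smooth_torus f ->
  fcoef k (step j c f) = ((k 0 j)%:~R - c) * fcoef k f.
Proof.
move=> tf; rewrite negD_stepE.
have tp := smooth_torus_partial j tf.
rewrite (fcoefD k (smooth_torusZ _ tp) (smooth_torusZ _ tf)) (fcoefZ _ k tp) (fcoefZ _ k tf).
have := fcoef_partial j k tf; set F := fcoef k (partial j f) => ->.
rewrite freqE mulrA mulrNN mulrA mulVf ?mul1r -?mulrDl//.
by rewrite eq_complex/= negb_and oner_neq0 orbT.
Qed.

Lemma smooth_torus_negD_falling j m f : smooth_torus f -> smooth_torus (negD_falling j m f).
Proof.
elim: m f => [//|m IH] f tf; apply: IH; exact: smooth_torus_negD_step.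
Qed.

Lemma fcoef_negD_falling j m f k : smooth_torus f ->
  fcoef k (negD_falling j m f) = falling (k 0 j)%:~R m * fcoef k f.
Proof.
elim: m f => [|m IH] f tf; first by rewrite /falling big_ord0 mul1r.
rewrite [LHS](IH _ (smooth_torus_negD_step j m%:R tf)) (fcoef_negD_step _ _ _ tf).
by rewrite fallingS mulrA.
Qed.

Lemma smooth_torus_negD_mi alpha f : smooth_torus f -> smooth_torus (negD_mi alpha f).
Proof.
move=> tf; rewrite /negD_mi /mi_comp; elim: (enum _) => [//|j s IH].
exact: smooth_torus_negD_falling.
Qed.

Lemma fcoef_negD_mi alpha f k : smooth_torus f ->
  fcoef k (negD_mi alpha f) = mi_falling k alpha * fcoef k f.
Proof.
move=> tf; rewrite /mi_falling -big_enum /negD_mi /mi_comp /=.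
suff : forall s, smooth_torus (foldr (fun j g => negD_falling j (alpha j) g) f s) /\
  fcoef k (foldr (fun j g => negD_falling j (alpha j) g) f s) =
  \prod_(j <- s) falling (k 0 j)%:~R (alpha j) * fcoef k f.
  by move=> /(_ (enum 'I_n))[].
elim=> [|j s [IH1 IH2]]; first by rewrite big_nil mul1r.
split; first exact: smooth_torus_negD_falling.
by rewrite [LHS](fcoef_negD_falling _ _ _ IH1) IH2 big_cons mulrA.
Qed.

Lemma fourier_dominated f z : smooth_torus f ->
  exists b, dominated b (fun k => mode (- k) z * (two_pi_mn (n := n) * fcoef k f)).
Proof.
move=> tf; have [C C0 HC] := fcoef_rapid (2 * n) tf.
exists (fun k => cabs (two_pi_mn (n := n) : R[i]) * C * size1 k ^- (2 * n)); split.
  by apply: sumbdd_rapid; rewrite mulr_ge0// cabs_ge0.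
move=> k; rewrite cabsM cabs_mode mul1r cabsM -mulrA ler_wpM2l ?cabs_ge0//.
exact: rapid_le.
Qed.

Lemma negD_falling_order (P : Type) (D : P -> Prop) (W lam : P -> R)
    (F : P -> 'rV[R]_n -> R[i]) j m : family_order D W lam F ->
  family_order D (fun q => W q * lam q ^+ m) lam (fun q => negD_falling j m (F q)).
Proof.
elim: m F W => [|m IH] F W oF.
  by under eq_fun do rewrite mulr1.
have -> : (fun q => W q * lam q ^+ m.+1) = (fun q => W q * lam q * lam q ^+ m).
  by apply/funext => q; rewrite exprS mulrA.
have := IH _ _ (orderD (orderZ (- (0 +i* 1)^-1) (order_partial j oF))
  (order_le (W' := fun q => W q * lam q) (lam' := lam) _ _ _ (orderZ (- m%:R) oF))).
have pW q : D q -> 0 <= W q * lam q /\ 1 <= lam q.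
  move=> Dq; have [W0 l1] := order_pos oF Dq.
  by rewrite mulr_ge0// (le_trans ler01).
have -> : (fun q => negD_falling j m.+1 (F q)) = (fun q => negD_falling j m
    (fun x => - (0 +i* 1)^-1 * partial j (F q) x + - m%:R * F q x)).
  by apply/funext => q; rewrite -negD_stepE.
apply; [exists 1 => // q Dq; rewrite mul1r|exists 1 => // q Dq; rewrite mul1r//|exact: pW].
by have [W0 l1] := order_pos oF Dq; rewrite ler_peMr.
Qed.

End NegatedDerivatives.

(** * The kernels, the amplitude c and its expansion *)

Section CompositionKernel.
Local Open Scope classical_set_scope.
Local Open Scope complex_scope.
Context {R : realType} {n : nat}.
Local Notation Z := 'rV[int]_n.
Local Notation J := (@japanese R n).

Lemma sumbdd_inj (h : Z -> Z) (b : Z -> R) : injective h -> sumbdd b ->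
  sumbdd (fun k => b (h k)).
Proof.
move=> ih [b0 [B HB]]; split=> //; exists B => s us.
by rewrite -(big_map h xpredT b) HB// map_inj_uniq.
Qed.

Context (m l rho delta : R).
Hypotheses (rho0 : 0 <= rho) (delta0 : 0 <= delta) (delta1 : delta < 1).
Context (A : Z -> 'rV[R]_(n + n) -> R[i]) (p : Z -> 'rV[R]_n -> R[i]).
Hypothesis tA : forall x, smooth_torus (A x).
Hypothesis oA : family_order (fun _ => True) (fun x => J x `^ m)
  (fun x => J x `^ delta) A.
Hypothesis op : symbol_order l rho delta p.

Let a (x y : 'rV[R]_n) xi := A xi (row_mx x y).
Let q x xi := p xi x.

Let density_torus xi x (P : 'rV[R]_n -> R[i]) :
  smooth_torus P -> smooth_torus (fun y => A xi (row_mx x y) * P y).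
Proof. exact: smooth_torusM (smooth_torus_sectionr x (tA xi)). Qed.

Lemma comp_termE x z xi k : comp_term a q x z xi (xi + k) =
  mode (- k) z * (two_pi_mn (n := n) * fcoef k (fun y => A xi (row_mx x y) * p (xi + k) y)).
Proof.
have [tp _] := op; have td := density_torus xi x (tp (xi + k)).
have [/smooth_ccont cd _] := smooth_torusM (smooth_torus_mode k) td.
rewrite mulrA -torus_integralZ//; congr torus_integral; apply/funext => y.
rewrite addrAC subrr add0r dotBl /mode dotNr addrC expiD /a /q; ring.
Qed.

Lemma comp_term_kernel x z xi k : comp_term a q x z xi (xi + k) =
  kernel_term A p 0 xi k (row_mx x z).
Proof.
rewrite comp_termE /kernel_term row_mxKl row_mxKr; congr (_ * (_ * fcoef _ _)).
apply/funext => y; rewrite /remainder_density /symbol_remainder /taylor_remainder /=.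
rewrite /mi_sum big_pred0 ?subr0// => alpha; exact: ltn0.
Qed.

Lemma comp_term_sumbdd x z xi : exists2 b, sumbdd b &
  forall eta, cabs (comp_term a q x z xi eta) <= b eta.
Proof.
have [b sb Hb] := kernel_term_word rho0 delta0 delta1 tA oA op 0 xi [::].
exists (fun eta => b (eta - xi)).
  by apply: (sumbdd_inj (h := fun eta => eta - xi)) sb => y y' /addIr.
by move=> eta; rewrite -[in X in cabs X](subrKC xi eta) comp_term_kernel; exact: Hb.
Qed.

Lemma comp_amplitude_kernel x z xi : comp_amplitude a q x z xi =
  remainder_kernel A p 0 xi (row_mx x z).
Proof.
rewrite /comp_amplitude -(csum_reindex (h := fun k => xi + k) (h' := fun k => - xi + k)).
- by congr lattice_sum; apply/funext => k; exact: comp_term_kernel.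
- by move=> k; rewrite addKr.
- by move=> k; rewrite addNKr.
Qed.

Let expansion_density alpha xi x (y : 'rV[R]_n) :=
  A xi (row_mx x y) * diff_mi alpha (p^~ y) xi.

Let expansion_density_torus alpha xi x : smooth_torus (expansion_density alpha xi x).
Proof.
have [tp _] := op; apply: density_torus; under eq_fun do rewrite diff_miE.
exact: smooth_torus_diff.
Qed.

(** The two terms differ by the Taylor polynomial, whose alpha-part is a falling power of k times
    the coefficient of a Delta^alpha p. By [fcoef_negD_mi] the falling power is absorbed into an
    operator in -D acting on that product. *)
Lemma kernel_term_expansion M x z xi k :
  kernel_term A p 0 xi k (row_mx x z) - kernel_term A p M xi k (row_mx x z) =
  \sum_(alpha : {ffun 'I_n -> 'I_M} | (mi_size (fun j => alpha j) < M)%N)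
    (mi_fact (fun j => alpha j))%:R^-1 * (mode (- k) z * (two_pi_mn (n := n) *
      fcoef k (negD_mi (fun j => alpha j) (expansion_density (fun j => alpha j) xi x)))).
Proof.
rewrite /kernel_term row_mxKl row_mxKr -mulrBr -mulrBr.
have -> : fcoef k (remainder_density A p 0 [::] x xi k) -
  fcoef k (remainder_density A p M [::] x xi k) =
  \sum_(alpha : {ffun 'I_n -> 'I_M} | (mi_size (fun j => alpha j) < M)%N)
    (mi_fact (fun j => alpha j))%:R^-1 * mi_falling k (fun j => alpha j) *
      fcoef k (expansion_density (fun j => alpha j) xi x); last first.
  rewrite !mulr_sumr; apply: eq_bigr => alpha _.
  rewrite (fcoef_negD_mi _ k (expansion_density_torus _ _ _)).
  set F := fcoef _ _; set w := two_pi_mn; set e := mode _ _; ring.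
have ct (f : 'rV[R]_n -> R[i]) : smooth_torus f -> ccont (fun y => mode k y * f y).
  by move=> tf; have [/smooth_ccont] := smooth_torusM (smooth_torus_mode k) tf.
have c0 := ct _ (remainder_density_torus tA op 0 [::] x xi k).
have cM := ct _ (remainder_density_torus tA op M [::] x xi k).
rewrite {1 2}/fcoef -torus_integralB//.
have ca alpha : ccont (fun y => (mi_fact alpha)%:R^-1 * mi_falling k alpha *
   (mode k y * expansion_density alpha xi x y)).
  exact: ccontZ (ct _ (expansion_density_torus alpha xi x)).
under [in RHS]eq_bigr => alpha _.
  rewrite -torus_integralZ; last exact: ct (expansion_density_torus _ xi x).
  over.
rewrite -torus_integral_sum//; congr torus_integral; apply/funext => y.
rewrite /remainder_density /symbol_remainder /taylor_remainder /=.
rewrite [mi_sum 0 _]big_pred0; last by move=> alpha; exact: ltn0.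
rewrite subr0 -!mulrBr opprB addrCA subrr addr0 /mi_sum !mulr_sumr.
by apply: eq_bigr => alpha _; rewrite /expansion_density; ring.
Qed.

(** After summation over k, each term of the expansion is recovered by Fourier inversion at z. The
    products a Delta^alpha p are smooth and periodic in y, so all series involved are dominated and
    may be separated. *)
Lemma remainder_kernelE M x z xi : remainder a q M x z xi =
  remainder_kernel A p M xi (row_mx x z).
Proof.
rewrite /remainder comp_amplitude_kernel.
have dK M' : exists b, dominated b (fun k => kernel_term A p M' xi k (row_mx x z)).
  have [b sb Hb] := kernel_term_word rho0 delta0 delta1 tA oA op M' xi [::].
  by exists b; split=> // k; exact: Hb.
have [b0 d0] := dK 0; have [bM dM] := dK M.
suff -> : \sum_(alpha : {ffun 'I_n -> 'I_M} | (mi_size (fun j => alpha j) < M)%N)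
      expansion_term a q (fun j => alpha j) x z xi =
    remainder_kernel A p 0 xi (row_mx x z) - remainder_kernel A p M xi (row_mx x z).
  by rewrite opprB addrC subrK.
rewrite -(csumB d0 dM).
under [X in lattice_sum X]eq_fun do rewrite kernel_term_expansion.
have tE alpha := smooth_torus_negD_mi alpha (expansion_density_torus alpha xi x).
have /choice[b Hb] alpha := fourier_dominated z (tE alpha).
rewrite (csum_sum _ _ (fun alpha : {ffun 'I_n -> 'I_M} =>
  dominatedZ (mi_fact (fun j => alpha j))%:R^-1 (Hb (fun j => alpha j)))).
apply: eq_bigr => alpha _; rewrite (csumZ _ (Hb _)); congr (_ * _).
exact: fourier_inversion z (tE _).
Qed.

End CompositionKernel.

(** * Translation between the amplitude classes and families *)

Section AmplitudeOrder.
Local Open Scope classical_set_scope.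
Local Open Scope complex_scope.
Context {R : realType} {n : nat}.
Local Notation Z := 'rV[int]_n.
Local Notation J := (@japanese R n).
Local Notation everywhere := (fun _ : Z => True).

Lemma deriv2_miE alpha beta (f : 'rV[R]_(n + n) -> R[i]) x y : smooth f ->
  deriv2_mi alpha beta (fun x y => f (row_mx x y)) x y =
  foldr partial f (split_word (mi_word alpha) (mi_word beta)) (row_mx x y).
Proof.
move=> sf; rewrite /deriv2_mi deriv_miE.
have -> : (fun x' => deriv_mi beta (fun y => f (row_mx x' y)) y) =
   (fun x' => foldr partial f (map (@rshift n n) (mi_word beta)) (row_mx x' y)).
  by apply/funext => x'; rewrite deriv_miE (word_sectionr x' _ sf).
by rewrite (word_sectionl y _ (smooth_word _ sf)) -foldr_cat.
Qed.

Lemma smooth_amplitude_torus a : smooth_amplitude a ->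
  forall xi, smooth_torus (fun w : 'rV[R]_(n + n) => a (lsubmx w) (rsubmx w) xi).
Proof.
move=> sa xi; have [sA pl pr] := sa xi; split=> // j w.
rewrite addrC lsubmx_shift rsubmx_shift -(splitK j); case: (fintype.split j) => i /=.
  by rewrite lblock_lshift rblock_lshift /= scaler0 add0r addrC pl.
by rewrite lblock_rshift rblock_rshift /= scaler0 add0r addrC pr.
Qed.

Section Words.
Context (A : Z -> 'rV[R]_(n + n) -> R[i]).
Hypothesis tA : forall xi, smooth_torus (A xi).
Local Notation a := (fun x y xi => A xi (row_mx x y)).

Lemma torus_smooth_amplitude : smooth_amplitude a.
Proof.
move=> xi; split.
- have -> : (fun w : 'rV[R]_(n + n) => A xi (row_mx (lsubmx w) (rsubmx w))) = A xi.
    by apply/funext => w; rewrite hsubmxK.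
  by case: (tA xi).
- by move=> y; case: (smooth_torus_sectionl y (tA xi)).
- by move=> x; case: (smooth_torus_sectionr x (tA xi)).
Qed.

(** Any word can be rearranged into x-letters followed by y-letters, because partial derivatives of
    smooth periodic functions commute. *)
Lemma family_order_split (W lam : Z -> R) : (forall xi, 0 <= W xi /\ 1 <= lam xi) ->
  (forall s t, exists C : R, forall xi w,
     cabs (foldr partial (A xi) (split_word s t) w) <=
     C * W xi * lam xi ^+ (size s + size t)) ->
  family_order everywhere W lam A.
Proof.
move=> pW H; split; [by move=> xi _; case: (tA xi)|by move=> xi _; exact: pW|].
move=> s; pose s1 := pmap (@lblock n n) s; pose s2 := pmap (@rblock n n) s.
have [C HC] := H s1 s2; exists `|C| => // xi w _.
rewrite (word_perm (tA xi) (perm_split_word s)) (le_trans (HC xi w))//.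
rewrite -size_split_word -(perm_size (perm_split_word s)).
have [W0 l1] := pW xi; rewrite -!mulrA ler_wpM2r ?ler_norm//.
by rewrite mulr_ge0// exprn_ge0// (le_trans ler01).
Qed.

Lemma japanese_scale (delta : R) xi : 0 <= delta -> 1 <= J xi `^ delta.
Proof.
by move=> d0; rewrite -[X in X <= _](powRr0 (J xi)) ler_powR// japanese_ge1.
Qed.

Lemma deriv2_orderP (e delta : R) : 0 <= delta ->
  family_order everywhere (fun xi => J xi `^ e) (fun xi => J xi `^ delta) A <->
  forall alpha beta : 'I_n -> nat, exists C : R, forall x y xi,
    cabs (deriv2_mi alpha beta (fun x' y' => A xi (row_mx x' y')) x y) <=
    C * J xi `^ (e + delta * (mi_size alpha + mi_size beta)%N%:R).
Proof.
move=> delta0; split=> [oA alpha beta|H].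
  have [C C0 HC] := order_bound oA (split_word (mi_word alpha) (mi_word beta)).
  exists C => x y xi; have [sA _] := tA xi; rewrite deriv2_miE//.
  apply: le_trans (HC xi _ I) _.
  by rewrite size_split_word !size_mi_word powR_expn -mulrA -powRDp// japanese_gt0.
apply: family_order_split => [xi|s t].
  by rewrite powR_ge0 japanese_scale.
have [C HC] := H (fun j => count_mem j s) (fun j => count_mem j t).
exists C => xi w; have [sA _] := tA xi.
have := HC (lsubmx w) (rsubmx w) xi; rewrite deriv2_miE// hsubmxK !mi_size_count.
rewrite powR_expn -mulrA -powRDp ?japanese_gt0//.
rewrite [foldr _ _ (split_word s t)](word_perm (tA xi) (t :=
  split_word (mi_word (fun j => count_mem j s)) (mi_word (fun j => count_mem j t))))//.
by rewrite perm_cat// perm_map// perm_mi_word.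
Qed.

(** The scale is written as the power 0 of <xi>, so that this is the case delta = 0 of the general
    estimates. *)
Lemma bounded_amplitudeP (m : R) : bounded_amplitude m a <->
  family_order everywhere (fun xi => J xi `^ m) (fun xi => J xi `^ 0) A.
Proof.
split=> [[_ H]|/(deriv2_orderP _ (lexx 0)) H].
  apply/(deriv2_orderP _ (lexx 0)) => alpha beta; have [C HC] := H alpha beta.
  by exists C => x y xi; rewrite mul0r addr0.
split; first exact: torus_smooth_amplitude.
move=> alpha beta; have [C HC] := H alpha beta.
by exists C => x y xi; have := HC x y xi; rewrite mul0r addr0.
Qed.

End Words.

(** The two definitions take differences in xi and derivatives in (x, y) in opposite orders; these
    operations commute. *)
Lemma amplitude_classP (A : Z -> 'rV[R]_(n + n) -> R[i]) (m rho delta : R) :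
  0 <= delta -> (forall xi, smooth_torus (A xi)) ->
  amplitude_class m rho delta (fun x y xi => A xi (row_mx x y)) <->
  symbol_order m rho delta A.
Proof.
move=> delta0 tA.
have E alpha beta gamma x y xi :
  diff_mi alpha (fun zeta => deriv2_mi beta gamma
    (fun x' y' => A zeta (row_mx x' y')) x y) xi =
  deriv2_mi beta gamma
    (fun x' y' => foldr diff_step (A^~ (row_mx x' y')) (mi_word alpha) xi) x y.
  have [sD _] := smooth_torus_diff (mi_word alpha) xi tA.
  rewrite (deriv2_miE beta gamma x y sD).
  rewrite word_diff// diff_miE.
  suff -> : (fun zeta => deriv2_mi beta gamma (fun x' y' => A zeta (row_mx x' y')) x y) =
      (fun zeta => foldr partial (A zeta) (split_word (mi_word beta) (mi_word gamma))
        (row_mx x y)) by [].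
  by apply/funext => zeta; have [sA _] := tA zeta; rewrite deriv2_miE.
split=> [[_ H]|[_ oA]].
  split=> // d; apply/deriv2_orderP => //; first by move=> xi; exact: smooth_torus_diff.
  move=> beta gamma; have [C HC] := H (fun j => count_mem j d) beta gamma.
  exists C => x y xi; have := HC x y xi; rewrite E mi_size_count.
  congr (cabs (deriv2_mi _ _ _ _ _) <= _); apply/funext => x'; apply/funext => y'.
  by rewrite (diff_word_perm _ (perm_mi_word d)).
split; first exact: torus_smooth_amplitude.
move=> alpha beta gamma.
have tD xi := smooth_torus_diff (mi_word alpha) xi tA.
have /(deriv2_orderP tD _ delta0)/(_ beta gamma)[C HC] := oA (mi_word alpha).
by exists C => x y xi; have := HC x y xi; rewrite E size_mi_word.
Qed.

Lemma symbol_class_order (p : 'rV[R]_n -> Z -> R[i]) (l rho delta : R) :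
  0 <= delta -> symbol_class l rho delta p -> symbol_order l rho delta (fun xi x => p x xi).
Proof.
move=> delta0 [tp H]; split=> // d; split.
- by move=> xi _; case: (smooth_torus_diff d xi tp).
- by move=> xi _; rewrite powR_ge0 japanese_scale.
move=> s; have [C HC] := H (fun j => count_mem j d) (fun j => count_mem j s).
exists `|C| => // xi x _; apply: le_trans (_ : C * J xi `^
    (l - rho * (size d)%:R + delta * (size s)%:R) <= _).
  have := HC x xi; rewrite !mi_size_count -diff_wordE word_diff//.
  suff -> : (fun zeta => deriv_mi (fun j => count_mem j s) (p^~ zeta) x) =
      (fun zeta => foldr partial (p^~ zeta) s x) by [].
  by apply/funext => zeta; rewrite (wordE s (tp zeta)).
rewrite powR_expn -mulrA -powRDp ?japanese_gt0//.
by rewrite ler_wpM2r ?powR_ge0 ?ler_norm.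
Qed.

End AmplitudeOrder.

(** * Symbol classes of c and of its expansion *)

Section CompositionClasses.
Local Open Scope classical_set_scope.
Local Open Scope complex_scope.
Context {R : realType} {n : nat}.
Local Notation Z := 'rV[int]_n.
Local Notation J := (@japanese R n).
Local Notation everywhere := (fun _ : Z => True).
Implicit Types (m l rho delta : R) (A : Z -> 'rV[R]_(n + n) -> R[i])
  (p : Z -> 'rV[R]_n -> R[i]).

Lemma order_sum (P : Type) (D : P -> Prop) N (W lam : P -> R) (I : Type) (r : seq I)
    (Q : pred I) (F : I -> P -> 'rV[R]_N -> R[i]) :
  (forall q, D q -> 0 <= W q /\ 1 <= lam q) ->
  (forall i, Q i -> family_order D W lam (F i)) ->
  family_order D W lam (fun q x => \sum_(i <- r | Q i) F i q x).
Proof.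
move=> pW oF; elim: r => [|i r IH].
  under eq_fun do under eq_fun do rewrite big_nil.
  by apply: order_cst => //; exists 0 => // q _; rewrite cabs0 mul0r.
under eq_fun do under eq_fun do rewrite big_cons.
by case E : (Q i) => //; exact: orderD (oF i E) IH.
Qed.

Lemma remainder_kernel_order m l rho delta A p M :
  0 <= rho -> 0 <= delta -> delta < 1 -> (forall x, smooth_torus (A x)) ->
  family_order everywhere (fun x => J x `^ m) (fun x => J x `^ delta) A ->
  symbol_order l rho delta p ->
  family_order everywhere
    (fun x => J x `^ remainder_exponent m l rho delta M (2 * n))
    (fun x => J x `^ delta) (remainder_kernel A p M).
Proof.
move=> rho0 delta0 delta1 tA oA op; apply: family_order_split.
- exact: remainder_kernel_smooth tA oA op M.
- by move=> xi; rewrite powR_ge0 japanese_scale.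
move=> s t; have [C C0 HC] := remainder_kernel_bound rho0 delta0 delta1 tA oA op M s t.
exists C => xi w; apply: le_trans (HC xi w) _.
rewrite powR_expn -mulrA -powRDp ?japanese_gt0// le_eqVlt; apply/orP; left; apply/eqP.
by congr (_ * _ `^ _); rewrite /remainder_exponent natrD; ring.
Qed.

(** The terms of the expansion as functions on R^(n + n), with -D acting in the second block; in
    this form the calculus of families applies to them. *)
Definition expansion_kernel A p (alpha : 'I_n -> nat) (xi : Z) (w : 'rV[R]_(n + n)) : R[i] :=
  (mi_fact alpha)%:R^-1 *
  foldr (fun j f => negD_falling (rshift n j) (alpha j) f)
    (fun w => A xi w * diff_mi alpha (p^~ (rsubmx w)) xi) (enum 'I_n) w.

Lemma negD_falling_sectionr j k (f : 'rV[R]_(n + n) -> R[i]) x : smooth_torus f ->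
  negD_falling j k (fun z => f (row_mx x z)) =
  (fun z => negD_falling (rshift n j) k f (row_mx x z)).
Proof.
elim: k f => [//|k IH] f tf /=; rewrite -(IH _ (smooth_torus_negD_step _ _ tf)).
congr negD_falling; apply/funext => z; have [sf _] := tf.
have E := congr1 (fun h => h z) (word_sectionr x [:: j] sf).
by rewrite /= in E; rewrite /D_ E.
Qed.

Lemma expansion_kernelE A p alpha x z xi : (forall x, smooth_torus (A x)) ->
  (forall x, smooth_torus (p x)) ->
  expansion_term (fun x y xi => A xi (row_mx x y)) (fun x xi => p xi x) alpha x z xi =
  expansion_kernel A p alpha xi (row_mx x z).
Proof.
move=> tA tp; rewrite /expansion_term /expansion_kernel /negD_mi /mi_comp; congr (_ * _).
pose G (w : 'rV[R]_(n + n)) := A xi w * diff_mi alpha (p^~ (rsubmx w)) xi.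
have tG : smooth_torus G.
  apply: smooth_torusM (tA xi) _; apply: (smooth_torus_rsubmx
    (g := fun y => diff_mi alpha (p^~ y) xi)).
  by under eq_fun do rewrite diff_miE; exact: smooth_torus_diff.
have -> : (fun z' => A xi (row_mx x z') * diff_mi alpha (fun xi => p xi z') xi) =
    (fun z' => G (row_mx x z')) by apply/funext => z'; rewrite /G row_mxKr.
rewrite -/G; suff : forall s,
  smooth_torus (foldr (fun j f => negD_falling (rshift n j) (alpha j) f) G s) /\
  foldr (fun j f => negD_falling j (alpha j) f) (fun z' => G (row_mx x z')) s =
  (fun z => foldr (fun j f => negD_falling (rshift n j) (alpha j) f) G s (row_mx x z)).
  by move=> /(_ (enum 'I_n))[_ ->].
elim=> [//|j s [IH1 IH2]]; split; first exact: smooth_torus_negD_falling IH1.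
by rewrite /= IH2; exact: negD_falling_sectionr IH1.
Qed.

(** Each of the |alpha| differences lowers the order by rho, and each of the |alpha| factors of the
    operator in -D raises it by delta. *)
Lemma expansion_kernel_order m l rho delta A p alpha : 0 <= delta ->
  family_order everywhere (fun x => J x `^ m) (fun x => J x `^ delta) A ->
  symbol_order l rho delta p ->
  family_order everywhere
    (fun x => J x `^ (m + l - (rho - delta) * (mi_size alpha)%:R))
    (fun x => J x `^ delta) (expansion_kernel A p alpha).
Proof.
move=> delta0 oA [tp op]; apply: orderZ.
have -> : (fun x => J x `^ (m + l - (rho - delta) * (mi_size alpha)%:R)) =
  (fun x => J x `^ (m + l - rho * (mi_size alpha)%:R) *
     (J x `^ delta) ^+ (\sum_(j <- enum 'I_n) alpha j)%N).
  apply/funext => x; rewrite big_enum /= -/(mi_size alpha) powR_expn.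
  by rewrite -powRDp ?japanese_gt0//; congr powR; ring.
elim: (enum 'I_n) => [|j s IH] /=; last first.
  have -> : (fun x => J x `^ (m + l - rho * (mi_size alpha)%:R) *
      (J x `^ delta) ^+ (\sum_(j <- j :: s) alpha j)) =
    (fun x => J x `^ (m + l - rho * (mi_size alpha)%:R) *
      (J x `^ delta) ^+ (\sum_(j <- s) alpha j) * (J x `^ delta) ^+ alpha j).
    by apply/funext => x; rewrite big_cons addnC exprD mulrA.
  exact: negD_falling_order IH.
have -> : (fun x => J x `^ (m + l - rho * (mi_size alpha)%:R) *
    (J x `^ delta) ^+ (\sum_(j <- [::]) alpha j)) =
  (fun x => J x `^ (m + l - rho * (mi_size alpha)%:R)).
  by apply/funext => x; rewrite big_nil mulr1.
have -> : (fun x => J x `^ (m + l - rho * (mi_size alpha)%:R)) =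
  (fun x => J x `^ m * J x `^ (l - rho * (mi_size alpha)%:R)).
  by apply/funext => x; rewrite -(powRDp _ _ (japanese_gt0 x)) addrA.
apply: orderM oA _; rewrite -size_mi_word.
have -> : (fun (q : Z) (x : 'rV[R]_(n + n)) => diff_mi alpha (p^~ (rsubmx x)) q) =
  (fun q x => foldr diff_step (p^~ (rsubmx x)) (mi_word alpha) q).
  by apply/funext => q; apply/funext => x; rewrite diff_miE.
apply: (order_pullback (L := fun _ => rsubmx) (sigma := @rblock n n)) (op (mi_word alpha)).
  by move=> _; exact: continuous_rsubmx.
by move=> _; exact: rsubmx_shift.
Qed.

(* The loss <xi>^(2 n delta) in the remainder is absorbed by the gain
   <xi>^(- (rho - delta) M) of a long expansion. *)
Lemma comp_kernel_order m l rho delta A p : 0 <= delta -> delta < rho -> rho <= 1 ->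
  (forall x, smooth_torus (A x)) ->
  family_order everywhere (fun x => J x `^ m) (fun x => J x `^ delta) A ->
  symbol_order l rho delta p ->
  family_order everywhere (fun x => J x `^ (m + l)) (fun x => J x `^ delta)
    (remainder_kernel A p 0).
Proof.
move=> delta0 dr rho1 tA oA op; have rho0 := ltW (le_lt_trans delta0 dr).
have delta1 := lt_le_trans dr rho1; have rd : 0 < rho - delta by rewrite subr_gt0.
have [M] := exists_nat_ge (delta * (2 * n)%:R / (rho - delta)).
rewrite ler_pdivrMr// => HM.
have pW xi : True -> 0 <= J xi `^ (m + l) /\ 1 <= J xi `^ delta.
  by rewrite powR_ge0 japanese_scale.
have weaken (e : R) (F : Z -> 'rV[R]_(n + n) -> R[i]) : e <= m + l ->
    family_order everywhere (fun x => J x `^ e) (fun x => J x `^ delta) F ->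
    family_order everywhere (fun x => J x `^ (m + l)) (fun x => J x `^ delta) F.
  move=> el; apply: order_le pW; last by exists 1 => // q _; rewrite mul1r.
  by exists 1 => // q _; rewrite mul1r ler_powR ?japanese_ge1.
have -> : remainder_kernel A p 0 = (fun xi w => remainder_kernel A p M xi w +
  \sum_(alpha : {ffun 'I_n -> 'I_M} | (mi_size (fun j => alpha j) < M)%N)
    expansion_kernel A p (fun j => alpha j) xi w).
  have [tp _] := op; apply/funext => xi; apply/funext => w; rewrite -(hsubmxK w).
  rewrite -(remainder_kernelE rho0 delta0 delta1 tA oA op M).
  rewrite -(comp_amplitude_kernel tA op) /remainder -addrA addrC.
  under eq_bigr do rewrite (expansion_kernelE _ _ _ _ tA tp).
  by rewrite addNr add0r.
apply: orderD.
  apply: weaken (remainder_kernel_order M rho0 delta0 delta1 tA oA op).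
  by rewrite /remainder_exponent; move: HM; lra.
apply: order_sum pW _ => alpha _.
apply: weaken (expansion_kernel_order _ delta0 oA op).
by rewrite gerBl mulr_ge0// ltW.
Qed.

(** After the substitution eta = xi + k the mode e^(-izk) no longer depends on xi. So Delta_j acts
    only on the product a(x, y, xi) p(y, xi + k), where it obeys the discrete Leibniz rule. *)
Lemma comp_kernel_diff m l rho delta A p j xi w :
  0 <= delta -> delta < 1 -> 0 <= rho ->
  symbol_order m rho delta A -> symbol_order l rho delta p ->
  diff_step j (fun xi => remainder_kernel A p 0 xi w) xi =
  remainder_kernel (fun x w => diff_step j (A^~ w) x) p 0 xi w +
  remainder_kernel (fun x w => A (x + delta_mx 0 j) w)
    (fun x w => diff_step j (p^~ w) x) 0 xi w.
Proof.
move=> delta0 delta1 rho0 oA op.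
have dom m' l' A' p' xi' : symbol_order m' rho delta A' -> symbol_order l' rho delta p' ->
    exists b, dominated b (fun k => kernel_term A' p' 0 xi' k w).
  move=> oA' op'; have [b sb Hb] := kernel_term_word rho0 delta0 delta1 oA'.1
    (symbol_order_family oA') op' 0 xi' [::].
  by exists b; split=> // k; exact: Hb.
have oA' := symbol_order_shift j rho0 oA; have oDp := symbol_order_diff j op.
have oDA := symbol_order_diff j oA.
have [b1 d1] := dom _ _ _ _ xi oDA op.
have [b2 d2] := dom _ _ _ _ xi oA' oDp.
have [b3 d3] := dom _ _ _ _ (xi + delta_mx 0 j) oA op.
have [b4 d4] := dom _ _ _ _ xi oA op.
rewrite /remainder_kernel -(csumD d1 d2) /diff_step -(csumB d3 d4).
congr lattice_sum; apply/funext => k; rewrite /kernel_term -mulrBr -mulrDr.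
congr (_ * _); rewrite /remainder_coef -mulrBr -mulrDr; congr (_ * _).
have td x A' p' m' l' : symbol_order m' rho delta A' -> symbol_order l' rho delta p' ->
    ccont (fun y => mode k y * remainder_density A' p' 0 [::] (lsubmx w) x k y).
  move=> [tA' _] op'; have td := remainder_density_torus tA' op' 0 [::] (lsubmx w) x k.
  by have [/smooth_ccont] := smooth_torusM (smooth_torus_mode k) td.
rewrite /fcoef -torus_integralB; [|exact: td oA op|exact: td oA op].
rewrite -torus_integralD; [|exact: td oDA op|exact: td oA' oDp].
congr torus_integral; apply/funext => y.
rewrite /remainder_density /symbol_remainder /taylor_remainder /=.
have E0 (G : ('I_n -> nat) -> R[i]) : mi_sum 0 G = 0.
  by rewrite [LHS]big_pred0// => alpha; exact: ltn0.
by rewrite !E0 !subr0 /diff_step addrAC; ring.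
Qed.

(** Induction on the word of differences, for all A, p and orders at once: by [comp_kernel_diff] the
    innermost difference yields two kernels of the same kind, both of order m + l - rho. *)
Lemma comp_kernel_symbol m l rho delta A p : 0 <= delta -> delta < rho -> rho <= 1 ->
  symbol_order m rho delta A -> symbol_order l rho delta p ->
  symbol_order (m + l) rho delta (remainder_kernel A p 0).
Proof.
move=> delta0 dr rho1 oA op; have rho0 := ltW (le_lt_trans delta0 dr).
have delta1 := lt_le_trans dr rho1.
split.
  move=> xi; have := remainder_kernel_smooth rho0 delta0 delta1 oA.1
   (symbol_order_family oA) op 0 xi.
  by [].
move=> d; elim/last_ind: d m l A p oA op => [|d j IH] m l A p oA op.
  rewrite mulr0 subr0.
  exact: comp_kernel_order delta0 dr rho1 oA.1 (symbol_order_family oA) op.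
have := IH _ _ _ _ (symbol_order_shift j rho0 oA) (symbol_order_diff j op).
have := IH _ _ _ _ (symbol_order_diff j oA) op.
rewrite size_rcons (_ : m - rho + l - _ = m + l - rho * (size d).+1%:R); last first.
  by rewrite -(natr1 (size d)); ring.
rewrite (_ : m + (l - rho) - _ = m + l - rho * (size d).+1%:R); last first.
  by rewrite -(natr1 (size d)); ring.
move=> o1 o2; have := orderD o1 o2; congr family_order.
apply/funext => xi; apply/funext => w.
rewrite diff_word_rcons -diff_wordD; congr (foldr _ _ _ _); apply/funext => zeta.
by rewrite (comp_kernel_diff j zeta w delta0 delta1 rho0 oA op).
Qed.

End CompositionClasses.

(** * The composition formula *)

Section Composition.
Local Open Scope classical_set_scope.
Local Open Scope complex_scope.
Context {R : realType} {n : nat}.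
Local Notation Z := 'rV[int]_n.
Local Notation J := (@japanese R n).
Local Notation everywhere := (fun _ : Z => True).
Implicit Types (u : 'rV[R]_n -> R[i]) (phi : 'rV[R]_n -> Z -> R).

Lemma powR_size1_le (e : R) (L : nat) (k : Z) : `|e| <= L%:R ->
  J k `^ e <= size1 k ^+ L.
Proof.
move=> eL; have k1 := size1_ge1 (R := R) k; have k0 := size1_gt0 (R := R) k.
have := @powR_dominated R (J k) 1 (size1 k) e (japanese_ge1 k) (lexx 1) k1.
rewrite mul1r powR1 mul1r => /(_ (japanese_le_size1 k)) /le_trans; apply.
by rewrite -(powR_mulrn L (ltW k0)) ler_powR.
Qed.

(** * The series for Pu *)

Section PseudoDifferential.
Context (l rho : R) (p : Z -> 'rV[R]_n -> R[i]).
Hypothesis op : symbol_order l rho 0 p.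
Context (u : 'rV[R]_n -> R[i]).
Hypothesis tu : smooth_torus u.
Let q (x : 'rV[R]_n) xi := p xi x.

Lemma psdo_termE x xi : psdo_term q u x xi =
  two_pi_mn (n := n) * fcoef (- xi) u * (mode xi x * p xi x).
Proof.
have [/smooth_ccont cu _] := smooth_torusM (smooth_torus_mode (- xi)) tu.
rewrite mulrC mulrA -torus_integralZ//; congr torus_integral; apply/funext => y.
rewrite dotBl /mode dotNr expiD /q; ring.
Qed.

Let psdo_modeE : psdo_term q u =
  (fun x xi => two_pi_mn (n := n) * fcoef (- xi) u * (mode xi x * p xi x)).
Proof. by apply/funext => x; apply/funext => xi; exact: psdo_termE. Qed.

Lemma mode_symbol_torus xi : smooth_torus (fun x => mode xi x * p xi x).
Proof. by have [tp _] := op; exact: smooth_torusM (smooth_torus_mode _) (tp _). Qed.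

Lemma psdo_term_torus xi : smooth_torus (fun x => psdo_term q u x xi).
Proof. rewrite psdo_modeE; exact: smooth_torusZ (mode_symbol_torus xi). Qed.

Lemma mode_order : family_order everywhere (fun=> 1) (@size1 R n) (@mode R n).
Proof.
split; [by move=> xi _; exact: mode_smooth|by move=> xi _; rewrite size1_ge1|].
move=> s; exists 1 => // xi w _; rewrite mode_word cabsM cabs_mode mulr1 !mul1r.
exact: cabs_prod_freq_le.
Qed.

(** The coefficients of u decay faster than any power of [size1 xi]: L powers pay for the growth of
    p, one for each letter of s, and 2n for summability. *)
Lemma psdo_term_word s : exists2 b, sumbdd b &
  forall xi x, cabs (foldr partial (fun x => psdo_term q u x xi) s x) <= b xi.
Proof.
have [L HL] := exists_nat_ge `|l|.
have op' : family_order everywhere (fun xi => size1 xi ^+ L) (@size1 R n) p.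
  apply: order_le (symbol_order_family op).
  - by exists 1 => // xi _; rewrite mul1r powR_size1_le.
  - by exists 1 => // xi _; rewrite mul1r powRr0 size1_ge1.
  - by move=> xi _; rewrite exprn_ge0 ?size1_ge0 ?size1_ge1.
have [C C0 HC] := order_bound (orderM mode_order op') s.
have [C' C0' HC'] := fcoef_rapid (2 * n + (L + size s)) tu.
pose c : R := cabs (two_pi_mn (n := n) : R[i]).
have c0 : 0 <= c by exact: cabs_ge0.
exists (fun xi => c * C' * C * size1 xi ^- (2 * n)).
  by apply: sumbdd_rapid; rewrite !mulr_ge0.
move=> xi x; rewrite psdo_modeE.
have [sm _] := mode_symbol_torus xi; rewrite (wordZ _ s sm) !cabsM -/c.
have h1 := HC xi x I; have h2 := HC' (- xi); rewrite size1N in h2.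
rewrite ler_pdivlMr ?exprn_gt0 ?size1_gt0//.
set F := cabs (fcoef _ _) in h2 *; set G := cabs (foldr _ _ _ _) in h1 *.
have F0 : 0 <= F by exact: cabs_ge0.
have s0 m : 0 <= size1 xi ^+ m :> R by rewrite exprn_ge0// size1_ge0.
apply: le_trans (_ : c * F * (C * (1 * size1 xi ^+ L) * size1 xi ^+ size s) *
  size1 xi ^+ (2 * n) <= _).
  by rewrite ler_wpM2r// ler_wpM2l// mulr_ge0.
have -> : c * F * (C * (1 * size1 xi ^+ L) * size1 xi ^+ size s) * size1 xi ^+ (2 * n)
  = c * C * (size1 xi ^+ (2 * n + (L + size s)) * F) by rewrite !exprD; ring.
by rewrite [X in _ <= X]mulrAC ler_wpM2l// mulr_ge0.
Qed.

Lemma psdo_term_sumbdd : exists2 b, sumbdd b &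
  forall xi x, cabs (psdo_term q u x xi) <= b xi.
Proof. exact: psdo_term_word [::]. Qed.

Lemma psdo_smooth_torus : smooth_torus (psdo q u).
Proof.
split.
  apply: (csum_smooth (f := fun xi x => psdo_term q u x xi)) psdo_term_word.
  by move=> xi; case: (psdo_term_torus xi).
move=> j x; congr lattice_sum; apply/funext => xi.
by have [_] := psdo_term_torus xi; apply.
Qed.

End PseudoDifferential.

(** * The series for Tu *)

Section FourierSeriesOperator.
Context (m : R) (A : Z -> 'rV[R]_(n + n) -> R[i]).
Hypothesis tA : forall xi, smooth_torus (A xi).
Let a (x y : 'rV[R]_n) xi := A xi (row_mx x y).

Let amplitude_mul_torus u x xi : smooth_torus u ->
  smooth_torus (fun y => A xi (row_mx x y) * u y).
Proof. exact: smooth_torusM (smooth_torus_sectionr x (tA xi)). Qed.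

Lemma fso_termE phi u x xi : smooth_torus u -> fso_term phi a u x xi =
  expi (phi x xi) * (two_pi_mn (n := n) *
    fcoef (- xi) (fun y => A xi (row_mx x y) * u y)).
Proof.
move=> tu; have td := amplitude_mul_torus x xi tu.
have [/smooth_ccont cd _] := smooth_torusM (smooth_torus_mode (- xi)) td.
rewrite mulrA -torus_integralZ//; congr torus_integral; apply/funext => y.
rewrite expiD /mode dotNr /a; ring.
Qed.

(** Integration by parts of a u in y gives any power of decay, since the y-derivatives of a keep the
    order m. K powers absorb <xi>^m and 2n give summability; the phase has modulus 1. *)
Lemma fso_term_summable phi u x :
  family_order everywhere (fun xi => J xi `^ m) (fun xi => J xi `^ 0) A ->
  smooth_torus u -> abs_summable (fso_term phi a u x).
Proof.
move=> oA tu; have [K HK] := exists_nat_ge `|m|.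
have oS := order_pullback (L := fun _ => row_mx x) (fun _ => @continuous_row_mxr R n n x)
  (fun _ => @row_mxr_shift R n n x) oA.
have ou : family_order everywhere (fun=> 1) (fun xi => J xi `^ 0) (fun=> u).
  have := order_reparam (D' := everywhere) (h := fun=> tt) (fun _ _ => I)
    (smooth_torus_order tu).
  congr family_order; apply/funext => xi; by rewrite powRr0.
have pf xi : True -> torus_periodic (fun y => A xi (row_mx x y) * u y).
  by move=> _; case: (amplitude_mul_torus x xi tu).
have [C C0 HC] := fcoef_decay (2 * n + K) (orderM oS ou) pf.
pose c : R := cabs (two_pi_mn (n := n) : R[i]).
have c0 : 0 <= c by exact: cabs_ge0.
apply: (@dominated_summable R n (fun xi => c * C * size1 xi ^- (2 * n))); split.
  by apply: sumbdd_rapid; rewrite mulr_ge0.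
move=> xi; rewrite fso_termE// !cabsM cabs_expi mul1r -/c -mulrA ler_wpM2l//.
apply: rapid_le; have s0 : 0 < size1 xi ^+ K :> R by rewrite exprn_gt0// size1_gt0.
rewrite -(ler_pM2r s0); have := HC xi (- xi) I; rewrite size1N powRr0 expr1n !mulr1.
rewrite exprD mulrAC => /le_trans; apply; rewrite ler_wpM2l//; exact: powR_size1_le.
Qed.

End FourierSeriesOperator.

Context (m l rho : R) (A : Z -> 'rV[R]_(n + n) -> R[i]) (p : Z -> 'rV[R]_n -> R[i]).
Hypothesis rho0 : 0 <= rho.
Hypothesis tA : forall xi, smooth_torus (A xi).
Hypothesis oA : family_order everywhere (fun xi => J xi `^ m) (fun xi => J xi `^ 0) A.
Hypothesis op : symbol_order l rho 0 p.
Let a (x y : 'rV[R]_n) xi := A xi (row_mx x y).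
Let q (x : 'rV[R]_n) xi := p xi x.

(* Both sides equal [e^(i phi) Sum_eta u^(eta) F(eta - xi)], with [F(k)] the [k]-th
   Fourier coefficient of [a(x, ., xi) p(., eta)]. *)
Lemma fso_term_comp phi u x xi : smooth_torus u ->
  fso_term phi a (psdo q u) x xi = fso_term phi (comp_amplitude a q) u x xi.
Proof.
move=> tu; have lt01 := @ltr01 R.
have [tp _] := op.
have tK := remainder_kernel_smooth rho0 (lexx 0) lt01 tA oA op 0.
have -> : comp_amplitude a q = (fun x z xi => remainder_kernel A p 0 xi (row_mx x z)).
  apply/funext => x'; apply/funext => z; apply/funext => xi'.
  exact: comp_amplitude_kernel tA op x' z xi'.
rewrite (fso_termE tA phi x xi (psdo_smooth_torus op tu)) (fso_termE tK phi x xi tu).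
congr (_ * (_ * _)); rewrite /fcoef.
pose F k := fcoef k (fun y => A xi (row_mx x y) * p (xi + k) y).
pose c eta := two_pi_mn (n := n) * fcoef (- eta) u.
have cm k : ccont (mode k : 'rV[R]_n -> R[i]) by exact: smooth_ccont (mode_smooth k).
have [sS pS] := smooth_torus_sectionr x (tA xi).
have cS := smooth_ccont sS; have [CA HA] := periodic_bounded cS pS.
have [su pu] := tu; have cu := smooth_ccont su; have [Cu Hu] := periodic_bounded cu pu.
have CA0 : 0 <= CA := le_trans (cabs_ge0 _) (HA 0).
have Cu0 : 0 <= Cu := le_trans (cabs_ge0 _) (Hu 0).
(* The series for Pu is dominated uniformly in y and that for c uniformly in z, so each is
   integrated termwise; the substitution eta = xi + k matches the two results. *)
transitivity (lattice_sum (fun k => c (xi + k) * F k)).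
  have [b sb Hb] := psdo_term_sumbdd op tu.
  pose f eta y := mode (- xi) y * (A xi (row_mx x y) * psdo_term q u y eta).
  have df y : dominated (fun eta => CA * b eta) (f^~ y).
    split; first exact: sumbddZ.
    by move=> eta; rewrite !cabsM cabs_mode mul1r ler_pM ?cabs_ge0.
  have dp y : dominated b (psdo_term q u y) by split=> // eta; exact: Hb.
  have -> : (fun y => mode (- xi) y * (A xi (row_mx x y) * psdo q u y)) =
     (fun y => lattice_sum (f^~ y)).
    apply/funext => y; rewrite mulrA -(csumZ _ (dp y)); congr lattice_sum.
    by apply/funext => eta; rewrite /f mulrA.
  rewrite (csum_torus_integral _ df); last first.
    move=> eta; apply: ccontM => //; apply: ccontM => //.
    by have [/smooth_ccont] := psdo_term_torus op tu eta.
  rewrite -(csum_reindex (h := fun k => xi + k) (h' := fun k => - xi + k)).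
  - congr lattice_sum; apply/funext => k; rewrite /F /fcoef -torus_integralZ.
      congr torus_integral; apply/funext => y; rewrite /f (psdo_termE _ tu).
      rewrite /c modeD /q; set g := fcoef _ _; set w := two_pi_mn.
      have := modeD (- xi) xi y; rewrite addNr mode0 => E.
      transitivity (mode (- xi) y * mode xi y * (A xi (row_mx x y) * (w * g) *
        (mode k y * p (xi + k) y))); first by ring.
      by rewrite -E; ring.
    apply: ccontM => //; apply: ccontM => //.
    by case: (tp (xi + k)) => /smooth_ccont.
  - by move=> k; rewrite addKr.
  - by move=> k; rewrite addNKr.
have [b sb Hb] := kernel_term_word rho0 (lexx 0) lt01 tA oA op 0 xi [::].
pose f k z := mode (- xi) z * (kernel_term A p 0 xi k (row_mx x z) * u z).
have df z : dominated (fun k => Cu * b k) (f^~ z).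
  split; first exact: sumbddZ.
  move=> k; rewrite cabsM cabs_mode mul1r cabsM mulrC.
  exact: ler_pM (cabs_ge0 _) (cabs_ge0 _) (Hu z) (Hb k (row_mx x z)).
have dk z : dominated b (fun k => kernel_term A p 0 xi k (row_mx x z)).
  by split=> // k; exact: Hb.
have -> : (fun z => mode (- xi) z * (remainder_kernel A p 0 xi (row_mx x z) * u z)) =
   (fun z => lattice_sum (f^~ z)).
  apply/funext => z; rewrite [_ * u z]mulrC mulrA -(csumZ _ (dk z)).
  by congr lattice_sum; apply/funext => k; rewrite /f -mulrA [u z * _]mulrC.
rewrite (csum_torus_integral _ df); last first.
  move=> k; apply: ccontM => //; apply: ccontM => //.
  have tk := kernel_term_smooth tA op 0 xi k.
  by have [/smooth_ccont] := smooth_torus_sectionr x tk.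
congr lattice_sum; apply/funext => k.
have E z : kernel_term A p 0 xi k (row_mx x z) = mode (- k) z * (two_pi_mn (n := n) * F k).
  by rewrite -(comp_term_kernel tA op) (comp_termE tA op).
rewrite /c mulrAC -torus_integralZ; last exact: ccontM.
congr torus_integral; apply/funext => z; rewrite /f E opprD modeD; ring.
Qed.

End Composition.

Unset Implicit Arguments.

Theorem theorem8p2 (R : realType) (n : nat) (m l : R)
    (phi : 'rV[R]_n -> 'rV[int]_n -> R)
    (phi_periodic : forall xi, torus_periodic (fun x => expi (phi x xi))) :
  (forall (a : 'rV[R]_n -> 'rV[R]_n -> 'rV[int]_n -> R[i])
          (p : 'rV[R]_n -> 'rV[int]_n -> R[i]),
     bounded_amplitude m a ->
     symbol_class l 1 0 p ->
     [/\ (* the series defining Tu, Pu, c and TPu converge absolutely *)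
         forall u x, smooth_torus u ->
           [/\ abs_summable (fso_term phi a u x),
               abs_summable (psdo_term p u x) &
               abs_summable (fso_term phi (comp_amplitude a p) u x)],
         forall x z xi, abs_summable (comp_term a p x z xi),
         (* the composition formula, pointwise and in the sense of
            distributions *)
         (forall u, smooth_torus u ->
           smooth_torus (psdo p u) /\
           forall x, fso phi a (psdo p u) x = fso phi (comp_amplitude a p) u x)
         /\
         (forall T : ('rV[R]_n -> R[i]) -> (('rV[R]_n -> R[i]) -> R[i]),
           (forall u, smooth_torus u ->
              torus_distribution (T u) /\
              is_function_distribution (T u) (fso phi a u)) ->
           forall u, smooth_torus u ->
              torus_distribution (T (psdo p u)) /\
              is_function_distribution (T (psdo p u))
                (fso phi (comp_amplitude a p) u)),
         bounded_amplitude (m + l) (comp_amplitude a p) &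
         forall M : nat, bounded_amplitude (m + l - M%:R) (remainder a p M)])
  /\
  (forall (rho delta : R)
          (a : 'rV[R]_n -> 'rV[R]_n -> 'rV[int]_n -> R[i])
          (p : 'rV[R]_n -> 'rV[int]_n -> R[i]),
     0 <= delta -> delta < rho -> rho <= 1 ->
     symbol_class l rho delta p ->
     amplitude_class m rho delta a ->
     (forall x z xi, abs_summable (comp_term a p x z xi)) /\
     amplitude_class (m + l) rho delta (comp_amplitude a p)).
Proof.
split=> [a0 p ba sp|rho delta a0 p delta0 dr rho1 sp ca].
  (* The amplitude is regarded as a family of functions on the torus of dimension 2n, and is used
     below only in the form A xi (x, y). *)
  pose A xi (w : 'rV[R]_(n + n)) := a0 (lsubmx w) (rsubmx w) xi.
  have aE : a0 = (fun x y xi => A xi (row_mx x y)).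
    by apply/funext => x; apply/funext => y; apply/funext => xi;
      rewrite /A row_mxKl row_mxKr.
  have tA := smooth_amplitude_torus ba.1 : forall xi, smooth_torus (A xi).
  clearbody A; subst a0.
  have oA := (bounded_amplitudeP tA m).1 ba.
  have op := symbol_class_order (lexx 0) sp.
  have [r0 d0 d1] : [/\ 0 <= 1 :> R, 0 <= 0 :> R & 0 < 1 :> R] by [].
  have oK M := remainder_kernel_order M r0 d0 d1 tA oA op.
  have tK M := remainder_kernel_smooth r0 d0 d1 tA oA op M.
  (* For rho = 1 and delta = 0 integration by parts costs nothing, so the remainder gains the full
     power M; M = 0 gives the order of c. *)
  have expE M : remainder_exponent m l 1 0 M (2 * n) = m + l - M%:R.
    by rewrite /remainder_exponent subr0 mul1r mul0r addr0.
  have cE : comp_amplitude (fun x y xi => A xi (row_mx x y)) p =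
      (fun x z xi => remainder_kernel A (fun xi x => p x xi) 0 xi (row_mx x z)).
    apply/funext => x; apply/funext => z; apply/funext => xi.
    exact: comp_amplitude_kernel tA op x z xi.
  have oc : family_order (fun _ => True) (fun xi => japanese xi `^ (m + l))
      (fun xi => japanese xi `^ 0) (remainder_kernel A (fun xi x => p x xi) 0).
    by have := oK 0%N; rewrite expE subr0.
  have sP u : smooth_torus u -> smooth_torus (psdo p u).
    by move=> tu; have := psdo_smooth_torus op tu.
  have comp u x : smooth_torus u -> fso phi (fun x y xi => A xi (row_mx x y)) (psdo p u) x =
      fso phi (comp_amplitude (fun x y xi => A xi (row_mx x y)) p) u x.
    move=> tu; congr lattice_sum; apply/funext => xi.
    exact: (fso_term_comp r0 tA oA op).
  split.
  - move=> u x tu; split; first exact: fso_term_summable tA phi u x oA tu.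
      have [b sb Hb] := psdo_term_sumbdd op tu.
      by apply: (@dominated_summable R n b); split=> // xi; exact: Hb.
    by rewrite cE; exact: fso_term_summable (tK 0%N) phi u x oc tu.
  - move=> x z xi; have [b sb Hb] := comp_term_sumbdd r0 d0 d1 tA oA op x z xi.
    by apply: (@dominated_summable R n b).
  - split=> [u tu|T HT u tu]; first by split=> [|x]; [exact: sP|exact: comp].
    (* Both series agree at every point, so the claim is the hypothesis on T at the smooth function
       Pu. *)
    have -> : fso phi (comp_amplitude (fun x y xi => A xi (row_mx x y)) p) u =
        fso phi (fun x y xi => A xi (row_mx x y)) (psdo p u).
      by apply/funext => x; rewrite comp.
    exact: HT (sP u tu).
  - by rewrite cE; exact/(bounded_amplitudeP (tK 0%N)).
  move=> M; have -> : remainder (fun x y xi => A xi (row_mx x y)) p M =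
      (fun x z xi => remainder_kernel A (fun xi x => p x xi) M xi (row_mx x z)).
    apply/funext => x; apply/funext => z; apply/funext => xi.
    exact (remainder_kernelE r0 d0 d1 tA oA op M x z xi).
  by apply/(bounded_amplitudeP (tK M)); rewrite -expE; exact: oK.
pose A xi (w : 'rV[R]_(n + n)) := a0 (lsubmx w) (rsubmx w) xi.
have aE : a0 = (fun x y xi => A xi (row_mx x y)).
  by apply/funext => x; apply/funext => y; apply/funext => xi;
    rewrite /A row_mxKl row_mxKr.
have tA := smooth_amplitude_torus ca.1 : forall xi, smooth_torus (A xi).
clearbody A; subst a0.
have oA := (amplitude_classP m rho delta0 tA).1 ca.
have op := symbol_class_order delta0 sp.
have rho0 := ltW (le_lt_trans delta0 dr); have delta1 := lt_le_trans dr rho1.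
have oA0 := symbol_order_family oA.
split=> [x z xi|].
  have [b sb Hb] := comp_term_sumbdd rho0 delta0 delta1 tA oA0 op x z xi.
  by apply: (@dominated_summable R n b).
have -> : comp_amplitude (fun x y xi => A xi (row_mx x y)) p =
    (fun x z xi => remainder_kernel A (fun xi x => p x xi) 0 xi (row_mx x z)).
  apply/funext => x; apply/funext => z; apply/funext => xi.
  exact: comp_amplitude_kernel tA op x z xi.
have oC := comp_kernel_symbol delta0 dr rho1 oA op.
exact/(amplitude_classP (m + l) rho delta0 oC.1).
Qed.
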